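(* Let $\alpha,\beta\in(0,1)$ be constants and consider the rank-1 heterogeneous random graph on $[n]$ with $w_{ij}=w_iw_j$ for $i\neq j$, where $w_i\in[\beta,1]$. Let $\mathcal{T}_n=\sum_{i<j<k}\frac{A_{ij}A_{jk}A_{ki}}{d_id_jd_k}$ be its sum of weighted triangles, and let $v_n^2=v_{1n}^2+v_{2n}^2$ with $v_{1n}^2,v_{2n}^2$ as defined in the context. Then, as $n\to\infty$, \[\frac{\mathcal{T}_n-\mathbb{E}[\mathcal{T}_n]}{v_n}\Rightarrow\mathcal{N}(0,1),\] where $v_n^2=\frac{n^3}{6w^6p_n^3}(1+o(1))$ and $w=\sum_{i}w_i$. Especially, for the Erdős–Rényi random graph $\mathcal{G}_n(\alpha)$ (the case $w_{ij}=c$ for all $i<j$, with a constant $c\in(0,1)$), $v_n^2=\frac{1}{6n^{3(1-\alpha)}}(1+o(1))$.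
   Context: Model: $\alpha,\beta\in(0,1)$ are fixed and $p_n=n^{-\alpha}$. The random undirected graph on $[n]=\{1,\dots,n\}$ has symmetric $0/1$ adjacency matrix $A$, $A_{ii}=0$, where $A_{ij}$ ($1\le i<j\le n$) are independent with $\mathbb{P}(A_{ij}=1)=p_nw_{ij}$, $w_{ij}=w_{ji}$, $w_{ii}=0$. The rank-1 heterogeneous random graph is the case $w_{ij}=w_iw_j$ ($i\ne j$) with $w_1,\dots,w_n\in[\beta,1]$. The Erdős–Rényi random graph $\mathcal{G}_n(\alpha)$ is the case $w_{ij}=c$ ($1\le i<j\le n$) for a constant $c\in(0,1)$. Degrees: $d_i=\sum_jA_{ij}$. In $\mathcal{T}_n$ a summand is set to zero if $d_id_jd_k=0$. Put $\mu_{ij}=p_nw_{ij}$ for $i\ne j$, $\mu_{ii}=0$, $\mu_i=\sum_j\mu_{ij}$, \[\eta_i=\sum_{j\neq k}\frac{\mu_{ij}\mu_{jk}\mu_{ki}}{\mu_i^2\mu_j\mu_k},\qquad \gamma_{ij}=\sum_{k\notin\{i,j\}}\frac{\mu_{jk}\mu_{ki}}{\mu_i\mu_j\mu_k},\] \[v_{1n}^2=\sum_{i<j<k}\frac{\mu_{ij}(1-\mu_{ij})\mu_{jk}(1-\mu_{jk})\mu_{ki}(1-\mu_{ki})}{\mu_i^2\mu_j^2\mu_k^2},\qquad v_{2n}^2=\sum_{i<j}\left(\gamma_{ij}-\frac{\eta_i+\eta_j}{2}\right)^2\mu_{ij}(1-\mu_{ij}),\] with sums over $j\ne k$ being over ordered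 pairs of distinct indices. $\Rightarrow\mathcal{N}(0,1)$ denotes convergence in distribution to the standard normal law.
   Formalization: For the Erdős–Rényi graph with w_ij = c, the printed v_n² = 1/(6n^{3(1-α)})(1+o(1)) is false for every c in (0,1); the formal statement proves the corrected v_n² = 1/(6c³n^{3(1-α)})(1+o(1)) for 0 < c ≤ 1. *)

(* Defs.v *)
From HB Require Import structures.
From mathcomp Require Import all_boot all_order all_algebra.
From mathcomp Require Import all_classical all_reals all_analysis.
From mathcomp Require Import measurable_realfun.

Set Implicit Arguments.
Unset Strict Implicit.
Unset Printing Implicit Defensive.

Import Order.TTheory GRing.Theory Num.Theory.
Import numFieldNormedType.Exports.

Local Open Scope classical_set_scope.
Local Open Scope ring_scope.

(* Mutual independence of the finite family (X i)_(i | D i): the product rule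
   for all subfamilies and all measurable sets. *)
Definition mutually_independent d d' (T : measurableType d)
    (T' : measurableType d') (R : realType) (P : probability T R)
    (I : finType) (D : pred I) (X : I -> {RV P >-> T'}) : Prop :=
  forall (J : {set I}) (B : I -> set T'),
    (forall i, i \in J -> D i) ->
    (forall i, i \in J -> measurable (B i)) ->
    P (\big[setI/setT]_(i in J) (X i @^-1` B i)) =
    (\prod_(i in J) fine (P (X i @^-1` B i)))%:E.

Arguments mutually_independent {d d' T T' R} P {I} D X.

(* The X n may live on different probability spaces; their cumulative
   distribution functions converge to that of nu wherever the latter is
   continuous. *)
Definition cvg_in_distribution (R : realType) (d : nat -> measure_display)
    (T : forall n, measurableType (d n)) (P : forall n, probability (T n) R)
    (X : forall n, {RV (P n) >-> R}) (nu : probability (measurableTypeR R) R) : Prop :=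
  forall t : R,
    {for t, continuous (fun s : R => nu `]-oo, s]%classic)} ->
    cdf (X n) t @[n --> \oo] --> nu `]-oo, t]%classic.

Arguments cvg_in_distribution {R d T} P X nu.

Section model.
Context {R : realType}.

Definition p_ (alpha : R) (n : nat) : R := n%:R `^ (- alpha).

Definition rank1_weights n (w : 'I_n -> R) : 'M[R]_n :=
  \matrix_(i, j) (if i == j then 0 else w i * w j).

Definition er_weights n (c : R) : 'M[R]_n :=
  \matrix_(i, j) (if i == j then 0 else c).

(* mu_ij = p_n w_ij *)
Definition edge_prob (alpha : R) n (W : 'M[R]_n) : 'M[R]_n := p_ alpha n *: W.

Section variance.
Context {n : nat} (mu : 'M[R]_n).

Definition mean_deg (i : 'I_n) : R := \sum_j mu i j.

Definition eta (i : 'I_n) : R :=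
  \sum_j \sum_(k | k != j)
    (mu i j * mu j k * mu k i)
    / (mean_deg i ^+ 2 * mean_deg j * mean_deg k).

Definition gamma (i j : 'I_n) : R :=
  \sum_(k | (k != i) && (k != j))
    (mu j k * mu k i) / (mean_deg i * mean_deg j * mean_deg k).

Definition v1_sq : R :=
  \sum_(i < n) \sum_(j < n | (i < j)%N) \sum_(k < n | (j < k)%N)
    (mu i j * (1 - mu i j) * (mu j k * (1 - mu j k))
     * (mu k i * (1 - mu k i)))
    / (mean_deg i ^+ 2 * mean_deg j ^+ 2 * mean_deg k ^+ 2).

Definition v2_sq : R :=
  \sum_(i < n) \sum_(j < n | (i < j)%N)
    (gamma i j - (eta i + eta j) / 2) ^+ 2 * (mu i j * (1 - mu i j)).

Definition v_sq : R := v1_sq + v2_sq.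

End variance.

Section graph.
Context {d : measure_display} {T : measurableType d} (P : probability T R).
Context {n : nat} (A : 'I_n -> 'I_n -> {RV P >-> bool}).

Record random_graph (mu : 'M[R]_n) : Prop := RandomGraph {
  adj_sym : forall i j x, A i j x = A j i x;
  adj_irr : forall i x, A i i x = false;
  adj_prob : forall i j : 'I_n, (i < j)%N ->
    P [set x | A i j x] = (mu i j)%:E;
  adj_indep : mutually_independent P
    (fun e : 'I_n * 'I_n => (e.1 < e.2)%N)
    (fun e => A e.1 e.2) }.

Definition deg (i : 'I_n) (x : T) : nat := (\sum_j A i j x)%N.

(* If deg i * deg j * deg k = 0 the summand is 0, since 0^-1 = 0. *)
Definition weighted_triangles (x : T) : R :=
  \sum_(i < n) \sum_(j < n | (i < j)%N) \sum_(k < n | (j < k)%N)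
    (A i j x * A j k x * A k i x)%:R / (deg i x * deg j x * deg k x)%:R.

(* fine loses nothing: weighted_triangles is bounded, so its expectation is
   finite. *)
Definition standardized_triangles (v : R) (x : T) : R :=
  (weighted_triangles x - fine 'E_P[weighted_triangles]%E) / v.

Let measurable_adj (F : {ffun 'I_n * 'I_n -> bool} -> R) :
  measurable_fun setT (fun x => F [ffun e => A e.1 e.2 x]).
Proof.
pose h (a : {ffun 'I_n * 'I_n -> bool}) x : R :=
  F a * \prod_(e : 'I_n * 'I_n) (A e.1 e.2 x == a e)%:R.
rewrite (_ : (fun x => _) =
    fun x => \sum_(a : {ffun 'I_n * 'I_n -> bool}) h a x); last first.
  apply/funext => x; rewrite (bigD1 [ffun e => A e.1 e.2 x]) //= /h.
  rewrite big1 ?mulr1; last by move=> e _; rewrite ffunE eqxx.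
  rewrite big1 ?addr0// => a; rewrite eq_sym => aA.
  have [e Ae] : exists e : 'I_n * 'I_n, A e.1 e.2 x != a e.
    apply/existsP; apply: contraNT aA; rewrite negb_exists => /forallP Aa.
    by apply/eqP/ffunP => e; rewrite ffunE; apply/eqP; rewrite -[_ == _]negbK.
  by rewrite (bigD1 e)//= (negbTE Ae) mul0r mulr0.
apply: measurable_sum => a; apply: measurable_funM => //.
apply: measurable_prod => e _.
apply: (@measurableT_comp _ _ _ _ _ _ (fun b : bool => (b == a e)%:R : R)) => //.
Qed.

Lemma measurable_weighted_triangles :
  measurable_fun setT weighted_triangles.
Proof.
pose F (a : {ffun 'I_n * 'I_n -> bool}) : R :=
  \sum_(i < n) \sum_(j < n | (i < j)%N) \sum_(k < n | (j < k)%N)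
    (a (i, j) * a (j, k) * a (k, i))%:R
    / ((\sum_l a (i, l)) * (\sum_l a (j, l)) * (\sum_l a (k, l)))%:R.
rewrite (_ : weighted_triangles = fun x => F [ffun e => A e.1 e.2 x]).
  exact: (measurable_adj F).
apply/funext => x /=; rewrite /weighted_triangles /F.
apply: eq_bigr => i _; apply: eq_bigr => j _; apply: eq_bigr => k _; rewrite !ffunE /=.
have degE m : deg m x = (\sum_l [ffun e => A e.1 e.2 x] (m, l))%N.
  by apply: eq_bigr => l _; rewrite ffunE.
by rewrite -!degE.
Qed.

Lemma measurable_standardized_triangles v :
  measurable_fun setT (standardized_triangles v).
Proof.
apply: measurable_funM => //; apply: measurable_funB => //.
exact: measurable_weighted_triangles.
Qed.

HB.instance Definition _ := isMeasurableFun.Build _ _ _ _ weighted_triangles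
  measurable_weighted_triangles.

HB.instance Definition _ v := isMeasurableFun.Build _ _ _ _
  (standardized_triangles v) (measurable_standardized_triangles v).

End graph.
End model.

Arguments random_graph {R d T} P {n} A mu.
Arguments weighted_triangles {R d T} P {n} A x.
Arguments standardized_triangles {R d T} P {n} A v x.

(* Main.v *)
Require Import Defs.
From HB Require Import structures.
From mathcomp Require Import all_boot all_order all_algebra.
From mathcomp Require Import ring lra zify.

Set Implicit Arguments.
Unset Strict Implicit.
Unset Printing Implicit Defensive.

Import Order.TTheory GRing.Theory Num.Theory.

Local Open Scope ring_scope.

(** Notation: [W] is the sum of the weights, [m i = p w_i W], [M = p W^2], [L = n p]. All mean
    degrees are of order [L]. The claim is that the fluctuations come from centred triangles alone.
    With [Z = A - mu], let [lintri] be the sum of [Z_xy Z_yz Z_zx / (m x m y m z)] over triangles.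
    Its variance is [n^3 / (6 W^6 p^3)] up to a factor tending to 1, hence of order [L^-3].

    Remainder. Adding the edge ij creates a triangle over each common neighbour, but it also raises
    the degrees of i and j and so lowers the weight of the triangles already there, by about
    [1 / (2 M)] at each end. Since [mu_ij = m i m j / M], the lower-order terms in the expansion of
    [Z_iz Z_jz] collapse to degrees, and their typical value cancels this loss. The discrete
    derivative of [wtri - lintri] therefore consists of deviations and one small constant
    ([cdiff_remainder]). Their second moments ([Ex_cdiff_remainder]) are summed by the Efron-Stein
    inequality ([efron_stein]), so that the remainder has variance of order [L^-3 (p + 1/L)]
    ([var_remainder]). This is negligible because [p = n^-alpha] tends to 0 and [L = n^(1-alpha)] to
    infinity. The same cancellation makes the second part of the variance negligible: every gamma_ij
    and every eta_i lies in one interval near [1 / M] of relative width O(1/n) ([bounds_gap],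
    [v2_bounds], [v_bounds]).

    Leading term. The derivative [ycod x y] of [lintri] at xy does not involve the edge xy, and
    [6 * lintri] is the sum of [Z_xy * ycod x y] over ordered pairs. Integration by parts and a
    Taylor expansion turn [E[f'(sT) - sT f(sT)]], with [T = lintri], into [E[f'(sT) (1 - s^2 V)]]
    plus an error governed by fourth moments of [ycod] ([stein_bound]). Here [V = vsum] has mean
    [E[T^2]], and a second use of Efron-Stein shows that it concentrates ([var_vsum]).

    Normal limit. Stein's equation is solved for compactly supported Lipschitz functions of Gaussian
    integral 0 ([stein_solution]). Subtracting a multiple of a wide plateau removes the integral
    condition ([stein_compact]), and trapezoids sandwich the indicator of a half-line ([stein_cdf]).
    Everything up to there concerns a finite product measure; [expectation_graph] carries it to an
    arbitrary probability space. The Erdős-Rényi graph is the rank-1 graph with all weights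
    [sqrt c], whence the factor [c ^+ 3] in its asymptotics, which equals 1 at [c = 1]. *)

(** * Finite product Bernoulli measures: conditional means, Efron-Stein, integration by parts *)

Section bernoulli_product.
Context {R : realFieldType} {I : finType} (q : I -> R).
Notation cfg := {ffun I -> bool}.
Implicit Types (a b : cfg) (e : I) (F G : cfg -> R) (S : pred I).

Definition weight a : R := \prod_e (if a e then q e else 1 - q e).

Definition Ex F : R := \sum_a weight a * F a.

Definition upd a e c : cfg := [ffun x => if x == e then c else a x].

Definition cdiff e F a : R := F (upd a e true) - F (upd a e false).

(** Conditional expectation given all coordinates other than [e]. *)
Definition cmean e F a : R :=
  q e * F (upd a e true) + (1 - q e) * F (upd a e false).

(** Measurability with respect to the coordinates in [S]. *)
Definition dep S F : Prop :=
  forall a b, (forall x, S x -> a x = b x) -> F a = F b.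

Definition evar e : R := q e * (1 - q e).

Lemma eq_Ex F G : (forall a, F a = G a) -> Ex F = Ex G.
Proof. by move=> FG; apply: eq_bigr => a _; rewrite FG. Qed.

Lemma ExD F G : Ex (fun a => F a + G a) = Ex F + Ex G.
Proof. by rewrite -big_split; apply: eq_bigr => a _; rewrite mulrDr. Qed.

Lemma ExZ c F : Ex (fun a => c * F a) = c * Ex F.
Proof. by rewrite mulr_sumr; apply: eq_bigr => a _; rewrite mulrCA. Qed.

Lemma ExZr c F : Ex (fun a => F a * c) = Ex F * c.
Proof. by rewrite mulr_suml; apply: eq_bigr => a _; rewrite mulrA. Qed.

Lemma ExB F G : Ex (fun a => F a - G a) = Ex F - Ex G.
Proof.
rewrite -mulN1r -ExZ -ExD; apply: eq_Ex => a; by rewrite mulN1r.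
Qed.

Lemma Ex_sum (J : Type) (r : seq J) (P : pred J) (F : J -> cfg -> R) :
  Ex (fun a => \sum_(j <- r | P j) F j a) = \sum_(j <- r | P j) Ex (F j).
Proof.
by rewrite exchange_big/=; apply: eq_bigr => a _; rewrite mulr_sumr.
Qed.

Lemma Ex_cst c : Ex (fun=> c) = c.
Proof.
rewrite -[LHS]mulr_suml -[RHS]mul1r; congr (_ * c).
rewrite /weight -(bigA_distr_bigA (fun e (c : bool) => if c then q e else 1 - q e)) big1// => e _.
by rewrite big_bool /=; ring.
Qed.

Lemma updE a e c x : upd a e c x = if x == e then c else a x.
Proof. by rewrite ffunE. Qed.

Lemma upd_upd a e c c' : upd (upd a e c) e c' = upd a e c'.
Proof. by apply/ffunP => x; rewrite !ffunE; case: eqP. Qed.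

Lemma upd_id a e : upd a e (a e) = a.
Proof. by apply/ffunP => x; rewrite !ffunE; case: eqP => [->|]. Qed.

Lemma updC a e e' c c' : e != e' -> upd (upd a e c) e' c' = upd (upd a e' c') e c.
Proof.
move=> ee'; apply/ffunP => x; rewrite !ffunE.
by case: eqP => [->|//]; rewrite eq_sym (negbTE ee').
Qed.

(** Configurations are paired by flipping the coordinate [e], each pair being indexed by its member
    with [a e = true]. *)
Lemma sum_cfg_split e F :
  \sum_a F a = \sum_(a : cfg | a e) (F a + F (upd a e false)).
Proof.
rewrite (bigID (fun a : cfg => a e))/= big_split/=; congr (_ + _).
rewrite (reindex_onto (fun a => upd a e false) (fun a => upd a e true)); last first.
  by move=> a /negbTE aE; rewrite upd_upd -aE upd_id.
apply: eq_bigl => a; rewrite updE eqxx/= upd_upd.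
by apply/eqP/idP => [<-|aE]; [rewrite updE eqxx|rewrite -[in RHS](upd_id a e) aE].
Qed.

Lemma Ex_cmean e F : Ex (cmean e F) = Ex F.
Proof.
rewrite /Ex (sum_cfg_split e) [RHS](sum_cfg_split e); apply: eq_bigr => a ae.
rewrite /cmean !upd_upd.
have E : upd a e true = a by rewrite -ae upd_id.
have W b : weight b = (if b e then q e else 1 - q e) *
    \prod_(x | x != e) (if b x then q x else 1 - q x) by rewrite /weight (bigD1 e).
rewrite E !W updE eqxx ae.
have -> : \prod_(x | x != e) (if upd a e false x then q x else 1 - q x) =
    \prod_(x | x != e) (if a x then q x else 1 - q x).
  by apply: eq_bigr => x xe; rewrite updE (negbTE xe).
by ring.
Qed.

Section bounds.
Hypothesis q01 : forall e, 0 <= q e <= 1.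

Lemma weight_ge0 a : 0 <= weight a.
Proof.
apply: prodr_ge0 => e _; have /andP[? ?] := q01 e.
by case: ifP; rewrite ?subr_ge0.
Qed.

Lemma le_Ex F G : (forall a, F a <= G a) -> Ex F <= Ex G.
Proof. by move=> FG; apply: ler_sum => a _; rewrite ler_wpM2l// weight_ge0. Qed.

Lemma Ex_ge0 F : (forall a, 0 <= F a) -> 0 <= Ex F.
Proof. by move=> F0; rewrite -(Ex_cst 0) le_Ex. Qed.

Lemma evar_ge0 e : 0 <= evar e.
Proof. by have /andP[? ?] := q01 e; rewrite mulr_ge0// subr_ge0. Qed.

Lemma evar_le e : evar e <= q e.
Proof. by have /andP[? ?] := q01 e; rewrite /evar ler_piMr// gerBl. Qed.

End bounds.

(** Total variance at one coordinate: conditionally on the others, [F] takes two values that differ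
    by [cdiff e F], so its conditional variance is [evar e * cdiff e F ^+ 2]. *)
Lemma Ex_cmean_sq e F :
  Ex (fun a => F a ^+ 2) =
  Ex (fun a => cmean e F a ^+ 2) + evar e * Ex (fun a => cdiff e F a ^+ 2).
Proof.
rewrite -(Ex_cmean e) -ExZ -ExD; apply: eq_Ex => a.
by rewrite /cmean /cdiff /evar; ring.
Qed.

Lemma dep_cmean S e F : dep S F -> dep (fun x => S x && (x != e)) (cmean e F).
Proof.
move=> SF a b ab; rewrite /cmean; congr (_ * _ + _ * _); apply: SF => x Sx;
by rewrite !updE; case: eqP => // /eqP xe; rewrite ab// Sx.
Qed.

(** Averaging out coordinates one at a time; along an enumeration of [I] this is the Doob martingale
    that leads from [F] to [Ex F]. *)
Let cmeans s F := foldr cmean F s.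

Lemma Ex_cmeans s F : Ex (cmeans s F) = Ex F.
Proof. by elim: s => //= e s IH; rewrite Ex_cmean. Qed.

Lemma cmeans_all F a : cmeans (enum I) F a = Ex F.
Proof.
rewrite -(Ex_cmeans (enum I)).
have dep0 s : dep [predC s] (cmeans s F).
  elim: s => [|e s IH] /=; first by move=> b c bc; congr F; apply/ffunP => x; apply: bc.
  move=> b c bc; apply: (dep_cmean IH) => x /= /andP[xs xe]; apply: bc.
  by rewrite !inE negb_or xe.
rewrite -[LHS]Ex_cst; apply: eq_Ex => b; apply: dep0 => x.
by rewrite inE mem_enum.
Qed.

Lemma cdiff_cmean_ne e x F a : x != e -> cdiff e (cmean x F) a = cmean x (cdiff e F) a.
Proof.
move=> xe; have ex : e != x by rewrite eq_sym.
by rewrite /cdiff /cmean !(updC _ _ _ ex); ring.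
Qed.

Lemma cdiff_cmean_eq e F a : cdiff e (cmean e F) a = 0.
Proof. by rewrite /cdiff /cmean !upd_upd subrr. Qed.

Section efron_stein.
Hypothesis q01 : forall e, 0 <= q e <= 1.

Lemma Ex_cmean_sq_le e F : Ex (fun a => cmean e F a ^+ 2) <= Ex (fun a => F a ^+ 2).
Proof.
rewrite [leRHS](Ex_cmean_sq e) lerDl mulr_ge0 ?evar_ge0// Ex_ge0// => a.
exact: sqr_ge0.
Qed.

(** Averaging over another coordinate commutes with [cdiff e] and contracts the second moment;
    averaging over [e] itself kills the derivative. *)
Let cdiff_cmeans_le e s F :
  Ex (fun a => cdiff e (cmeans s F) a ^+ 2) <= Ex (fun a => cdiff e F a ^+ 2).
Proof.
elim: s => [//|x s IH] /=; apply: le_trans IH; have [->|xe] := eqVneq x e.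
  rewrite [leLHS](@eq_Ex _ (fun=> 0)); last by move=> a; rewrite cdiff_cmean_eq expr0n.
  by rewrite Ex_cst Ex_ge0// => a; exact: sqr_ge0.
rewrite [leLHS](@eq_Ex _ (fun a => cmean x (cdiff e (cmeans s F)) a ^+ 2)); last first.
  by move=> a; rewrite cdiff_cmean_ne.
exact: Ex_cmean_sq_le.
Qed.

(** Telescope [Ex_cmean_sq] along the enumeration of the coordinates. Each increment involves the
    derivative of a partially averaged [F], which [cdiff_cmeans_le] bounds by the derivative of
    [F]. *)
Theorem efron_stein F :
  Ex (fun a => (F a - Ex F) ^+ 2) <=
  \sum_e evar e * Ex (fun a => cdiff e F a ^+ 2).
Proof.
have main s : Ex (fun a => F a ^+ 2) <= Ex (fun a => cmeans s F a ^+ 2) +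
    \sum_(e <- s) evar e * Ex (fun a => cdiff e F a ^+ 2).
  elim: s => [|e s IH] /=; first by rewrite big_nil addr0.
  apply: (le_trans IH); rewrite big_cons addrA lerD2r (Ex_cmean_sq e) lerD2l.
  by rewrite ler_wpM2l ?evar_ge0.
have := main (enum I); rewrite big_enum/=.
rewrite [X in _ <= X + _ -> _](_ : _ = Ex F ^+ 2); last first.
  by rewrite -[RHS]Ex_cst; apply: eq_Ex => a; rewrite cmeans_all.
rewrite -lerBlDl; apply: le_trans.
rewrite (@eq_Ex (fun a => (F a - Ex F) ^+ 2)
  (fun a => F a ^+ 2 + ((- 2 * Ex F) * F a + Ex F ^+ 2))); last by move=> a; ring.
by rewrite ExD ExD ExZ Ex_cst le_eqVlt; apply/orP; left; apply/eqP; ring.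
Qed.

End efron_stein.

Definition centered e a : R := (a e)%:R - q e.

(* Discrete integration by parts. *)
Lemma Ex_centered e F :
  Ex (fun a => centered e a * F a) = evar e * Ex (cdiff e F).
Proof.
rewrite -(Ex_cmean e) -ExZ; apply: eq_Ex => a.
by rewrite /cmean /centered /cdiff /evar !updE eqxx/=; ring.
Qed.

Lemma Ex_coord e F :
  Ex (fun a => (a e)%:R * F a) = q e * Ex (fun a => F (upd a e true)).
Proof.
rewrite -(Ex_cmean e) -ExZ; apply: eq_Ex => a.
by rewrite /cmean !updE eqxx/=; ring.
Qed.

Lemma dep_upd S F a e c : dep S F -> ~~ S e -> F (upd a e c) = F a.
Proof.
move=> SF Se; apply: SF => x Sx; rewrite updE; case: eqP => // xe.
by rewrite xe (negbTE Se) in Sx.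
Qed.

Lemma cdiff_dep S F e a : dep S F -> ~~ S e -> cdiff e F a = 0.
Proof. by move=> SF Se; rewrite /cdiff !(dep_upd _ _ SF Se) subrr. Qed.

Lemma dep_sub (S T : pred I) F : (forall x, S x -> T x) -> dep S F -> dep T F.
Proof. by move=> ST SF a b ab; apply: SF => x /ST; exact: ab. Qed.

Lemma dep_cst S c : dep S (fun=> c).
Proof. by []. Qed.

Lemma depM S F G : dep S F -> dep S G -> dep S (fun a => F a * G a).
Proof. by move=> SF SG a b ab; rewrite (SF a b ab) (SG a b ab). Qed.

Lemma dep_sum S (J : Type) (r : seq J) (P : pred J) (F : J -> cfg -> R) :
  (forall j, P j -> dep S (F j)) -> dep S (fun a => \sum_(j <- r | P j) F j a).
Proof. by move=> SF a b ab; apply: eq_bigr => j /SF; exact. Qed.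

(* Two independent copies a, b exchange their coordinates in T. *)
Lemma Ex_indep (S T : pred I) F G : dep S F -> dep T G ->
  (forall x, S x -> T x -> False) ->
  Ex (fun a => F a * G a) = Ex F * Ex G.
Proof.
move=> SF TG ST.
pose mix (a b : cfg) : cfg := [ffun x => if T x then b x else a x].
rewrite /Ex mulr_suml; under [RHS]eq_bigr do rewrite mulr_sumr.
rewrite pair_big/=.
have mixK a b : mix (mix a b) (mix b a) = a.
  by apply/ffunP => x; rewrite !ffunE; case: (T x).
rewrite (reindex_onto (fun p : cfg * cfg => (mix p.1 p.2, mix p.2 p.1))
   (fun p : cfg * cfg => (mix p.1 p.2, mix p.2 p.1)))/=; last first.
  by move=> [a b] _ /=; rewrite !mixK.
rewrite [RHS](eq_bigl xpredT); last by move=> p; rewrite /= !mixK -surjective_pairing eqxx.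
rewrite -(pair_bigA _ (fun a b => weight (mix a b) * F (mix a b) *
  (weight (mix b a) * G (mix b a))))/=.
apply: eq_bigr => a _; rewrite -[LHS]Ex_cst /Ex; apply: eq_bigr => b _.
have -> : F (mix a b) = F a.
  by apply: SF => x Sx; rewrite ffunE; case: ifP => // /(ST x Sx).
have -> : G (mix b a) = G a by apply: TG => x Tx; rewrite ffunE Tx.
have wE : weight (mix a b) * weight (mix b a) = weight a * weight b.
  rewrite /weight -!big_split/=; apply: eq_bigr => x _; rewrite !ffunE.
  by case: (T x) => //; rewrite mulrC.
by rewrite mulrACA wE; ring.
Qed.

End bernoulli_product.

(** * Second moments of linear forms in centred coordinates *)

Section orthogonality.
Context {R : realFieldType} {I : finType} (q : I -> R).
Notation cfg := {ffun I -> bool}.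
Notation Ex := (Ex q).
Implicit Types (a b : cfg) (e : I) (F G : cfg -> R).

Definition nodep e F : Prop := forall a c, F (upd a e c) = F a.

Lemma dep_nodep (S : pred I) F e : dep S F -> ~~ S e -> nodep e F.
Proof. by move=> SF Se a b; apply: dep_upd SF Se. Qed.

Lemma cdiff_nodep e F a : nodep e F -> cdiff e F a = 0.
Proof. by move=> eF; rewrite /cdiff !eF subrr. Qed.

Lemma cdiffMl e F G a : nodep e G -> cdiff e (fun a => G a * F a) a = G a * cdiff e F a.
Proof. by move=> eG; rewrite /cdiff !eG mulrBr. Qed.

Lemma cdiff_sum e (J : Type) (r : seq J) (P : pred J) (F : J -> cfg -> R) a :
  cdiff e (fun a => \sum_(j <- r | P j) F j a) a =
  \sum_(j <- r | P j) cdiff e (F j) a.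
Proof. by rewrite /cdiff -sumrB. Qed.

Lemma cdiffZ e c F a : cdiff e (fun a => c * F a) a = c * cdiff e F a.
Proof. by rewrite /cdiff mulrBr. Qed.

Lemma cdiff_centered e a : cdiff e (centered q e) a = 1.
Proof. by rewrite /cdiff /centered !updE eqxx/=; ring. Qed.

Lemma nodep_centered e e' : e' != e -> nodep e (centered q e').
Proof. by move=> ee a b; rewrite /centered updE (negbTE ee). Qed.

Lemma nodepM e F G : nodep e F -> nodep e G -> nodep e (fun a => F a * G a).
Proof. by move=> eF eG a b; rewrite eF eG. Qed.

Lemma nodep_sum e (J : Type) (r : seq J) (P : pred J) (F : J -> cfg -> R) :
  (forall j, P j -> nodep e (F j)) -> nodep e (fun a => \sum_(j <- r | P j) F j a).
Proof. by move=> SF a b; apply: eq_bigr => j /SF ->. Qed.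

Lemma Ex_centered_sq e F : nodep e F ->
  Ex (fun a => centered q e a ^+ 2 * F a) = evar q e * Ex F.
Proof.
move=> eF; rewrite -(Ex_cmean q e) -ExZ; apply: eq_Ex => a.
by rewrite /cmean /centered !eF !updE eqxx/= /evar; ring.
Qed.

(** No coefficient [G j] involves any of the coordinates [c k], so conditionally on the rest this is
    a linear form in independent centred variables and its terms are orthogonal. The proof
    integrates by parts in each [c j]. *)
Lemma Ex_sq_sum_centered (J : finType) (P : pred J) (c : J -> I)
    (G : J -> cfg -> R) :
  {in P &, injective c} ->
  (forall j k, P j -> P k -> nodep (c k) (G j)) ->
  Ex (fun a => (\sum_(j | P j) centered q (c j) a * G j a) ^+ 2) =
  \sum_(j | P j) evar q (c j) * Ex (fun a => G j a ^+ 2).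
Proof.
move=> cI cG; pose W a := \sum_(j | P j) centered q (c j) a * G j a.
rewrite (@eq_Ex _ _ _ _ (fun a => \sum_(j | P j) centered q (c j) a * (G j a * W a))); last first.
  by move=> a; rewrite expr2 -/(W a) {1}/W mulr_suml; apply: eq_bigr => j _; rewrite mulrA.
rewrite Ex_sum; apply: eq_bigr => j Pj; rewrite Ex_centered; congr (_ * _).
apply: eq_Ex => a; rewrite cdiffMl; last exact: cG.
rewrite expr2; congr (_ * _); rewrite cdiff_sum (bigD1 j)//= big1 ?addr0; last first.
  move=> k /andP[Pk kj]; apply: cdiff_nodep; apply: nodepM; last exact: cG.
  by apply: nodep_centered; apply: contra kj => /eqP/cI->.
rewrite (_ : cdiff _ _ a = cdiff (c j) (fun a => G j a * centered q (c j) a) a); last first.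
  by rewrite /cdiff ![centered _ _ _ * _]mulrC.
by rewrite cdiffMl ?cdiff_centered ?mulr1//; exact: cG.
Qed.

End orthogonality.

(** * Negative moments of Bernoulli counts *)

Section count.
Context {R : realFieldType} {I : finType} (q : I -> R).
Notation cfg := {ffun I -> bool}.
Notation Ex := (Ex q).
Hypothesis q01 : forall e, 0 <= q e <= 1.
Variable J : pred I.

Definition cnt (a : cfg) : nat := (\sum_(e | J e) a e)%N.
Notation lam := (\sum_(e | J e) q e).

Lemma cntE a : (cnt a)%:R = \sum_(e | J e) (a e)%:R :> R.
Proof. by rewrite /cnt natr_sum. Qed.

Lemma Ex_cnt : Ex (fun a => (cnt a)%:R) = lam.
Proof.
rewrite (@eq_Ex _ _ _ _ (fun a => \sum_(e | J e) (a e)%:R * 1)); last first.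
  by move=> a; rewrite cntE; apply: eq_bigr => e _; rewrite mulr1.
by rewrite Ex_sum; apply: eq_bigr => e _; rewrite Ex_coord Ex_cst mulr1.
Qed.

Lemma Ex_cnt_var : Ex (fun a => ((cnt a)%:R - lam) ^+ 2) <= lam.
Proof.
rewrite (@eq_Ex _ _ _ _ (fun a => (\sum_(e | J e) centered q e a * 1) ^+ 2)); last first.
  move=> a; rewrite cntE -sumrB; congr (_ ^+ 2); apply: eq_bigr => e _.
  by rewrite mulr1.
rewrite (@Ex_sq_sum_centered _ _ _ _ J id (fun _ _ => 1))//.
by apply: ler_sum => e _; rewrite expr1n Ex_cst mulr1 evar_le.
Qed.

(** Conditioning on [a e = 1] replaces the count by at most [cnt a + 1], and [g] is antitone. Each
    application to a negative power gains one factor [lam^-1]; this drives all the bounds below. *)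
Lemma size_bias (g : nat -> R) : (forall m n, (m <= n)%N -> g n <= g m) ->
  lam * Ex (fun a => g (cnt a).+1) <= Ex (fun a => (cnt a)%:R * g (cnt a)).
Proof.
move=> gA.
rewrite (@eq_Ex _ _ _ (fun a => (cnt a)%:R * g (cnt a))
   (fun a => \sum_(e | J e) (a e)%:R * g (cnt a))); last first.
  by move=> a; rewrite cntE mulr_suml.
rewrite Ex_sum mulr_suml; apply: ler_sum => e Je; rewrite Ex_coord.
apply: ler_wpM2l; first by have /andP[] := q01 e.
apply: le_Ex => // a; apply: gA.
rewrite /cnt (bigD1 e)//= [X in (_ <= X.+1)%N](bigD1 e)//= updE eqxx add1n ltnS.
rewrite (eq_bigr (fun e => nat_of_bool (a e))); first exact: leq_addl.
by move=> x /andP[_ /negbTE xe]; rewrite updE xe.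
Qed.

Hypothesis lam0 : 0 < lam.

(** The reciprocal of [max x 1]: antitone also at 0, where [x%:R^-1] would be 0. *)
Let inv1 (x : nat) : R := (x.-1.+1)%:R^-1.

Let inv1_gt0 x : 0 < inv1 x. Proof. by rewrite invr_gt0 ltr0Sn. Qed.

Let inv1_anti m n : (m <= n)%N -> inv1 n <= inv1 m.
Proof.
move=> mn; rewrite lef_pV2 ?posrE ?ltr0Sn// ler_nat ltnS.
by case: m mn => // m; case: n.
Qed.

Let inv1_mul x : x%:R * inv1 x <= 1.
Proof.
case: x => [|x]; first by rewrite mul0r ler01.
by rewrite mulfV// pnatr_eq0.
Qed.

Let inv1_shift x : x%:R * inv1 x ^+ 2 <= 2 * x.+1%:R^-1.
Proof.
case: x => [|x]; first by rewrite mul0r mulr_ge0// invr_ge0.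
rewrite expr2 mulrA mulfV ?pnatr_eq0// mul1r.
rewrite -[leLHS]mul1r ler_pdivrMr ?ltr0Sn// mulrAC ler_pdivlMr ?ltr0Sn// mul1r.
by rewrite -natrM ler_nat; lia.
Qed.

Lemma Ex_inv1 : Ex (fun a => (cnt a).+1%:R^-1) <= lam^-1.
Proof.
rewrite -[leRHS]mulr1 ler_pdivlMl//.
apply: (le_trans (size_bias inv1_anti)).
by rewrite -[leRHS](Ex_cst q); apply: le_Ex.
Qed.

Let inv1_sqr_anti m n : (m <= n)%N -> inv1 n ^+ 2 <= inv1 m ^+ 2.
Proof. by move=> mn; rewrite ler_sqr ?nnegrE ?(ltW (inv1_gt0 _))// inv1_anti. Qed.

Lemma Ex_inv2 : Ex (fun a => (cnt a).+1%:R ^- 2) <= 2 * lam ^- 2.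
Proof.
have E : 2 * lam ^- 2 = lam^-1 * (2 * lam^-1).
  by rewrite -[lam ^- 2]exprVn; ring.
rewrite E ler_pdivlMl//.
rewrite (@eq_Ex _ _ _ _ (fun a => inv1 (cnt a).+1 ^+ 2)); last first.
  by move=> a; rewrite exprVn.
apply: (le_trans (size_bias inv1_sqr_anti)).
apply: (@le_trans _ _ (Ex (fun a => 2 * (cnt a).+1%:R^-1))); first exact: le_Ex.
by rewrite ExZ ler_wpM2l// Ex_inv1.
Qed.

Lemma Ex_inv3 : Ex (fun a => (cnt a).+1%:R ^- 3) <= 8 * lam ^- 3.
Proof.
(* Size biasing gives [lam^-1] and lowers the power by one; the 4 comes from [x + 1 <= 2 * x]
   squared, the [2 * lam ^- 2] from [Ex_inv2]. *)
have E : 8 * lam ^- 3 = lam^-1 * (4 * (2 * lam ^- 2)).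
  by rewrite -![lam ^- _]exprVn; ring.
rewrite E ler_pdivlMl//.
rewrite (@eq_Ex _ _ _ _ (fun a => inv1 (cnt a).+1 ^+ 3)); last first.
  by move=> a; rewrite exprVn.
have anti m n : (m <= n)%N -> inv1 n ^+ 3 <= inv1 m ^+ 3.
  by move=> mn; rewrite lerXn2r ?nnegrE ?(ltW (inv1_gt0 _))// inv1_anti.
apply: (le_trans (size_bias anti)).
apply: (@le_trans _ _ (Ex (fun a => 4 * (cnt a).+1%:R ^- 2))); last first.
  by rewrite ExZ ler_wpM2l// Ex_inv2.
apply: le_Ex => // a; case: (cnt a) => [|x]; first by rewrite mul0r mulr_ge0// invr_ge0 sqr_ge0.
rewrite /inv1/= exprS mulrA mulfV ?pnatr_eq0// mul1r exprVn.
rewrite -[leLHS]mul1r ler_pdivrMr ?exprn_gt0 ?ltr0Sn// mulrAC ler_pdivlMr ?exprn_gt0 ?ltr0Sn// mul1r.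
by rewrite -!natrX -natrM ler_nat; nia.
Qed.

(** For [1 / (x (x + 1))] two size-bias steps lose nothing, which gives the constant 1 in front of
    [lam ^- 2]. *)
Lemma Ex_inv12 : Ex (fun a => (cnt a).+1%:R^-1 * (cnt a).+2%:R^-1) <= lam ^- 2.
Proof.
have E : lam ^- 2 = lam^-1 * lam^-1 by rewrite -[lam ^- _]exprVn; ring.
rewrite E ler_pdivlMl//.
have anti m n : (m <= n)%N -> inv1 n * inv1 n.+1 <= inv1 m * inv1 m.+1.
  by move=> mn; rewrite ler_pM ?inv1_anti ?ltnS// ltW.
apply: (le_trans (size_bias anti)).
apply: le_trans Ex_inv1; apply: le_Ex => // a.
rewrite mulrA; apply: (@le_trans _ _ (1 * inv1 (cnt a).+1)); last by rewrite mul1r.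
by rewrite ler_wpM2r// ltW.
Qed.

(** Use [x^-2 = 1 / (x (x + 1)) + 1 / (x^2 (x + 1))]. The leading constant must be exactly 1, since
    it has to cancel in [Ex_recip_dev]. *)
Lemma Ex_inv2_sharp : Ex (fun a => (cnt a).+1%:R ^- 2) <= lam ^- 2 + 8 * lam ^- 3.
Proof.
apply: le_trans (lerD Ex_inv12 Ex_inv3); rewrite -ExD; apply: le_Ex => // a.
rewrite -[_.+2%:R]natr1; have : 0 < (cnt a).+1%:R :> R by rewrite ltr0Sn.
move: (_.+1%:R) => x x0; have x1 : 0 < x + 1 by rewrite addr_gt0.
have -> : x ^- 2 = x^-1 * (x + 1)^-1 + x ^- 2 * (x + 1)^-1.
  by field; rewrite !gt_eqF.
rewrite lerD2l [leRHS](_ : _ = x ^- 2 * x^-1); last by field; rewrite gt_eqF.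
rewrite ler_wpM2l ?invr_ge0 ?sqr_ge0//.
by rewrite lef_pV2 ?posrE// lerDl.
Qed.

(** Jensen's inequality, by the tangent to [1 / x] at the mean [y]. *)
Lemma Ex_inv_ge (c : nat) : (0 < c)%N ->
  (c%:R + lam)^-1 <= Ex (fun a => (c + cnt a)%:R^-1).
Proof.
move=> c0; set y := c%:R + lam.
have y0 : 0 < y by rewrite addr_gt0// ltr0n.
apply: (@le_trans _ _ (Ex (fun a => 2 / y - c%:R / y ^+ 2 + (- (y ^- 2)) * (cnt a)%:R))).
  rewrite ExD ExZ Ex_cst Ex_cnt /y le_eqVlt; apply/orP; left; apply/eqP.
  by field; rewrite gt_eqF.
apply: le_Ex => // a; rewrite natrD.
have : 0 < c%:R + (cnt a)%:R :> R by rewrite ltr_wpDr// ltr0n.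
clearbody y; move: (c%:R : R) ((cnt a)%:R : R) => u v uv0.
rewrite -subr_ge0 (_ : _ - _ = (u + v - y) ^+ 2 / ((u + v) * y ^+ 2)); last first.
  by field; rewrite !gt_eqF.
by rewrite divr_ge0 ?sqr_ge0// mulr_ge0 ?sqr_ge0// ltW.
Qed.

(** Expand the square. The terms of order [lam ^- 2] cancel between the sharp second moment and
    Jensen's bound. What is left is [8 * lam ^- 3] from the former and [16 * lam ^- 3] from
    replacing [lam] by [lam + 4]. *)
Lemma Ex_recip_dev (c : nat) (m : R) : (0 < c <= 3)%N -> lam <= m <= lam + 4 ->
  Ex (fun a => ((c + cnt a)%:R^-1 - m^-1) ^+ 2) <= 24 * lam ^- 3.
Proof.
move=> /andP[c0 c3] /andP[lm ml]; have m0 : 0 < m := lt_le_trans lam0 lm.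
rewrite (@eq_Ex _ _ _ _ (fun a => (c + cnt a)%:R ^- 2 +
   ((- 2 / m) * (c + cnt a)%:R^-1 + m ^- 2))); last first.
  by move=> a; rewrite -![_ ^- 2]exprVn; ring.
rewrite !ExD ExZ Ex_cst.
have H1 : Ex (fun a => (c + cnt a)%:R ^- 2) <= lam ^- 2 + 8 * lam ^- 3.
  apply: le_trans Ex_inv2_sharp; apply: le_Ex => // a.
  rewrite lef_pV2 ?posrE ?exprn_gt0 ?ltr0n//; last by rewrite addn_gt0 c0.
  by rewrite ler_sqr ?nnegrE ?ler0n// ler_nat; lia.
have H2 := Ex_inv_ge c0.
have y0 : 0 < c%:R + lam by rewrite addr_gt0// ltr0n.
have l4 : 0 < lam + 4 by rewrite ltr_wpDr.
have H3 : (lam + 4) ^- 2 <= m^-1 * Ex (fun a => (c + cnt a)%:R^-1).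
  rewrite -[_ ^- 2]exprVn expr2; apply: ler_pM.
  - by rewrite invr_ge0 ltW.
  - by rewrite invr_ge0 ltW.
  - by rewrite lef_pV2 ?posrE.
  - apply: le_trans H2; rewrite lef_pV2 ?posrE// addrC lerD2l.
    by rewrite (ler_nat _ c 4); lia.
have H4 : m ^- 2 <= lam ^- 2.
  by rewrite lef_pV2 ?posrE ?exprn_gt0// ler_sqr ?nnegrE ?(ltW lam0) ?(ltW m0).
have H5 : 2 * lam ^- 2 + 8 * lam ^- 3 - 2 * (lam + 4) ^- 2 <= 24 * lam ^- 3.
  rewrite -subr_ge0.
  have -> : 24 * lam ^- 3 - (2 * lam ^- 2 + 8 * lam ^- 3 - 2 * (lam + 4) ^- 2) =
    (96 * lam + 256 ) / (lam ^+ 3 * (lam + 4) ^+ 2).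
    by field; rewrite !gt_eqF.
  rewrite divr_ge0//; first by rewrite addr_ge0// mulr_ge0// ltW.
  by rewrite mulr_ge0// exprn_ge0// ltW.
move: H1 H3 H4 H5.
have -> : - 2 / m * Ex (fun a => (c + cnt a)%:R^-1) =
  - 2 * (m^-1 * Ex (fun a => (c + cnt a)%:R^-1)) by rewrite mulrA.
move: (Ex _) (m^-1 * _) (m ^- 2) (lam ^- 2) (lam ^- 3) ((lam + 4) ^- 2).
by move=> *; lra.
Qed.

End count.

(** * Fourth moments of linear forms, and expectations that ignore coordinates *)

Lemma cube_diff_le {R : realFieldType} (q x g : R) : 0 <= q -> q <= 1 ->
  g * ((x + (1 - q) * g) ^+ 3 - (x - q * g) ^+ 3) <=
  9 / 2 * (x * g) ^+ 2 + 5 / 2 * g ^+ 4.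
Proof.
move=> q0 q1.
have -> : g * ((x + (1 - q) * g) ^+ 3 - (x - q * g) ^+ 3) =
  3 * (x * g) ^+ 2 + 3 * (1 - 2 * q) * ((x * g) * g ^+ 2) + (1 - 3 * q * (1 - q)) * (g ^+ 2) ^+ 2.
  by ring.
have -> : g ^+ 4 = (g ^+ 2) ^+ 2 by ring.
move: (x * g) (g ^+ 2) => u v.
have H1 := sqr_ge0 (u - v); have H2 := sqr_ge0 (u + v).
have q2 : 0 <= q * (1 - q) by rewrite mulr_ge0// subr_ge0.
have H3 : 0 <= (q * (1 - q)) * v ^+ 2 by rewrite mulr_ge0// sqr_ge0.
have H4 : 0 <= q * (u + v) ^+ 2 by rewrite mulr_ge0.
have H5 : 0 <= (1 - q) * (u - v) ^+ 2 by rewrite mulr_ge0// subr_ge0.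
rewrite -subr_ge0 (_ : _ - _ = 3 / 2 * (q * (u + v) ^+ 2) + 3 / 2 * ((1 - q) * (u - v) ^+ 2)
  + 3 * ((q * (1 - q)) * v ^+ 2)); last by field.
by rewrite !addr_ge0// mulr_ge0// divr_ge0.
Qed.

Section fourth_moment.
Context {R : realFieldType} {I : finType} (q : I -> R).
Notation cfg := {ffun I -> bool}.
Notation Ex := (Ex q).
Hypothesis q01 : forall e, 0 <= q e <= 1.

(** Write the fourth power of the sum [Y] as [Y * Y ^+ 3] and integrate by parts. At each coordinate
    the jump of the cube is bounded by [cube_diff_le], which leaves second moments of the other
    terms and fourth powers of the coefficient. *)
Lemma Ex_pow4_sum_centered (J : finType) (P : pred J) (c : J -> I)
    (G : J -> cfg -> R) :
  {in P &, injective c} ->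
  (forall j k, P j -> P k -> nodep (c k) (G j)) ->
  Ex (fun a => (\sum_(j | P j) centered q (c j) a * G j a) ^+ 4) <=
  \sum_(j | P j) evar q (c j) * (9 / 2 *
     (\sum_(l | P l && (l != j)) evar q (c l) * Ex (fun a => G l a ^+ 2 * G j a ^+ 2))
     + 5 / 2 * Ex (fun a => G j a ^+ 4)).
Proof.
move=> cI cG; pose Y a := \sum_(j | P j) centered q (c j) a * G j a.
pose Y' j a := \sum_(l | P l && (l != j)) centered q (c l) a * G l a.
rewrite (@eq_Ex _ _ _ _ (fun a => \sum_(j | P j) centered q (c j) a * (G j a * Y a ^+ 3))); last first.
  by move=> a; rewrite exprS -/(Y a) {1}/Y mulr_suml; apply: eq_bigr => j _; rewrite mulrA.
rewrite Ex_sum; apply: ler_sum => j Pj; rewrite Ex_centered.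
apply: ler_wpM2l; first exact: evar_ge0.
have YE a b : Y (upd a (c j) b) = Y' j a + (b%:R - q (c j)) * G j a.
  rewrite /Y (bigD1 j)//= addrC; congr (_ + _); last first.
    by rewrite cG// /centered updE eqxx.
  apply: eq_bigr => l /andP[Pl lj]; rewrite cG//; congr (_ * _).
  by apply: nodep_centered; apply: contra lj => /eqP/cI->.
have -> : \sum_(l | P l && (l != j)) evar q (c l) * Ex (fun a => G l a ^+ 2 * G j a ^+ 2)
    = Ex (fun a => (Y' j a * G j a) ^+ 2).
  have -> : Ex (fun a => (Y' j a * G j a) ^+ 2) =
    Ex (fun a => (\sum_(l | P l && (l != j)) centered q (c l) a * (G l a * G j a)) ^+ 2).
    apply: eq_Ex => a; congr (_ ^+ 2); rewrite /Y' mulr_suml.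
    by apply: eq_bigr => l _; rewrite mulrA.
  rewrite (@Ex_sq_sum_centered _ _ _ _ (fun l => P l && (l != j)) c (fun l a => G l a * G j a)).
  - by apply: eq_bigr => l _; congr (_ * _); apply: eq_Ex => a; rewrite exprMn.
  - by move=> l l' /andP[Pl _] /andP[Pl' _]; exact: cI.
  - by move=> l l' /andP[Pl _] /andP[Pl' _]; apply: nodepM; exact: cG.
rewrite -!ExZ -ExD; apply: le_Ex => // a.
have /andP[q0 q1] := q01 (c j).
rewrite /cdiff !YE !cG// -mulrBr.
have := cube_diff_le (Y' j a) (G j a) q0 q1.
by rewrite /= mulrBl mul1r sub0r mulNr.
Qed.

End fourth_moment.

(** The coordinates outside [S] may be frozen at [false]. This is the form in which the law of the
    upper-triangular entries of a random graph is recognised. *)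
Lemma Ex_dep {R : realFieldType} {I : finType} (q : I -> R) (S : pred I) (F : {ffun I -> bool} -> R) :
  dep S F ->
  Ex q F = \sum_b F b * \prod_e (if S e then if b e then q e else 1 - q e else (~~ b e)%:R).
Proof.
move=> dF; pose r (a : {ffun I -> bool}) : {ffun I -> bool} := [ffun e => S e && a e].
have Fr a : F a = F (r a) by apply: dF => e Se; rewrite ffunE Se.
rewrite /Ex (partition_big r predT)//=; apply: eq_bigr => b _.
pose g e (v : bool) := (if v then q e else 1 - q e) * ((S e && v) == b e)%:R.
have E a : (if r a == b then weight q a else 0) = \prod_e g e (a e).
  rewrite /g big_split/= -/(weight q a); case: eqP => [<-|/eqP rb].
    by rewrite [X in _ * X]big1 ?mulr1// => e _; rewrite ffunE eqxx.
  have [e re] : exists e, r a e != b e.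
    apply/existsP; apply: contraNT rb; rewrite negb_exists => /forallP H.
    by apply/eqP/ffunP => e; apply/eqP; rewrite -[_ == _]negbK.
  by rewrite [X in _ * X](bigD1 e)//=; move: re; rewrite ffunE => /negbTE->; rewrite mul0r mulr0.
rewrite (eq_bigr (fun a => F b * weight q a)); last by move=> a /eqP rb; rewrite Fr rb mulrC.
rewrite -mulr_sumr; congr (_ * _); rewrite big_mkcond (eq_bigr _ (fun a _ => E a)).
rewrite -(bigA_distr_bigA g); apply: eq_bigr => e _; rewrite big_bool /g /=.
by case: (S e); case: (b e) => /=; ring.
Qed.

(** * Edges, degrees and stars in a configuration *)

Section edges.
Context {n : nat}.
Implicit Types (i j k l : 'I_n) (e : 'I_n * 'I_n) (s : seq 'I_n).
Notation cfg := {ffun 'I_n * 'I_n -> bool}.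

(** An undirected edge is the pair in increasing order. A configuration also has coordinates on and
    below the diagonal, which [adj] never reads. *)
Definition edge i j : 'I_n * 'I_n := if (i < j)%N then (i, j) else (j, i).

Lemma edgeC i j : edge i j = edge j i.
Proof.
rewrite /edge; case: (ltngtP i j) => // /val_inj ->; by [].
Qed.

Lemma edge_inj i j k l : edge i j = edge k l ->
  (i = k /\ j = l) \/ (i = l /\ j = k).
Proof.
rewrite /edge; case: ltnP => _; case: ltnP => _ [-> ->]; by [left|right].
Qed.

Lemma edge_eq i j k l :
  (edge i j == edge k l) = ((i == k) && (j == l)) || ((i == l) && (j == k)).
Proof.
apply/eqP/idP => [/edge_inj[[-> ->]|[-> ->]]|/orP[]/andP[/eqP-> /eqP->]//].
- by rewrite !eqxx.
- by rewrite !eqxx orbT.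
- exact: edgeC.
Qed.

Definition adj (a : cfg) i j : bool := (i != j) && a (edge i j).

Lemma adjC a i j : adj a i j = adj a j i.
Proof. by rewrite /adj eq_sym edgeC. Qed.

Lemma adjii a i : adj a i i = false.
Proof. by rewrite /adj eqxx. Qed.

Lemma adj_upd a i j c k l : i != j -> adj (upd a (edge i j) c) k l =
  if (k == i) && (l == j) || (k == j) && (l == i) then c else adj a k l.
Proof.
move=> ij; rewrite /adj updE edge_eq; case: ifP => [|_//].
by move=> /orP[]/andP[/eqP-> /eqP->]; rewrite ?ij ?[j == i]eq_sym ?ij.
Qed.

(* Number of neighbours of i outside s. *)
Definition dg i s (a : cfg) : nat := (\sum_(k | k \notin s) adj a i k)%N.

Definition other i e : 'I_n := if e.1 == i then e.2 else e.1.

Lemma other_edge i k : other i (edge i k) = k.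
Proof.
rewrite /other /edge; case: ltnP => _ /=; first by rewrite eqxx.
by case: (k =P i) => // ->.
Qed.

(* The edges joining i to a vertex outside s. *)
Definition star i s : pred ('I_n * 'I_n) := fun e =>
  [&& edge i (other i e) == e, other i e != i & other i e \notin s].

Lemma starP i s e : star i s e ->
  exists k, [/\ e = edge i k, k != i & k \notin s].
Proof. by move=> /and3P[/eqP ei oi os]; exists (other i e). Qed.

Lemma star_edge i s k : k != i -> k \notin s -> star i s (edge i k).
Proof. by move=> ki ks; rewrite /star other_edge eqxx ki. Qed.

Lemma sum_star (V : nmodType) i s (f : 'I_n * 'I_n -> V) :
  \sum_(e | star i s e) f e = \sum_(k | (k != i) && (k \notin s)) f (edge i k).
Proof.
rewrite (reindex_onto (edge i) (other i)); last by move=> e /and3P[/eqP].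
by apply: eq_bigl => k; rewrite /star !other_edge !eqxx andbT.
Qed.

Lemma cnt_star i s a : cnt (star i s) a = dg i s a.
Proof.
rewrite /cnt sum_star /dg big_mkcondl; apply: eq_bigr => k _.
by rewrite /adj eq_sym; case: eqP.
Qed.

Lemma dg_split i s k a : k \notin s -> dg i s a = (adj a i k + dg i (k :: s) a)%N.
Proof.
move=> ks; rewrite /dg (bigD1 k)//=; congr (_ + _)%N; apply: eq_bigl => l.
by rewrite inE negb_or andbC.
Qed.

Lemma dg_sub i s t a : {subset s <= t} -> (dg i t a <= dg i s a)%N.
Proof.
move=> st; rewrite /dg big_mkcond [leqRHS]big_mkcond/=; apply: leq_sum => k _.
case: ifP => [kt|]; last by case: ifP.
by rewrite (contra (@st k) kt).
Qed.

Lemma eq_dg i s t a : s =i t -> dg i s a = dg i t a.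
Proof. by move=> st; apply: eq_bigl => k; rewrite st. Qed.

Lemma dg_self i s a : dg i (i :: s) a = dg i s a.
Proof.
have [iS|iS] := boolP (i \in s); last by rewrite (dg_split _ _ iS) adjii.
by apply: eq_dg => k; rewrite inE; case: eqP => // ->.
Qed.

Lemma dg_out i s e a c : (forall k, k \notin s -> k != i -> e != edge i k) ->
  dg i s (upd a e c) = dg i s a.
Proof.
move=> h; apply: eq_bigr => k ks; rewrite /adj updE.
have [->|ik] := eqVneq i k; first by [].
by have [H|//] := eqVneq (edge i k) e; move: (h k ks); rewrite eq_sym ik H eqxx => /(_ isT).
Qed.

Section dependency.
Context {R : realFieldType}.
Implicit Types (S : pred ('I_n * 'I_n)).

Lemma dep_adj S i j : (i != j -> S (edge i j)) -> dep (R := R) S (fun a => (adj a i j)%:R).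
Proof.
move=> Sij a b ab; rewrite /adj; case: eqP => //= /eqP ij.
by rewrite ab// Sij.
Qed.

Lemma dep_dg S i s (g : nat -> R) :
  (forall k, k != i -> k \notin s -> S (edge i k)) -> dep S (fun a => g (dg i s a)).
Proof.
move=> Sij a b ab; congr g; apply: eq_bigr => k ks.
by rewrite /adj; case: eqP => //= /eqP ik; rewrite ab// Sij// eq_sym.
Qed.

End dependency.

Definition upper e := (e.1 < e.2)%N.

Lemma upper_edge i j : i != j -> upper (edge i j).
Proof.
move=> ij; rewrite /upper /edge; case: (ltngtP i j) => //= /val_inj E.
by rewrite E eqxx in ij.
Qed.

Lemma upperE e : upper e -> e = edge e.1 e.2.
Proof. by case: e => i j; rewrite /upper /edge /= => ->. Qed.

(* Pairs avoiding the vertex i. *)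
Definition avoid i : pred ('I_n * 'I_n) := fun e => (e.1 != i) && (e.2 != i).

Lemma avoid_edge i j k : avoid i (edge j k) = (j != i) && (k != i).
Proof. by rewrite /avoid /edge; case: ifP => //=; rewrite andbC. Qed.

End edges.

(** * Rank-1 edge probabilities and moments of reciprocal degrees *)

Section rank1.
Context {R : realFieldType} {n : nat} (p : R) (w : 'I_n -> R).

Definition rmu (i j : 'I_n) : R := if i == j then 0 else p * (w i * w j).
Definition rq (e : 'I_n * 'I_n) : R := rmu e.1 e.2.
Definition wsum : R := \sum_i w i.
(** The mean degree with the missing diagonal term added back; with it, [rmu i j = m i * m j / M]
    holds exactly for [i != j] ([rmu_m]). *)
Definition mdeg (i : 'I_n) : R := p * w i * wsum.
Definition mtot : R := p * wsum ^+ 2.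
Definition avgd : R := n%:R * p.
Definition lamx i (s : seq 'I_n) : R := \sum_(k | k \notin s) rmu i k.

Lemma rmuC i j : rmu i j = rmu j i.
Proof. by rewrite /rmu eq_sym [w i * _]mulrC. Qed.

Lemma rmuii i : rmu i i = 0.
Proof. by rewrite /rmu eqxx. Qed.

Lemma rq_edge i j : rq (edge i j) = rmu i j.
Proof. by rewrite /rq /edge; case: ifP => //= _; rewrite rmuC. Qed.

Lemma lam_star i s : \sum_(e | star i s e) rq e = lamx i s.
Proof.
rewrite sum_star /lamx big_mkcondl; apply: eq_bigr => k _.
by rewrite rq_edge /rmu eq_sym; case: eqP.
Qed.

Section bounds.
Variable beta : R.
Hypothesis hp : 0 < p <= 1.
Hypothesis hb : 0 < beta.
Hypothesis hw : forall i, beta <= w i <= 1.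
Hypothesis hn : 12 <= beta * n%:R.

(** Every [m i] is at least [beta ^+ 2 * L]. The factor 2 absorbs the removal of up to six vertices:
    [12 <= beta * n%:R] makes [W - 6] at least [beta * n%:R / 2] ([L_kap_le]). So [kap / L] bounds
    all inverse mean degrees at once. *)
Definition kap : R := 2 / beta ^+ 2.

Notation Ex := (Ex rq).
Notation L := avgd.
Notation M := mtot.
Notation m := mdeg.
Notation W := wsum.

Let p0 : 0 < p. Proof. by case/andP: hp. Qed.
Let p1 : p <= 1. Proof. by case/andP: hp. Qed.

Lemma w_gt0 i : 0 < w i.
Proof. by have /andP[? _] := hw i; apply: lt_le_trans hb _. Qed.

Lemma w_le1 i : w i <= 1. Proof. by have /andP[] := hw i. Qed.

Lemma rmu_ge0 i j : 0 <= rmu i j.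
Proof.
rewrite /rmu; case: eqP => // _.
by rewrite !mulr_ge0// ltW// w_gt0.
Qed.

Lemma rmu_le i j : rmu i j <= p.
Proof.
rewrite /rmu; case: eqP => _; first exact: ltW.
rewrite ler_piMr ?(ltW p0)//.
by rewrite mulr_ile1 ?w_le1// ltW// w_gt0.
Qed.

Lemma rq01 e : 0 <= rq e <= 1.
Proof. by rewrite rmu_ge0/= (le_trans (rmu_le _ _)). Qed.

Lemma n_gt0 : 0 < n%:R :> R.
Proof. by rewrite -(pmulr_rgt0 _ hb); apply: lt_le_trans hn. Qed.

Lemma L_gt0 : 0 < L. Proof. by rewrite mulr_gt0// n_gt0. Qed.

Lemma W_le : W <= n%:R.
Proof.
rewrite /wsum (le_trans (ler_sum _ (fun i _ => w_le1 i)))//.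
by rewrite sumr_const card_ord.
Qed.

Lemma W_ge : beta * n%:R <= W.
Proof.
apply: (@le_trans _ _ (\sum_(i < n) beta)); last first.
  by apply: ler_sum => i _; have /andP[] := hw i.
by rewrite sumr_const card_ord mulr_natr.
Qed.

Lemma W_gt0 : 0 < W.
Proof. by apply: lt_le_trans W_ge; apply: lt_le_trans hn. Qed.

Lemma kap_gt0 : 0 < kap. Proof. by rewrite /kap divr_gt0// exprn_gt0. Qed.

Lemma beta_le1 : beta <= 1.
Proof.
have : (0 < n)%N by rewrite -(ltr_nat R) n_gt0.
case: n w hw => // n' w' hw' _; have /andP[] := hw' ord0; exact: le_trans.
Qed.

Lemma kap_ge2 : 2 <= kap.
Proof.
rewrite ler_pdivlMr ?exprn_gt0// ler_piMr// -[leRHS](expr1n _ 2).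
by rewrite ler_sqr ?nnegrE ?ler01 ?(ltW hb)// beta_le1.
Qed.

Lemma m_gt0 i : 0 < m i.
Proof. by rewrite !mulr_gt0// ?w_gt0 ?W_gt0. Qed.

Lemma M_gt0 : 0 < M.
Proof. by rewrite mulr_gt0// exprn_gt0// W_gt0. Qed.

Lemma m_le i : m i <= L.
Proof.
rewrite /mdeg /avgd [n%:R * p]mulrC ler_pM ?W_le//.
- by rewrite mulr_ge0 ?ltW// w_gt0.
- by rewrite ltW// W_gt0.
- by rewrite ler_piMr ?w_le1// ltW.
Qed.

Lemma rmu_m i j : i != j -> rmu i j = m i * m j / M.
Proof.
move=> /negbTE ij; rewrite /rmu ij /mdeg /mtot; field.
by rewrite !gt_eqF// W_gt0.
Qed.

Lemma lamx_le i s : lamx i s <= m i.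
Proof.
rewrite /mdeg mulr_sumr /lamx big_mkcond/=; apply: ler_sum => k _.
case: ifP => _; last by rewrite !mulr_ge0 ?(ltW p0) ?(ltW (w_gt0 _)).
by rewrite /rmu; case: eqP => _; rewrite ?mulrA// !mulr_ge0 ?(ltW p0) ?(ltW (w_gt0 _)).
Qed.

Lemma sum_seq_le (s : seq 'I_n) : \sum_(k in s) w k <= (size s)%:R.
Proof.
apply: (@le_trans _ _ (\sum_(k in s) 1)); first by apply: ler_sum => k _; exact: w_le1.
by rewrite sumr_const ler_nat card_size.
Qed.

Lemma lamx_ge i s : p * w i * (W - (size s).+1%:R) <= lamx i s.
Proof.
have -> : lamx i s = \sum_(k | k \notin i :: s) p * w i * w k.
  rewrite /lamx [LHS]big_mkcond [RHS]big_mkcond/=; apply: eq_bigr => k _.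
  by rewrite inE negb_or /rmu eq_sym; case: eqP => //=; rewrite ?mulrA; case: ifP.
rewrite -mulr_sumr ler_wpM2l ?mulr_ge0 ?(ltW p0) ?(ltW (w_gt0 _))//.
rewrite lerBlDr /wsum (bigID (mem (i :: s)))/= addrC lerD2l.
exact: (sum_seq_le (i :: s)).
Qed.

Lemma L_kap_le i (c : R) : c <= 6 -> L / kap <= p * w i * (W - c).
Proof.
move=> c6; apply: (@le_trans _ _ (p * beta * (beta * n%:R / 2))).
  rewrite /kap /avgd le_eqVlt; apply/orP; left; apply/eqP; field.
  by rewrite gt_eqF.
have Wb : beta * n%:R / 2 <= W - c.
  by have := W_ge; move: (beta * _) hn => z hz Wz; lra.
apply: ler_pM => //.
- by rewrite mulr_ge0 ?ltW.
- by rewrite !mulr_ge0 ?invr_ge0 ?(ltW hb) ?(ltW n_gt0).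
- by rewrite ler_wpM2l ?(ltW p0)//; have /andP[] := hw i.
Qed.

Lemma lamx_ge_kap i s : (size s <= 5)%N -> L / kap <= lamx i s.
Proof.
move=> s5; apply: le_trans (lamx_ge i s); apply: L_kap_le.
by rewrite (ler_nat _ _ 6).
Qed.

Lemma Lk_gt0 : 0 < L / kap.
Proof. by rewrite divr_gt0 ?L_gt0 ?kap_gt0. Qed.

Lemma inv_le_kap x : L / kap <= x -> x^-1 <= kap / L.
Proof.
move=> Lx; rewrite -[kap / L]invf_div lef_pV2 ?posrE ?Lk_gt0//.
exact: lt_le_trans Lk_gt0 Lx.
Qed.

Lemma invm_le i : (m i)^-1 <= kap / L.
Proof. by apply: inv_le_kap; rewrite -[m i]/(p * w i * W) -[W]subr0 L_kap_le. Qed.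

Lemma invM_le : M^-1 <= kap / (n%:R * L).
Proof.
rewrite -[kap / _]invf_div lef_pV2 ?posrE ?M_gt0//; last first.
  by rewrite divr_gt0 ?kap_gt0// mulr_gt0 ?L_gt0 ?n_gt0.
have -> : n%:R * L / kap = p * ((beta * n%:R) ^+ 2 / 2).
  by rewrite /kap /avgd; field; rewrite gt_eqF.
rewrite ler_wpM2l ?(ltW p0)//; apply: (@le_trans _ _ ((beta * n%:R) ^+ 2)).
  rewrite ler_piMr ?sqr_ge0// invf_le1// ler1n.
  by [].
by rewrite ler_sqr ?nnegrE ?W_ge ?(ltW W_gt0)// mulr_ge0 ?ltW ?n_gt0.
Qed.

Section moments.
Variables (i : 'I_n) (s : seq 'I_n).
Hypothesis s5 : (size s <= 5)%N.

Let lam0 : 0 < \sum_(e | star i s e) rq e.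
Proof. by rewrite lam_star (lt_le_trans Lk_gt0)// lamx_ge_kap. Qed.

Let lamV : (\sum_(e | star i s e) rq e)^-1 <= kap / L.
Proof. by apply: inv_le_kap; rewrite lam_star lamx_ge_kap. Qed.

Let lamV0 : 0 <= (\sum_(e | star i s e) rq e)^-1.
Proof. by rewrite invr_ge0 ltW. Qed.

Lemma dg_inv1 : Ex (fun a => (dg i s a).+1%:R^-1) <= (lamx i s)^-1.
Proof.
rewrite -lam_star; apply: le_trans (Ex_inv1 rq01 lam0).
by rewrite le_eqVlt; apply/orP; left; apply/eqP/eq_Ex => a; rewrite cnt_star.
Qed.

Lemma dg_inv1_kap : Ex (fun a => (dg i s a).+1%:R^-1) <= kap / L.
Proof. by apply: (le_trans dg_inv1); rewrite -lam_star. Qed.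

Lemma dg_inv2 : Ex (fun a => (dg i s a).+1%:R ^- 2) <= 2 * (kap / L) ^+ 2.
Proof.
apply: (@le_trans _ _ (2 * (\sum_(e | star i s e) rq e) ^- 2)).
  apply: le_trans (Ex_inv2 rq01 lam0).
  by rewrite le_eqVlt; apply/orP; left; apply/eqP/eq_Ex => a; rewrite cnt_star.
by rewrite ler_wpM2l// -exprVn lerXn2r ?nnegrE ?(le_trans lamV0).
Qed.

Lemma dg_inv_ge (c : nat) : (0 < c)%N ->
  (c%:R + lamx i s)^-1 <= Ex (fun a => (c + dg i s a)%:R^-1).
Proof.
move=> c0; rewrite -lam_star; apply: le_trans (Ex_inv_ge rq01 lam0 c0) _.
by rewrite le_eqVlt; apply/orP; left; apply/eqP/eq_Ex => a; rewrite cnt_star.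
Qed.

Lemma dg_var : Ex (fun a => ((dg i s a)%:R - lamx i s) ^+ 2) <= m i.
Proof.
rewrite -lam_star; apply: le_trans (lamx_le i s); rewrite -lam_star.
apply: le_trans (Ex_cnt_var rq01 (star i s)).
by rewrite le_eqVlt; apply/orP; left; apply/eqP/eq_Ex => a; rewrite cnt_star.
Qed.

End moments.

Lemma m_lamx i s : (size s <= 3)%N -> m i <= lamx i s + 4.
Proof.
move=> s3; have := lamx_ge i s; rewrite mulrBr -/(m i) lerBlDr => /le_trans; apply.
rewrite lerD2l; have -> : 4 = 1 * 4 :> R by rewrite mul1r.
apply: ler_pM => //; last by rewrite (ler_nat _ _ 4).
  by rewrite mulr_ge0 ?ltW// w_gt0.
by rewrite mulr_ile1 ?w_le1// ltW// w_gt0.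
Qed.

(** A degree fluctuates by the square root of its mean, so its reciprocal deviates by order
    [L^(-3/2)]. Removing [s] and the diagonal lowers the mean by at most 4 ([m_lamx]). *)
Lemma dg_dev i s (c : nat) : (0 < c <= 3)%N -> (size s <= 3)%N ->
  Ex (fun a => ((c + dg i s a)%:R^-1 - (m i)^-1) ^+ 2) <= 24 * (kap / L) ^+ 3.
Proof.
move=> c3 s3.
have s5 : (size s <= 5)%N by rewrite (leq_trans s3).
have lam0 : 0 < \sum_(e | star i s e) rq e.
  by rewrite lam_star (lt_le_trans Lk_gt0)// lamx_ge_kap.
have lamm : \sum_(e | star i s e) rq e <= m i <= \sum_(e | star i s e) rq e + 4.
  by rewrite lam_star lamx_le m_lamx.
apply: le_trans (le_trans (Ex_recip_dev rq01 lam0 c3 lamm) _).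
  by rewrite le_eqVlt; apply/orP; left; apply/eqP/eq_Ex => a; rewrite cnt_star.
rewrite ler_wpM2l// -exprVn lerXn2r ?nnegrE ?invr_ge0 ?(ltW lam0)//.
  by rewrite ltW// divr_gt0 ?kap_gt0 ?L_gt0.
by apply: inv_le_kap; rewrite lam_star lamx_ge_kap.
Qed.

End bounds.
End rank1.

(** * Triangle sums and their discrete derivatives *)

Section triple_sum.
Context {R : realFieldType} {n : nat}.
Implicit Types (i j x y z : 'I_n).

Lemma sum_split2 (V : zmodType) i j (f : 'I_n -> V) : i != j ->
  \sum_x f x = f i + f j + \sum_(x | x \notin [:: i; j]) f x.
Proof.
move=> ij; rewrite (bigD1 i)//= (bigD1 j)/=; last by rewrite eq_sym.
rewrite addrA; congr (_ + _); apply: eq_bigl => x.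
by rewrite !inE negb_or.
Qed.

(** Sort the triples by which of [i] and [j] they contain: one of them can sit in 3 positions, both
    of them in 6. *)
Lemma triple_sum_split i j (t : 'I_n -> 'I_n -> 'I_n -> R) : i != j ->
  (forall x y z, t x y z = t y x z) -> (forall x y z, t x y z = t x z y) ->
  (forall x z, t x x z = 0) ->
  \sum_x \sum_y \sum_z t x y z =
  \sum_(x | x \notin [:: i; j]) \sum_(y | y \notin [:: i; j]) \sum_(z | z \notin [:: i; j]) t x y z
  + 3 * (\sum_(y | y \notin [:: i; j]) \sum_(z | z \notin [:: i; j]) t i y z)
  + 3 * (\sum_(y | y \notin [:: i; j]) \sum_(z | z \notin [:: i; j]) t j y z)
  + 6 * (\sum_(z | z \notin [:: i; j]) t i j z).
Proof.
move=> ij tC1 tC2 t0.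
have t0' x z : t x z x = 0 by rewrite tC2 t0.
have t0'' x z : t z x x = 0 by rewrite tC1 t0'.
have S2 (u : 'I_n -> 'I_n -> R) : \sum_y \sum_z u y z =
    u i i + u i j + u j i + u j j + \sum_(z | z \notin [:: i; j]) (u i z + u j z)
    + \sum_(y | y \notin [:: i; j]) (u y i + u y j)
    + \sum_(y | y \notin [:: i; j]) \sum_(z | z \notin [:: i; j]) u y z.
  have inner y : \sum_z u y z = u y i + u y j + \sum_(z | z \notin [:: i; j]) u y z.
    exact: sum_split2.
  rewrite (sum_split2 _ ij) !inner (eq_bigr _ (fun y _ => inner y)) !big_split/=.
  by ring.
rewrite (sum_split2 _ ij) !S2 (eq_bigr _ (fun x _ => S2 (t x))) !big_split/=.
pose P x := x \notin [:: i; j].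
have e1 : \sum_(z | P z) t i i z = 0 by rewrite big1.
have e2 : \sum_(z | P z) t j j z = 0 by rewrite big1.
have e3 : \sum_(z | P z) t i z i = 0 by rewrite big1.
have e4 : \sum_(z | P z) t j z j = 0 by rewrite big1.
have e5 : \sum_(z | P z) t z i i = 0 by rewrite big1.
have e6 : \sum_(z | P z) t z j j = 0 by rewrite big1.
have e7 : \sum_(z | P z) t i z j = \sum_(z | P z) t i j z by apply: eq_bigr.
have e8 : \sum_(z | P z) t j i z = \sum_(z | P z) t i j z by apply: eq_bigr.
have e9 : \sum_(z | P z) t j z i = \sum_(z | P z) t i j z.
  by apply: eq_bigr => z _; rewrite tC2 tC1.
have e10 : \sum_(z | P z) t z i j = \sum_(z | P z) t i j z.
  by apply: eq_bigr => z _; rewrite tC1 tC2.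
have e11 : \sum_(z | P z) t z j i = \sum_(z | P z) t i j z.
  by apply: eq_bigr => z _; rewrite tC1 tC2 tC1 -tC2.
have d1 u : \sum_(x | P x) \sum_(y | P y) t x u y = \sum_(x | P x) \sum_(y | P y) t u x y.
  by apply: eq_bigr => x _; apply: eq_bigr => y _; rewrite tC1.
have d2 u : \sum_(x | P x) \sum_(y | P y) t x y u = \sum_(x | P x) \sum_(y | P y) t u x y.
  by apply: eq_bigr => x _; apply: eq_bigr => y _; rewrite tC2 tC1.
have bs u v : \sum_(x | P x) \sum_(y | P y) (t x u y + t x v y) =
    \sum_(x | P x) \sum_(y | P y) t u x y + \sum_(x | P x) \sum_(y | P y) t v x y.
  by rewrite -!d1 -big_split; apply: eq_bigr => x _; rewrite big_split.
have bs' u v : \sum_(x | P x) \sum_(y | P y) (t x y u + t x y v) =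
    \sum_(x | P x) \sum_(y | P y) t u x y + \sum_(x | P x) \sum_(y | P y) t v x y.
  by rewrite -!d2 -big_split; apply: eq_bigr => x _; rewrite big_split.
rewrite !bs !bs' !t0 !t0' !t0''.
by rewrite e1 e2 e3 e4 e5 e6 e7 e8 e9 e10 e11; ring.
Qed.

End triple_sum.

Lemma split_diff {R : realFieldType} (t s1 s0 u1 u0 v1 v0 ti tj : R) :
  s1 - s0 = - 2 * ti -> u1 - u0 = - 2 * tj ->
  6^-1 * (t + 3 * s1 + 3 * u1 + 6 * v1 - (t + 3 * s0 + 3 * u0 + 6 * v0)) =
  v1 - v0 - ti - tj.
Proof. by lra. Qed.

Section triangles.
Context {R : realFieldType} {n : nat} (p : R) (w : 'I_n -> R).
Implicit Types (i j x y z : 'I_n).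
Notation cfg := {ffun 'I_n * 'I_n -> bool}.
Notation m := (mdeg p w).
Notation M := (mtot p w).
Notation W := (wsum w).

Definition tri (a : cfg) x y z : R :=
  (adj a x y && adj a y z && adj a z x)%:R /
  ((dg x [::] a)%:R * (dg y [::] a)%:R * (dg z [::] a)%:R).

Definition wtri (a : cfg) : R := 6^-1 * \sum_x \sum_y \sum_z tri a x y z.

Definition zadj x y (a : cfg) : R := (adj a x y)%:R - rmu p w x y.

Definition ztri (a : cfg) x y z : R :=
  zadj x y a * zadj y z a * zadj z x a / (m x * m y * m z).

(** The leading term, a homogeneous form of degree 3 in the centred edges; 1/6 because triples are
    ordered. *)
Definition lintri (a : cfg) : R := 6^-1 * \sum_x \sum_y \sum_z ztri a x y z.

Lemma zadjC x y a : zadj x y a = zadj y x a.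
Proof. by rewrite /zadj adjC rmuC. Qed.

Lemma zadjii x a : zadj x x a = 0.
Proof. by rewrite /zadj adjii rmuii subrr. Qed.

Lemma zadjE x y a : x != y -> zadj x y a = centered (rq p w) (edge x y) a.
Proof. by move=> xy; rewrite /zadj /adj xy /centered rq_edge. Qed.

Lemma tri_swap12 a x y z : tri a x y z = tri a y x z.
Proof.
rewrite /tri (adjC a y x) (adjC a x z) (adjC a z y) [(dg y _ _)%:R * _]mulrC.
by congr ((nat_of_bool _)%:R / _); case: (adj a x y) => //=; rewrite andbC.
Qed.

Lemma tri_swap23 a x y z : tri a x y z = tri a x z y.
Proof.
rewrite /tri (adjC a x z) (adjC a z y) (adjC a y x) mulrAC.
congr ((nat_of_bool _)%:R / _).
by case: (adj a x y); case: (adj a y z); case: (adj a z x).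
Qed.

Lemma tri_diag a x z : tri a x x z = 0.
Proof. by rewrite /tri adjii mul0r. Qed.

Lemma ztri_swap12 a x y z : ztri a x y z = ztri a y x z.
Proof.
rewrite /ztri (zadjC y x) (zadjC x z) (zadjC z y) [m y * m x]mulrC.
by congr (_ * _); ring.
Qed.

Lemma ztri_swap23 a x y z : ztri a x y z = ztri a x z y.
Proof.
rewrite /ztri (zadjC x z) (zadjC z y) (zadjC y x) [m x * m y * _]mulrAC.
by congr (_ * _); ring.
Qed.

Lemma ztri_diag a x z : ztri a x x z = 0.
Proof. by rewrite /ztri zadjii !mul0r. Qed.

Section one_edge.
Variables (i j : 'I_n).
Hypothesis ij : i != j.
Notation out x := (x \notin [:: i; j]).
Notation a1 a := (upd a (edge i j) true).
Notation a0 a := (upd a (edge i j) false).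

Lemma adj_out a c x y : out x -> adj (upd a (edge i j) c) x y = adj a x y.
Proof.
rewrite !inE negb_or => /andP[/negbTE xi /negbTE xj].
by rewrite adj_upd// xi xj.
Qed.

Lemma adj_out_r a c x y : out x -> adj (upd a (edge i j) c) y x = adj a y x.
Proof. by move=> xo; rewrite adjC adj_out// adjC. Qed.

Lemma dg_upd_out a c x : out x -> dg x [::] (upd a (edge i j) c) = dg x [::] a.
Proof. by move=> xo; apply: eq_bigr => k _; rewrite adj_out. Qed.

Lemma dg_upd_in a c : dg i [::] (upd a (edge i j) c) = (c + dg i [:: j] a)%N.
Proof.
rewrite (@dg_split _ i [::] j)// adj_upd// !eqxx/=; congr (_ + _)%N.
apply: dg_out => k; rewrite inE => kj ki.
by rewrite edge_eq negb_or !negb_and (eq_sym j k) kj orbT/= (eq_sym i k) ki.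
Qed.

(** The weight lost by the triangles at [i] avoiding [j] when the edge ij raises the degree of [i]
    from [d] to [d + 1]: the last factor is [1 / d - 1 / (d + 1)], and 1/2 undoes the ordering of
    [y] and [z]. *)
Definition tri_at (a : cfg) : R := 2^-1 *
  (\sum_(y | out y) \sum_(z | out z)
     (adj a i y && adj a y z && adj a z i)%:R / ((dg y [::] a)%:R * (dg z [::] a)%:R)) /
  ((dg i [:: j] a)%:R * (dg i [:: j] a).+1%:R).

Lemma sum_tri_diff a :
  (\sum_(y | out y) \sum_(z | out z) tri (a1 a) i y z)
  - (\sum_(y | out y) \sum_(z | out z) tri (a0 a) i y z) = - 2 * tri_at a.
Proof.
pose c y z : R := (adj a i y && adj a y z && adj a z i)%:R / ((dg y [::] a)%:R * (dg z [::] a)%:R).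
pose d : R := (dg i [:: j] a)%:R * (dg i [:: j] a).+1%:R.
transitivity (\sum_(y | out y) \sum_(z | out z) - (c y z / d)); last first.
  rewrite /tri_at -/d mulNr -!mulrA mulVKf ?pnatr_eq0//.
  rewrite mulr_suml -sumrN; apply: eq_bigr => y _.
  by rewrite mulr_suml -sumrN.
rewrite -sumrB; apply: eq_bigr => y yo; rewrite -sumrB; apply: eq_bigr => z zo.
rewrite /tri !(dg_upd_out _ _ yo) !(dg_upd_out _ _ zo) !dg_upd_in.
rewrite !(adj_out_r _ _ _ yo) !(adj_out _ _ _ yo) !(adj_out _ _ _ zo) /c.
case: (boolP (adj a i y)) => [iy|_]; last by rewrite /= !mul0r subrr oppr0.
rewrite !andTb; case: (boolP (adj a y z && adj a z i)) => [H|_]; last first.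
  by rewrite /= !mul0r subrr oppr0.
(* The three degrees of an actual triangle are positive, so the convention [0^-1 = 0] does not
   interfere with the field identity. *)
have d0 : (0 < dg i [:: j] a)%N.
  move: yo; rewrite !inE negb_or => /andP[_ yj].
  by rewrite (@dg_split _ i [:: j] y) ?inE// iy.
have dy0 : (0 < dg y [::] a)%N by rewrite (@dg_split _ y [::] i)// adjC iy.
have dz0 : (0 < dg z [::] a)%N.
  by case/andP: H => _ zi; rewrite (@dg_split _ z [::] i)// zi.
rewrite /d add1n add0n -[_.+1%:R]natr1.
have D0 : ((dg i [:: j] a)%:R : R) + 1 != 0 by rewrite natr1 pnatr_eq0.
by field; rewrite D0 !pnatr_eq0 -!lt0n d0 dy0 dz0.
Qed.

End one_edge.

Section one_edge2.
Variables (i j : 'I_n).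
Hypothesis ij : i != j.
Notation out x := (x \notin [:: i; j]).
Notation a1 a := (upd a (edge i j) true).
Notation a0 a := (upd a (edge i j) false).

(** The edge ij closes a triangle over each common neighbour and devalues the triangles already
    present at [i] and at [j]. *)
Lemma cdiff_wtri a : cdiff (edge i j) wtri a =
  \sum_(z | out z) (adj a i z && adj a j z)%:R /
      ((dg i [:: j] a).+1%:R * (dg j [:: i] a).+1%:R * (dg z [::] a)%:R)
  - tri_at i j a - tri_at j i a.
Proof.
have ji : j != i by rewrite eq_sym.
rewrite /cdiff /wtri -mulrBr.
rewrite !(triple_sum_split ij (tri_swap12 _) (tri_swap23 _) (tri_diag _)).
have -> : \sum_(x | out x) \sum_(y | out y) \sum_(z | out z) tri (a1 a) x y z =
   \sum_(x | out x) \sum_(y | out y) \sum_(z | out z) tri (a0 a) x y z.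
  apply: eq_bigr => x xo; apply: eq_bigr => y yo; apply: eq_bigr => z zo.
  by rewrite /tri !(dg_upd_out ij) // !(adj_out ij).
have Ei := sum_tri_diff ij a; have Ej := sum_tri_diff ji a.
have oC x : (x \notin [:: j; i]) = out x by rewrite !inE orbC.
have sC (f : 'I_n -> 'I_n -> R) : \sum_(y | y \notin [:: j; i]) \sum_(z | z \notin [:: j; i]) f y z
  = \sum_(y | out y) \sum_(z | out z) f y z.
  by under eq_bigl do rewrite oC; apply: eq_bigr => y _; apply: eq_bigl => z; rewrite oC.
rewrite !sC !(edgeC j i) in Ej.
have Eij : \sum_(z | out z) tri (a1 a) i j z - \sum_(z | out z) tri (a0 a) i j z =
  \sum_(z | out z) (adj a i z && adj a j z)%:R /
      ((dg i [:: j] a).+1%:R * (dg j [:: i] a).+1%:R * (dg z [::] a)%:R).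
  rewrite -sumrB; apply: eq_bigr => z zo.
  rewrite /tri !(dg_upd_out ij _ _ zo) !(adj_out ij _ _ _ zo) !(adj_out_r ij _ _ _ zo).
  rewrite !(dg_upd_in ij) (edgeC i j) !(dg_upd_in ji) -(edgeC i j) !adj_upd// !eqxx/= mul0r subr0.
  by rewrite !add1n (adjC a z i) andbC.
by rewrite -Eij; exact: split_diff Ei Ej.
Qed.

Lemma zadj_out a c x y : out x -> zadj x y (upd a (edge i j) c) = zadj x y a.
Proof. by move=> xo; rewrite /zadj (adj_out ij). Qed.

Lemma cdiff_lintri a : cdiff (edge i j) lintri a =
  \sum_(z | out z) zadj i z a * zadj j z a / (m i * m j * m z).
Proof.
rewrite /cdiff /lintri -mulrBr.
rewrite !(triple_sum_split ij (ztri_swap12 _) (ztri_swap23 _) (ztri_diag _)).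
have -> : \sum_(x | out x) \sum_(y | out y) \sum_(z | out z) ztri (a1 a) x y z =
   \sum_(x | out x) \sum_(y | out y) \sum_(z | out z) ztri (a0 a) x y z.
  apply: eq_bigr => x xo; apply: eq_bigr => y yo; apply: eq_bigr => z zo.
  by rewrite /ztri !zadj_out.
have E k : \sum_(y | out y) \sum_(z | out z) ztri (a1 a) k y z =
   \sum_(y | out y) \sum_(z | out z) ztri (a0 a) k y z.
  apply: eq_bigr => y yo; apply: eq_bigr => z zo.
  by rewrite /ztri !(zadjC k y) !zadj_out.
rewrite (E i) (E j).
have -> : \sum_(z | out z) zadj i z a * zadj j z a / (m i * m j * m z) =
  \sum_(z | out z) ztri (a1 a) i j z - \sum_(z | out z) ztri (a0 a) i j z.
  rewrite -sumrB; apply: eq_bigr => z zo.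
  rewrite /ztri !(zadjC j z) !(zadj_out _ _ _ zo) -!mulrBl.
  have -> : zadj i j (a1 a) - zadj i j (a0 a) = 1.
    by rewrite /zadj !adj_upd// !eqxx/=; ring.
  by rewrite mul1r (zadjC i z) [zadj z i a * _]mulrC.
by rewrite (@split_diff _ _ _ _ _ _ _ _ 0 0) ?subrr ?mulr0 ?subr0.
Qed.

End one_edge2.
End triangles.

(** * Second moments of codegree sums *)

Section codegree.
Context {R : realFieldType} {n : nat} (p : R) (w : 'I_n -> R) (beta : R).
Hypothesis hp : 0 < p <= 1.
Hypothesis hb : 0 < beta.
Hypothesis hw : forall i, beta <= w i <= 1.
Hypothesis hn : 12 <= beta * n%:R.

Implicit Types (i j x y z : 'I_n).
Notation cfg := {ffun 'I_n * 'I_n -> bool}.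
Notation m := (mdeg p w).
Notation M := (mtot p w).
Notation W := (wsum w).
Notation Ex := (Ex (rq p w)).
Notation L := (avgd (n := n) p).
Notation kap := (kap beta).
Let q01 := rq01 hp hb hw.
Let p0 : 0 < p. Proof. by case/andP: hp. Qed.
Let p0' : 0 <= p. Proof. exact: ltW. Qed.

Lemma Ex_adj i j : Ex (fun a => (adj a i j)%:R) = rmu p w i j.
Proof.
have [->|ij] := eqVneq i j.
  by rewrite rmuii -(Ex_cst (rq p w) 0); apply: eq_Ex => a; rewrite adjii.
rewrite (@eq_Ex _ _ _ _ (fun a => (a (edge i j))%:R * 1)).
  by rewrite (Ex_coord _ _ (fun=> 1)) Ex_cst mulr1 rq_edge.
by move=> a; rewrite /adj ij mulr1.
Qed.

(** On the event that iz and iz' are present, the degree is 1 or 2 plus a degree that ignores these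
    edges and is independent of them. This is why [g] has to be controlled at [c + dg i s] for [c]
    up to 2. *)
Lemma Ex_adj_pair i j z z' (g : nat -> R) (Phi : R) : z != i -> z' != i ->
  z != j -> z' != j ->
  (forall d, 0 <= g d) ->
  (forall c s, (0 < c <= 2)%N -> (size s <= 3)%N ->
     Ex (fun a => g (c + dg i s a)%N) <= Phi) ->
  Ex (fun a => (adj a i z)%:R * (adj a i z')%:R * g (dg i [:: j] a)) <=
  (if z == z' then p else p ^+ 2) * Phi.
Proof.
move=> zi z'i zj z'j g0 gPhi.
have Phi0 : 0 <= Phi.
  by apply: le_trans (gPhi 1%N [::] isT isT); apply: Ex_ge0.
case: eqVneq => [<-{z' z'i z'j}|zz'].
  rewrite (@eq_Ex _ _ _ _ (fun a => (adj a i z)%:R * g (1 + dg i [:: z; j] a)%N)); last first.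
    move=> a; rewrite (@dg_split _ i [:: j] z) ?inE//.
    by case: (adj a i z); rewrite ?mul1r ?mul0r.
  rewrite (@Ex_indep _ _ _ [pred e | e == edge i z] (star i [:: z; j])).
  - rewrite Ex_adj ler_pM ?gPhi// ?(rmu_le hp hb hw)// ?(rmu_ge0 hp hb hw)//.
    by apply: Ex_ge0.
  - by apply: dep_adj => _ /=.
  - by apply: (@dep_dg _ _ _ i _ (fun d => g (1 + d)%N)) => k ki ks; apply: star_edge.
  - move=> e /eqP-> /starP[k [/edge_inj[[_ zk]|[-> ->]] ki]]; last by rewrite ?eqxx in ki *.
    by rewrite zk !inE eqxx.
rewrite (@eq_Ex _ _ _ _ (fun a => (adj a i z)%:R * ((adj a i z')%:R * g (2 + dg i [:: z'; z; j] a)%N))); last first.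
  move=> a; rewrite (@dg_split _ i [:: j] z) ?inE// (@dg_split _ i [:: z; j] z') ?inE ?negb_or 1?eq_sym ?zz'//.
  by case: (adj a i z); case: (adj a i z'); rewrite ?mul1r ?mul0r.
rewrite (@Ex_indep _ _ _ [pred e | e == edge i z] [pred e | e != edge i z]); last first.
- by move=> e /= ->.
- apply: depM; first by apply: dep_adj => _ /=; rewrite edge_eq eqxx/= eq_sym (negbTE zz') (negbTE z'i) andbF.
  apply: (@dep_dg _ _ _ i _ (fun d => g (2 + d)%N)) => k ki ks /=.
  by rewrite edge_eq eqxx/= (negbTE ki) andbF orbF; apply: contra ks => /eqP->; rewrite !inE eqxx orbT.
- by apply: dep_adj => _ /=.
rewrite (@Ex_indep _ _ _ [pred e | e == edge i z'] (star i [:: z'; z; j])).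
- rewrite !Ex_adj mulrA ler_pM ?gPhi//.
  + by rewrite mulr_ge0 ?(rmu_ge0 hp hb hw).
  + by apply: Ex_ge0.
  + by rewrite expr2 ler_pM ?(rmu_le hp hb hw) ?(rmu_ge0 hp hb hw).
- by apply: dep_adj => _ /=.
- by apply: (@dep_dg _ _ _ i _ (fun d => g (2 + d)%N)) => k ki ks; apply: star_edge.
- move=> e /eqP-> /starP[k [/edge_inj[[_ zk]|[-> ->]] ki]]; last by rewrite ?eqxx in ki *.
  by rewrite zk !inE eqxx.
Qed.
End codegree.

Lemma mul_le_half_sqr {R : realFieldType} (x y : R) :
  x * y <= x ^+ 2 * 2^-1 + y ^+ 2 * 2^-1.
Proof. by have := sqr_ge0 (x - y); nra. Qed.

Lemma half_sum_le {R : realFieldType} (x y k : R) :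
  x <= k -> y <= k -> 2^-1 * x + 2^-1 * y <= k.
Proof. by lra. Qed.

Section codegree_sum.
Context {R : realFieldType} {n : nat} (p : R) (w : 'I_n -> R) (beta : R).
Hypothesis hp : 0 < p <= 1.
Hypothesis hb : 0 < beta.
Hypothesis hw : forall i, beta <= w i <= 1.
Hypothesis hn : 12 <= beta * n%:R.

Implicit Types (i j x y z : 'I_n).
Notation cfg := {ffun 'I_n * 'I_n -> bool}.
Notation m := (mdeg p w).
Notation M := (mtot p w).
Notation W := (wsum w).
Notation Ex := (Ex (rq p w)).
Notation L := (avgd (n := n) p).
Notation kap := (kap beta).
Let q01 := rq01 hp hb hw.
Let p0 : 0 < p. Proof. by case/andP: hp. Qed.
Let p0' : 0 <= p. Proof. exact: ltW. Qed.

Section pair.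
Variables (i j : 'I_n).
Hypothesis ij : i != j.
Notation out z := (z \notin [:: i; j]).

Lemma outP z : out z -> z != i /\ z != j.
Proof. by rewrite !inE negb_or => /andP. Qed.

Definition inner : pred ('I_n * 'I_n) := fun e => avoid i e && avoid j e.

Lemma star_inner e : star i [:: j] e -> inner e -> False.
Proof.
by move=> /starP[k [-> _ _]]; rewrite /inner avoid_edge eqxx.
Qed.

Lemma star_star e : star i [:: j] e -> star j [:: i] e -> False.
Proof.
move=> /starP[k [-> _ kj]] /starP[l [/edge_inj[[E _]|[E _]] lj li]].
  by move: ij; rewrite E eqxx.
by rewrite E inE eqxx in li.
Qed.

(** In the expanded square the factors at [i], at [j] and away from both live on disjoint sets of
    edges, hence are independent. A pair [z], [z'] contributes the square of [p ^+ 2], or of [p]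
    when [z = z'], and summation gives [n^2 p^4 + n p^2 = L^2 p^2 + L p]. *)
Lemma Ex_gsum (al be : nat -> R) (de : 'I_n -> cfg -> R) (Phi Psi Delta : R) :
  (forall c s, (0 < c <= 2)%N -> (size s <= 3)%N ->
     Ex (fun a => al (c + dg i s a)%N ^+ 2) <= Phi) ->
  (forall c s, (0 < c <= 2)%N -> (size s <= 3)%N ->
     Ex (fun a => be (c + dg j s a)%N ^+ 2) <= Psi) ->
  0 <= Delta -> (forall z, out z -> dep inner (de z)) ->
  (forall z, out z -> Ex (fun a => de z a ^+ 2) <= Delta) ->
  Ex (fun a => (\sum_(z | out z) (adj a i z)%:R * (adj a j z)%:R *
    (al (dg i [:: j] a) * be (dg j [:: i] a) * de z a)) ^+ 2) <=
  Phi * Psi * Delta * (L ^+ 2 * p ^+ 2 + L * p).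
Proof.
move=> alPhi bePsi Delta0 deD deDelta.
have Phi0 : 0 <= Phi.
  by apply: le_trans (alPhi 1%N [::] isT isT); apply: Ex_ge0 => // a; exact: sqr_ge0.
have Psi0 : 0 <= Psi.
  by apply: le_trans (bePsi 1%N [::] isT isT); apply: Ex_ge0 => // a; exact: sqr_ge0.
pose A z z' (a : cfg) : R := (adj a i z)%:R * (adj a i z')%:R * al (dg i [:: j] a) ^+ 2.
pose B z z' (a : cfg) : R := (adj a j z)%:R * (adj a j z')%:R * be (dg j [:: i] a) ^+ 2.
have A0 z z' a : 0 <= A z z' a by rewrite /A mulr_ge0 ?sqr_ge0// mulr_ge0 ?ler0n.
have B0 z z' a : 0 <= B z z' a by rewrite /B mulr_ge0 ?sqr_ge0// mulr_ge0 ?ler0n.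
pose c z z' : R := if z == z' then p else p ^+ 2.
have c0 (z z' : 'I_n) : 0 <= c z z' by rewrite /c; case: ifP => _; rewrite ?sqr_ge0.
have EA z z' : out z -> out z' -> Ex (A z z') <= c z z' * Phi.
  move=> /outP[zi zj] /outP[z'i z'j]; apply: (Ex_adj_pair hp hb hw (g := fun d => al d ^+ 2)) => // d; exact: sqr_ge0.
have EB z z' : out z -> out z' -> Ex (B z z') <= c z z' * Psi.
  move=> /outP[zi zj] /outP[z'i z'j]; apply: (Ex_adj_pair hp hb hw (g := fun d => be d ^+ 2)) => // d; exact: sqr_ge0.
have EAB z z' u : out z -> out z' -> out u ->
    Ex (fun a => A z z' a * (B z z' a * de u a ^+ 2)) <= c z z' ^+ 2 * (Phi * Psi * Delta).
  move=> zo z'o uo; have [zi zj] := outP zo; have [z'i z'j] := outP z'o.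
  have D0 : 0 <= Ex (fun a => de u a ^+ 2) by apply: Ex_ge0 => // a; exact: sqr_ge0.
  have deD2 : dep inner (fun a => de u a ^+ 2) by move=> b b' bb'; rewrite (deD u uo b b' bb').
  have BD : dep (star j [:: i]) (B z z').
    apply: depM; first by apply: depM; apply: dep_adj => _; apply: star_edge; rewrite ?inE.
    by apply: (@dep_dg _ _ _ j _ (fun d => be d ^+ 2)) => k; exact: star_edge.
  have AD : dep (star i [:: j]) (A z z').
    apply: depM; first by apply: depM; apply: dep_adj => _; apply: star_edge; rewrite ?inE.
    by apply: (@dep_dg _ _ _ i _ (fun d => al d ^+ 2)) => k; exact: star_edge.
  rewrite (@Ex_indep _ _ _ (star i [:: j]) [predC (star i [:: j])])//; last first.
  - by move=> e h /negP; exact.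
  - apply: depM.
      by apply: dep_sub BD => e je /=; apply/negP => /star_star; exact.
    by apply: dep_sub deD2 => e je /=; apply/negP => /star_inner; exact.
  rewrite (@Ex_indep _ _ _ (star j [:: i]) inner)//; last first.
    by move=> e /starP[k [-> _ _]]; rewrite /inner !avoid_edge eqxx andbF.
  have -> : c z z' ^+ 2 * (Phi * Psi * Delta) = (c z z' * Phi) * ((c z z' * Psi) * Delta) by ring.
  rewrite ler_pM ?EA//; first by apply: Ex_ge0 => //.
    by rewrite mulr_ge0//; apply: Ex_ge0.
  by rewrite ler_pM ?EB ?deDelta//; apply: Ex_ge0.
(* The product [de z * de z'] is split by AM-GM, so that only second moments of a single [de]
   occur. *)
apply: (@le_trans _ _ (Ex (fun a => \sum_(z | out z) \sum_(z' | out z')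
    (2^-1 * (A z z' a * (B z z' a * de z a ^+ 2)) + 2^-1 * (A z z' a * (B z z' a * de z' a ^+ 2)))))).
  apply: le_Ex => // a; rewrite expr2 mulr_suml; apply: ler_sum => z zo.
  rewrite mulr_sumr; apply: ler_sum => z' zo'.
  rewrite (_ : _ * _ = A z z' a * (B z z' a * (de z a * de z' a))); last by rewrite /A /B; ring.
  rewrite [leRHS](_ : _ = A z z' a * (B z z' a * (de z a ^+ 2 * 2^-1 + de z' a ^+ 2 * 2^-1))); last by ring.
  apply: ler_wpM2l; first exact: A0.
  by apply: ler_wpM2l; [exact: B0|exact: mul_le_half_sqr].
rewrite Ex_sum; apply: (@le_trans _ _ (\sum_(z | out z) \sum_(z' | out z') c z z' ^+ 2 * (Phi * Psi * Delta))).
  apply: ler_sum => z zo; rewrite Ex_sum; apply: ler_sum => z' zo'.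
  by rewrite ExD !ExZ; apply: half_sum_le; exact: EAB.
have K0 : 0 <= Phi * Psi * Delta by rewrite !mulr_ge0.
under eq_bigr do rewrite -mulr_suml.
rewrite -mulr_suml [leLHS]mulrC ler_wpM2l//.
apply: (@le_trans _ _ (\sum_(z : 'I_n) (\sum_(z' : 'I_n) p ^+ 4 + p ^+ 2))); last first.
  rewrite !sumr_const !card_ord /avgd -[(_ + _) *+ n]mulr_natr -[p ^+ 4 *+ n]mulr_natr le_eqVlt.
  by apply/orP; left; apply/eqP; ring.
rewrite [leLHS]big_mkcond/=; apply: ler_sum => z _.
have S0 : 0 <= \sum_(z' : 'I_n) p ^+ 4 + p ^+ 2.
  by rewrite addr_ge0 ?sqr_ge0// sumr_ge0// => *; rewrite exprn_ge0.
case: ifP => // _; rewrite [leLHS]big_mkcond/= (bigD1 z)//= addrC.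
apply: lerD; last by rewrite /c eqxx; case: ifP => _ //; exact: sqr_ge0.
rewrite [leRHS](bigD1 z)//=; apply: (@le_trans _ _ (\sum_(z' | z' != z) p ^+ 4)).
  apply: ler_sum => z' z'z; rewrite /c eq_sym (negbTE z'z) -exprM.
  by case: ifP => // _; rewrite exprn_ge0.
by rewrite lerDr exprn_ge0.
Qed.

End pair.
End codegree_sum.

(** * The discrete derivative of the remainder *)

Section decomposition.
Context {R : realFieldType} {n : nat} (p : R) (w : 'I_n -> R) (beta : R).
Hypothesis hp : 0 < p <= 1.
Hypothesis hb : 0 < beta.
Hypothesis hw : forall i, beta <= w i <= 1.
Hypothesis hn : 12 <= beta * n%:R.

Implicit Types (i j x y z : 'I_n).
Notation cfg := {ffun 'I_n * 'I_n -> bool}.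
Notation m := (mdeg p w).
Notation M := (mtot p w).
Notation W := (wsum w).
Notation Ex := (Ex (rq p w)).
Notation L := (avgd (n := n) p).
Notation kap := (kap beta).
Let q01 := rq01 hp hb hw.
Let p0 : 0 < p. Proof. by case/andP: hp. Qed.
Let p0' : 0 <= p. Proof. exact: ltW. Qed.

Lemma sqr_sum3_le (x y z : R) : (x + y + z) ^+ 2 <= 3 * (x ^+ 2 + y ^+ 2 + z ^+ 2).
Proof.
have := sqr_ge0 (x - y); have := sqr_ge0 (y - z); have := sqr_ge0 (x - z).
by nra.
Qed.

Let kL0 : 0 <= kap / L.
Proof. by rewrite ltW// divr_gt0 ?(kap_gt0 hb) ?(L_gt0 hp hb hn). Qed.

Let hinv i : 0 <= (m i)^-1 <= kap / L.
Proof. by rewrite invr_ge0 ltW ?(m_gt0 hp hb hw hn)//= (invm_le hp hb hw hn). Qed.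

Section pair.
Variables (i j : 'I_n).
Hypothesis ij : i != j.
Notation out z := (z \notin [:: i; j]).
Notation di a := (dg i [:: j] a).
Notation dj a := (dg j [:: i] a).

(** Triangles over ij weighted by the error made in replacing true degrees by [m]. *)
Definition cotri (a : cfg) : R := \sum_(z | out z) (adj a i z && adj a j z)%:R *
  (((di a).+1%:R * (dj a).+1%:R * (dg z [::] a)%:R)^-1 - (m i * m j * m z)^-1).

Let al1 (d : nat) : R := d.+1%:R^-1.
Let dev k (d : nat) : R := d.+1%:R^-1 - (m k)^-1.
Let de1 z (a : cfg) : R := (2 + dg z [:: i; j] a)%:R^-1 - (m z)^-1.
Let de2 z (a : cfg) : R := (m z)^-1.
Let gs (al be : nat -> R) (de : 'I_n -> cfg -> R) a :=
  \sum_(z | out z) (adj a i z)%:R * (adj a j z)%:R * (al (di a) * be (dj a) * de z a).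

(** Telescoping a difference of products of three reciprocals, so that each term has exactly one
    deviation factor. On the event that z is adjacent to both, its degree is 2 plus its degree away
    from [i] and [j], and the three factors become independent as [Ex_gsum] requires. *)
Let cotriE a : cotri a =
  gs al1 al1 de1 a + gs (dev i) al1 de2 a + gs (fun=> (m i)^-1) (dev j) de2 a.
Proof.
rewrite /gs -!big_split/=; apply: eq_bigr => z /outP[zi zj].
have [iz|_] := boolP (adj a i z); last by rewrite !mul0r !addr0.
have [jz|_] := boolP (adj a j z); last by rewrite !mulr0 !mul0r !addr0.
have -> : dg z [::] a = (2 + dg z [:: i; j] a)%N.
  rewrite (@dg_split _ z [::] j)// (@dg_split _ z [:: j] i) ?inE// adjC jz adjC iz.
  by [].
rewrite /al1 /dev /de1 /de2 /= !invfM; ring.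
Qed.

Let Ex_al1 k c s : (0 < c <= 2)%N -> (size s <= 3)%N ->
  Ex (fun a => al1 (c + dg k s a)%N ^+ 2) <= 2 * (kap / L) ^+ 2.
Proof.
move=> c2 s3.
apply: le_trans (dg_inv2 hp hb hw hn k (leq_trans s3 _)) => //.
apply: le_Ex => // a; rewrite /al1 -exprVn lerXn2r ?nnegrE ?invr_ge0 ?ler0n//.
by rewrite lef_pV2 ?posrE ?ltr0Sn// ler_nat ltnS leq_addl.
Qed.

Let Ex_dev k c s : (0 < c <= 2)%N -> (size s <= 3)%N ->
  Ex (fun a => dev k (c + dg k s a)%N ^+ 2) <= 24 * (kap / L) ^+ 3.
Proof.
move=> c2 s3; have c3 : (0 < c.+1 <= 3)%N by case/andP: c2.
by apply: le_trans (dg_dev hp hb hw hn k c3 s3); apply: le_Ex.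
Qed.

Let de2_le z : Ex (fun a => de2 z a ^+ 2) <= (kap / L) ^+ 2.
Proof.
by rewrite /de2 Ex_cst lerXn2r ?nnegrE//; have /andP[] := hinv z.
Qed.

(** The deviation factor has second moment of order [(kap / L) ^+ 3] and the other two of order
    [(kap / L) ^+ 2], hence the power 7; 504 is [3 * (96 + 48 + 24)]. *)
Lemma Ex_cotri : Ex (fun a => cotri a ^+ 2) <=
  504 * (kap / L) ^+ 7 * (L ^+ 2 * p ^+ 2 + L * p).
Proof.
have S1 : Ex (fun a => gs al1 al1 de1 a ^+ 2) <=
    2 * (kap / L) ^+ 2 * (2 * (kap / L) ^+ 2) * (24 * (kap / L) ^+ 3) * (L ^+ 2 * p ^+ 2 + L * p).
  apply: (Ex_gsum hp hb hw ij).
  - exact: Ex_al1.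
  - exact: Ex_al1.
  - by rewrite mulr_ge0// exprn_ge0.
  - move=> z /outP[zi zj]; apply: (@dep_dg _ _ _ z _ (fun d => (2 + d)%:R^-1 - (m z)^-1)) => k kz.
    by rewrite !inE negb_or => /andP[ki kj]; rewrite /inner !avoid_edge zi zj ki kj.
  - by move=> z _; apply: (dg_dev hp hb hw hn z (c := 2)).
have S2 : Ex (fun a => gs (dev i) al1 de2 a ^+ 2) <=
    24 * (kap / L) ^+ 3 * (2 * (kap / L) ^+ 2) * (kap / L) ^+ 2 * (L ^+ 2 * p ^+ 2 + L * p).
  apply: (Ex_gsum hp hb hw ij).
  - exact: Ex_dev.
  - exact: Ex_al1.
  - by rewrite exprn_ge0.
  - by move=> z _; exact: dep_cst.
  - by move=> z _.
have S3 : Ex (fun a => gs (fun=> (m i)^-1) (dev j) de2 a ^+ 2) <=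
    (kap / L) ^+ 2 * (24 * (kap / L) ^+ 3) * (kap / L) ^+ 2 * (L ^+ 2 * p ^+ 2 + L * p).
  apply: (Ex_gsum hp hb hw ij).
  - by move=> c s _ _; rewrite Ex_cst lerXn2r ?nnegrE//; have /andP[] := hinv i.
  - exact: Ex_dev.
  - by rewrite exprn_ge0.
  - by move=> z _; exact: dep_cst.
  - by move=> z _.
apply: (@le_trans _ _ (3 * (Ex (fun a => gs al1 al1 de1 a ^+ 2) +
   Ex (fun a => gs (dev i) al1 de2 a ^+ 2) + Ex (fun a => gs (fun=> (m i)^-1) (dev j) de2 a ^+ 2)))).
  by rewrite -!ExD -ExZ; apply: le_Ex => // a; rewrite cotriE; exact: sqr_sum3_le.
apply: (@le_trans _ _ (3 * (2 * (kap / L) ^+ 2 * (2 * (kap / L) ^+ 2) * (24 * (kap / L) ^+ 3) * (L ^+ 2 * p ^+ 2 + L * p) +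
  24 * (kap / L) ^+ 3 * (2 * (kap / L) ^+ 2) * (kap / L) ^+ 2 * (L ^+ 2 * p ^+ 2 + L * p) +
  (kap / L) ^+ 2 * (24 * (kap / L) ^+ 3) * (kap / L) ^+ 2 * (L ^+ 2 * p ^+ 2 + L * p)))).
  by rewrite ler_wpM2l// lerD// lerD.
by rewrite le_eqVlt; apply/orP; left; apply/eqP; ring.
Qed.

(** The cancellation on which the theorem rests. Both [tri_at] terms are near [1 / (2 M)]; the
    derivative of [lintri] contributes the scaled degrees of [i] and [j], each near [1 / M], and the
    constant [- 1 / M]. The total constant is zero up to the explicit term in [m i + m j]. *)
Lemma cdiff_remainder a :
  cdiff (edge i j) (fun a => wtri a - lintri p w a) a =
  cotri a - (tri_at i j a - (2 * M)^-1) - (tri_at j i a - (2 * M)^-1)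
  + ((di a)%:R / m i - 1) / M + ((dj a)%:R / m j - 1) / M + (m i + m j) / M ^+ 2.
Proof.
have -> : cdiff (edge i j) (fun a => wtri a - lintri p w a) a =
    cdiff (edge i j) wtri a - cdiff (edge i j) (lintri p w) a by rewrite /cdiff; ring.
rewrite cdiff_wtri// cdiff_lintri//.
have m0 k : m k != 0 by rewrite gt_eqF// (m_gt0 hp hb hw hn).
have M0 : M != 0 by rewrite gt_eqF// (M_gt0 hp hw hn).
have W0 : W != 0 by rewrite gt_eqF// (W_gt0 hw hn).
have mE k : m k / M = w k / W.
  by rewrite /mdeg /mtot; field; rewrite W0 gt_eqF.
(* Expanding the product: by [rmu_m] the weights [m j] and [m z] cancel in the linear terms, so that
   these are plain neighbour counts over [m i * M] and [m j * M]. *)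
have -> : \sum_(z | out z) zadj p w i z a * zadj p w j z a / (m i * m j * m z) =
  \sum_(z | out z) (adj a i z && adj a j z)%:R * (m i * m j * m z)^-1
  - \sum_(z | out z) (adj a i z)%:R / (m i * M)
  - \sum_(z | out z) (adj a j z)%:R / (m j * M)
  + \sum_(z | out z) m z / M ^+ 2.
  rewrite -!sumrB -big_split/=; apply: eq_bigr => z /outP[zi zj].
  rewrite /zadj !(rmu_m hp hw hn)//; try by rewrite eq_sym.
  rewrite -mulnb natrM; field.
  by rewrite !m0 M0.
have dE (k l : 'I_n) : k != l -> \sum_(z | z \notin [:: k; l]) (adj a k z)%:R = (dg k [:: l] a)%:R :> R.
  by move=> kl; rewrite -dg_self /dg natr_sum.
have -> : \sum_(z | out z) (adj a i z)%:R / (m i * M) = (di a)%:R / (m i * M).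
  by rewrite -mulr_suml dE.
have -> : \sum_(z | out z) (adj a j z)%:R / (m j * M) = (dj a)%:R / (m j * M).
  rewrite -mulr_suml -(dE j i) 1?eq_sym//; congr (_ / _); apply: eq_bigl => z.
  by rewrite !inE orbC.
have -> : \sum_(z | out z) m z / M ^+ 2 = (M - m i - m j) / M ^+ 2.
  rewrite -mulr_suml; congr (_ / _).
  have : \sum_z m z = M by rewrite /mdeg -mulr_suml -mulr_sumr /mtot expr2 mulrA.
  by rewrite (sum_split2 _ ij) => <-; ring.
rewrite /cotri; under [in RHS]eq_bigr do rewrite mulrBr.
rewrite sumrB; move: (\sum_(_ | _) _) (\sum_(_ | _) _) => S1 S2.
by field; rewrite !m0 M0.
Qed.

End pair.
End decomposition.

Lemma depV {R : realFieldType} {I : finType} (S : pred I) (F : {ffun I -> bool} -> R) :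
  dep S F -> dep S (fun a => (F a)^-1).
Proof. by move=> SF a b ab; rewrite (SF a b ab). Qed.

Lemma one_sub_mul_le {R : realFieldType} (u v k : R) :
  1 - 2 * k <= u -> 1 - 2 * k <= v -> u <= 1 -> v <= 1 -> 0 <= u -> 0 <= v ->
  1 - 4 * k <= u * v.
Proof.
move=> ku kv u1 v1 u0 v0.
have : 0 <= (1 - u) * (1 - v) by rewrite mulr_ge0 ?subr_ge0.
by rewrite mulrBl mulrBr; lra.
Qed.

(** * Covariances of edge weights in the neighbourhood of a vertex *)

Section edge_pairs.
Context {R : realFieldType} {n : nat} (p : R) (w : 'I_n -> R) (beta : R).
Hypothesis hp : 0 < p <= 1.
Hypothesis hb : 0 < beta.
Hypothesis hw : forall i, beta <= w i <= 1.
Hypothesis hn : 12 <= beta * n%:R.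

Implicit Types (i j x y z : 'I_n).
Notation cfg := {ffun 'I_n * 'I_n -> bool}.
Notation m := (mdeg p w).
Notation M := (mtot p w).
Notation W := (wsum w).
Notation Ex := (Ex (rq p w)).
Notation L := (avgd (n := n) p).
Notation kap := (kap beta).
Let q01 := rq01 hp hb hw.
Let p0 : 0 < p. Proof. by case/andP: hp. Qed.
Let p0' : 0 <= p. Proof. exact: ltW. Qed.

Notation k := (kap / L).

Let k0 : 0 <= k.
Proof. by rewrite ltW// divr_gt0 ?(kap_gt0 hb) ?(L_gt0 hp hb hn). Qed.

Let M0 : 0 < M. Proof. exact: M_gt0 hp hw hn. Qed.

Lemma invM2_le : M ^- 2 <= k ^+ 4 * p ^+ 2.
Proof.
have L0 := L_gt0 hp hb hn; have n0 := n_gt0 hb hn.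
have k2 := kap_ge2 hb hw hn.
apply: (@le_trans _ _ ((kap / (n%:R * L)) ^+ 2)).
  rewrite -exprVn lerXn2r ?nnegrE ?invr_ge0 ?(ltW M0) ?(invM_le hp hb hw hn)//.
  by rewrite ltW// divr_gt0 ?(kap_gt0 hb)// mulr_gt0.
have -> : kap / (n%:R * L) = kap / L * (p / L).
  rewrite /avgd; field.
  by rewrite !gt_eqF.
rewrite exprMn [k ^+ 4](_ : _ = k ^+ 2 * k ^+ 2); last by ring.
rewrite -mulrA ler_wpM2l ?sqr_ge0// [k ^+ 2]exprMn exprVn expr_div_n mulrC -[leRHS]mulrA [L ^- 2 * _]mulrC.
rewrite mulrC ler_peMl ?mulr_ge0 ?invr_ge0 ?sqr_ge0//.
by rewrite -[leLHS](expr1n _ 2) lerXn2r ?nnegrE// ?(le_trans _ k2)// ler1n.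
Qed.

Section vertex.
Variable i : 'I_n.

(** The weight of yz with the degrees that [y] and [z] have when i, y, z form a triangle: 2 plus the
    neighbours elsewhere. It depends on edges avoiding [i] only, hence is independent of the
    neighbourhood of [i]. *)
Definition ewt y z (a : cfg) : R :=
  (adj a y z)%:R / ((2 + dg y [:: z; i] a)%:R * (2 + dg z [:: y; i] a)%:R).

(** Centred at [M^-1 = rmu y z / (m y * m z)], the approximate mean and the same for all pairs. *)
Definition edev y z a : R := if y == z then 0 else ewt y z a - M^-1.

Lemma ewt_ge0 y z a : 0 <= ewt y z a.
Proof. by rewrite divr_ge0 ?ler0n// mulr_ge0 ?ler0n. Qed.

Lemma dep_avoid_ewt y z : y != i -> z != i -> dep (avoid i) (ewt y z).
Proof.
move=> yi zi; apply: depM; first by apply: dep_adj => _; rewrite avoid_edge yi.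
apply: depV; apply: depM.
  apply: (@dep_dg _ _ _ y _ (fun d => (2 + d)%:R)) => x xy.
  by rewrite !inE negb_or avoid_edge yi => /andP[].
apply: (@dep_dg _ _ _ z _ (fun d => (2 + d)%:R)) => x xy.
by rewrite !inE negb_or avoid_edge zi => /andP[].
Qed.

Lemma dep_avoid_edev y z : y != i -> z != i -> dep (avoid i) (edev y z).
Proof.
move=> yi zi a b ab; rewrite /edev; case: eqP => // _.
by rewrite (dep_avoid_ewt yi zi ab).
Qed.

(** Independence of the edge and the two outer degrees, then Jensen for each reciprocal. A lower
    bound suffices, since the mean enters the second moment of [edev] with a negative sign. *)
Lemma Ex_ewt_ge y z : y != z -> y != i -> z != i ->
  M^-1 * (1 - 4 * k) <= Ex (ewt y z).
Proof.
move=> yz yi zi; have zy : z != y by rewrite eq_sym.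
rewrite (@Ex_indep _ _ _ [pred e | e == edge y z] [pred e | e != edge y z]); last first.
- by move=> e /= ->.
- have out x x' u : x != x' -> u != x -> u \notin [:: x'; i] -> edge x u != edge x x'.
    move=> xx' ux; rewrite !inE negb_or => /andP[ux' _].
    by rewrite edge_eq eqxx/= negb_or ux'/= (negbTE xx').
  apply: depV; apply: depM.
    by apply: (@dep_dg _ _ _ y _ (fun d => (2 + d)%:R)) => u uy us; apply: out.
  apply: (@dep_dg _ _ _ z _ (fun d => (2 + d)%:R)) => u uz us.
  by rewrite /= (edgeC y z); apply: out.
- by apply: dep_adj => _ /=.
rewrite Ex_adj (rmu_m hp hw hn)//.
rewrite (@eq_Ex _ _ _ _ (fun a => (2 + dg y [:: z; i] a)%:R^-1 * (2 + dg z [:: y; i] a)%:R^-1)); last first.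
  by move=> a; rewrite invfM.
rewrite (@Ex_indep _ _ _ (star y [:: z; i]) (star z [:: y; i])); last first.
- move=> e /starP[u [-> uy]]; rewrite !inE negb_or => /andP[uz _] /starP[v [/edge_inj[[E _]|[E1 E2]]]].
    by rewrite E eqxx in yz.
  by rewrite E2 eqxx in uz.
- by apply: (@dep_dg _ _ _ z _ (fun d => (2 + d)%:R^-1)) => u; exact: star_edge.
- by apply: (@dep_dg _ _ _ y _ (fun d => (2 + d)%:R^-1)) => u; exact: star_edge.
have m0 x : 0 < m x := m_gt0 hp hb hw hn x.
have E x s : (size s <= 5)%N -> (2 + m x)^-1 <= Ex (fun a => (2 + dg x s a)%:R^-1).
  move=> s5; apply: le_trans (dg_inv_ge hp hb hw hn x s5 (c := 2) isT).
  have l0 : 0 < lamx p w x s.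
    by apply: lt_le_trans (lamx_ge_kap hp hb hw hn x s5); exact: Lk_gt0 hp hb hn.
  by rewrite lef_pV2 ?posrE ?addr_gt0// lerD2l (lamx_le hp hb hw).
have m2 x : 0 < 2 + m x by rewrite addr_gt0.
apply: (@le_trans _ _ (m y * m z / M * ((2 + m y)^-1 * (2 + m z)^-1))); last first.
  apply: ler_wpM2l; first exact: (divr_ge0 (mulr_ge0 (ltW (m0 _)) (ltW (m0 _))) (ltW M0)).
  by apply: ler_pM; rewrite ?invr_ge0 ?(ltW (m2 _))//; exact: E.
have h x : 1 - 2 * k <= m x / (2 + m x).
  have -> : m x / (2 + m x) = 1 - 2 * (2 + m x)^-1 by field; rewrite gt_eqF.
  rewrite lerD2l lerN2 ler_wpM2l//; apply: le_trans (invm_le hp hb hw hn x).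
  by rewrite lef_pV2 ?posrE// lerDr.
have h1 x : m x / (2 + m x) <= 1 by rewrite ler_pdivrMr// mul1r lerDr.
have h0 x : 0 <= m x / (2 + m x) by exact: divr_ge0 (ltW (m0 x)) (ltW (m2 x)).
rewrite (_ : m y * m z / M * _ = M^-1 * ((m y / (2 + m y)) * (m z / (2 + m z)))); last first.
  by field; rewrite !gt_eqF.
rewrite ler_wpM2l ?invr_ge0 ?(ltW M0)//.
exact: one_sub_mul_le (h y) (h z) (h1 y) (h1 z) (h0 y) (h0 z).
Qed.

End vertex.
End edge_pairs.

Section edge_pairs.
Context {R : realFieldType} {n : nat} (p : R) (w : 'I_n -> R) (beta : R).
Hypothesis hp : 0 < p <= 1.
Hypothesis hb : 0 < beta.
Hypothesis hw : forall i, beta <= w i <= 1.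
Hypothesis hn : 12 <= beta * n%:R.

Implicit Types (i j x y z : 'I_n).
Notation cfg := {ffun 'I_n * 'I_n -> bool}.
Notation m := (mdeg p w).
Notation M := (mtot p w).
Notation W := (wsum w).
Notation Ex := (Ex (rq p w)).
Notation L := (avgd (n := n) p).
Notation kap := (kap beta).
Let q01 := rq01 hp hb hw.
Let p0 : 0 < p. Proof. by case/andP: hp. Qed.
Let p0' : 0 <= p. Proof. exact: ltW. Qed.

Notation k := (kap / L).

Let k0 : 0 <= k.
Proof. by rewrite ltW// divr_gt0 ?(kap_gt0 hb) ?(L_gt0 hp hb hn). Qed.

Let M0 : 0 < M. Proof. exact: M_gt0 hp hw hn. Qed.

Section four.
Variables (i y z y' z' : 'I_n).
Notation s := [:: i; y; z; y'; z'].

(** Removing all five vertices makes these independent for distinct vertices of [s], and independent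
    of the edges yz and y'z'. They dominate the reciprocals in [ewt]. *)
Definition rdg x (a : cfg) : R := (dg x s a).+1%:R^-1.

Lemma rdg_ge0 x a : 0 <= rdg x a.
Proof. by rewrite invr_ge0 ler0n. Qed.

Lemma dep_rdg x : dep (star x s) (rdg x).
Proof. by apply: (@dep_dg _ _ _ x _ (fun d => d.+1%:R^-1)) => u; exact: star_edge. Qed.

Lemma star_disj x u e : x != u -> u \in s -> star x s e -> star u s e -> False.
Proof.
move=> xu us /starP[v [-> _ vs]] /starP[t [/edge_inj[[E _]|[_ E]] _ _]].
  by rewrite E eqxx in xu.
by rewrite E us in vs.
Qed.

Lemma ewt_le x u a : x \in s -> u \in s -> i \in s ->
  ewt i x u a <= (adj a x u)%:R * (rdg x a * rdg u a).
Proof.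
move=> xs us is_; rewrite /ewt ler_wpM2l ?ler0n// -invfM lef_pV2.
- apply: ler_pM; rewrite ?ler0n// ler_nat add2n ltnS; apply: leqW; apply: dg_sub => t;
  by rewrite inE => /orP[/eqP->//|]; rewrite inE => /eqP->.
- by rewrite posrE mulr_gt0 ?ltr0n.
- by rewrite posrE mulr_gt0 ?ltr0n.
Qed.

Lemma Ex_rdg2 x u : x != u -> u \in s ->
  Ex (fun a => rdg x a ^+ 2 * rdg u a ^+ 2) <= 4 * k ^+ 4.
Proof.
move=> xu us.
rewrite (@Ex_indep _ _ _ (star x s) (star u s)); last first.
- by move=> e; exact: star_disj.
- by move=> a b ab; rewrite (dep_rdg ab).
- by move=> a b ab; rewrite (dep_rdg ab).
have E v : Ex (fun a => rdg v a ^+ 2) <= 2 * k ^+ 2.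
  apply: le_trans (dg_inv2 hp hb hw hn v (s := s) isT).
  by apply: le_Ex => // a; rewrite /rdg exprVn.
have E0 v : 0 <= Ex (fun a => rdg v a ^+ 2) by apply: Ex_ge0 => // a; exact: sqr_ge0.
apply: (@le_trans _ _ ((2 * k ^+ 2) * (2 * k ^+ 2))); first exact: ler_pM.
by rewrite le_eqVlt; apply/orP; left; apply/eqP; ring.
Qed.

Let rho a := rdg y a * rdg z a * (rdg y' a * rdg z' a).
Let adj2 (a : cfg) : R := (adj a y z)%:R * (adj a y' z')%:R.

Let Ex_split : Ex (fun a => adj2 a * rho a) = Ex adj2 * Ex rho.
Proof.
pose E2 := [pred e : 'I_n * 'I_n | (e == edge y z) || (e == edge y' z')].
have rO x : x \in s -> dep [predC E2] (rdg x).
  move=> xs; apply: dep_sub (@dep_rdg x) => e /starP[v [-> _ vs]] /=.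
  have H u t : u \in s -> t \in s -> edge x v != edge u t.
    move=> us ts; rewrite edge_eq negb_or !negb_and; apply/andP; split; apply/orP; right.
      by apply: contra vs => /eqP->.
    by apply: contra vs => /eqP->.
  by rewrite negb_or !H// !inE eqxx ?orbT.
apply: (@Ex_indep _ _ _ E2 [predC E2]).
- apply: depM; apply: dep_adj => _ /=; by rewrite eqxx ?orbT.
- by apply: depM; apply: depM; apply: rO; rewrite !inE eqxx ?orbT.
- by move=> e h /negP; exact.
Qed.

Lemma Ex_adj2 : Ex adj2 <= (if edge y z == edge y' z' then p else p ^+ 2).
Proof.
case: eqP => [e|/eqP e].
  apply: (@le_trans _ _ (Ex (fun a => (adj a y z)%:R))).
    by apply: le_Ex => // a; rewrite /adj2 ler_piMr ?ler0n// lern1 leq_b1.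
  by rewrite Ex_adj (rmu_le hp hb hw).
rewrite (@Ex_indep _ _ _ [pred x | x == edge y z] [pred x | x == edge y' z']).
- rewrite !Ex_adj expr2; apply: ler_pM; rewrite ?(rmu_le hp hb hw) ?(rmu_ge0 hp hb hw)//.
- by apply: dep_adj => _ /=.
- by apply: dep_adj => _ /=.
- by move=> x /eqP-> /eqP e'; rewrite e' eqxx in e.
Qed.

(** The crude bound, valid also when the pairs share vertices: AM-GM separates the reciprocals of
    one pair from those of the other. *)
Lemma Ex_ewt2 : y != z -> y' != z' ->
  Ex (fun a => ewt i y z a * ewt i y' z' a) <=
  (if edge y z == edge y' z' then p else p ^+ 2) * (4 * k ^+ 4).
Proof.
move=> yz y'z'.
apply: (@le_trans _ _ (Ex (fun a => adj2 a * rho a))).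
  apply: le_Ex => // a.
  rewrite [leRHS](_ : _ = ((adj a y z)%:R * (rdg y a * rdg z a)) *
     ((adj a y' z')%:R * (rdg y' a * rdg z' a))); last by rewrite /adj2 /rho; ring.
  by apply: ler_pM; rewrite ?ewt_ge0// ewt_le// !inE eqxx ?orbT.
rewrite Ex_split; apply: ler_pM.
- by apply: Ex_ge0 => // a; rewrite mulr_ge0 ?ler0n.
- by apply: Ex_ge0 => // a; rewrite /rho !mulr_ge0 ?rdg_ge0.
- exact: Ex_adj2.
- apply: (@le_trans _ _ (2^-1 * Ex (fun a => rdg y a ^+ 2 * rdg z a ^+ 2) +
      2^-1 * Ex (fun a => rdg y' a ^+ 2 * rdg z' a ^+ 2))).
    rewrite -!ExZ -ExD; apply: le_Ex => // a; rewrite ![2^-1 * _]mulrC -!exprMn.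
    exact: mul_le_half_sqr.
  by apply: half_sum_le; apply: Ex_rdg2 => //; rewrite !inE eqxx ?orbT.
Qed.

(** For distinct vertices the expectation factorises completely and the vertex weights cancel, so
    the constant in front of [M ^- 2] is 1 up to a relative error of order [k]. *)
Lemma Ex_ewt2_disj : uniq s ->
  Ex (fun a => ewt i y z a * ewt i y' z' a) <= (p ^+ 2 * (W - 6) ^+ 4)^-1.
Proof.
move=> us.
have W6 : 0 < W - 6.
  by rewrite subr_gt0 (lt_le_trans (_ : 6 < 12))// ?ltr_nat// (le_trans hn)// (W_ge hw).
have E x : Ex (rdg x) <= (p * w x * (W - 6))^-1.
  apply: (le_trans (dg_inv1 hp hb hw hn x (s := s) isT)).
  have wx : 0 < p * w x * (W - 6) by rewrite mulr_gt0// mulr_gt0// (w_gt0 hb hw).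
  have := lamx_ge hp hb hw x s => h.
  by rewrite lef_pV2 ?posrE// (lt_le_trans wx).
have E0 x : 0 <= Ex (rdg x) by apply: Ex_ge0 => // a; exact: rdg_ge0.
move: us; rewrite /= !inE !negb_or => /and5P[_ /and3P[yz yy' yz'] /andP[zy' zz'] y'z' _].
apply: (@le_trans _ _ (Ex (fun a => adj2 a * rho a))).
  apply: le_Ex => // a.
  rewrite [leRHS](_ : _ = ((adj a y z)%:R * (rdg y a * rdg z a)) *
     ((adj a y' z')%:R * (rdg y' a * rdg z' a))); last by rewrite /adj2 /rho; ring.
  by apply: ler_pM; rewrite ?ewt_ge0// ewt_le// !inE eqxx ?orbT.
have yin : y \in s by rewrite !inE eqxx ?orbT.
have zin : z \in s by rewrite !inE eqxx ?orbT.
have y'in : y' \in s by rewrite !inE eqxx ?orbT.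
have z'in : z' \in s by rewrite !inE eqxx ?orbT.
have -> : Ex (fun a => adj2 a * rho a) = rmu p w y z * rmu p w y' z' *
    (Ex (rdg y) * Ex (rdg z) * (Ex (rdg y') * Ex (rdg z'))).
  rewrite Ex_split; congr (_ * _).
    rewrite (@Ex_indep _ _ _ [pred x | x == edge y z] [pred x | x == edge y' z']) ?Ex_adj//.
    - by apply: dep_adj => _ /=.
    - by apply: dep_adj => _ /=.
    - by move=> x /eqP-> /eqP/edge_inj[[H _]|[H _]]; rewrite H eqxx in yy' yz'.
  rewrite (@Ex_indep _ _ _ [pred e | star y s e || star z s e] [pred e | star y' s e || star z' s e]).
  - congr (_ * _).
      by apply: Ex_indep; [exact: dep_rdg|exact: dep_rdg|move=> e; exact: star_disj].
    by apply: Ex_indep; [exact: dep_rdg|exact: dep_rdg|move=> e; exact: star_disj].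
  - apply: depM; [apply: dep_sub (@dep_rdg y)|apply: dep_sub (@dep_rdg z)] => e /= ->;
    by rewrite ?orbT.
  - apply: depM; [apply: dep_sub (@dep_rdg y')|apply: dep_sub (@dep_rdg z')] => e /= ->;
    by rewrite ?orbT.
  - by move=> e /= /orP[h1|h1] /orP[h2|h2]; apply: star_disj h1 h2.
have w0 x : w x != 0 by rewrite gt_eqF// (w_gt0 hb hw).
apply: (@le_trans _ _ ((p * (w y * w z)) * (p * (w y' * w z')) *
   ((p * w y * (W - 6))^-1 * (p * w z * (W - 6))^-1 * ((p * w y' * (W - 6))^-1 * (p * w z' * (W - 6))^-1)))).
  rewrite /rmu (negbTE yz) (negbTE y'z'); apply: ler_wpM2l.
    by rewrite !mulr_ge0 ?p0' ?(ltW (w_gt0 hb hw _)).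
  by apply: ler_pM; rewrite ?mulr_ge0 ?E0//; apply: ler_pM.
rewrite le_eqVlt; apply/orP; left; apply/eqP; field.
by rewrite !w0 !gt_eqF.
Qed.

End four.
End edge_pairs.

Lemma pow4_le {R : realFieldType} (q y : R) :
  0 <= q -> q <= 1 + y -> 0 <= y -> y <= 1 -> (q ^+ 2) ^+ 2 <= 1 + 15 * y.
Proof.
move=> q0 qy y0 y1.
have q2 : q ^+ 2 <= 1 + 3 * y.
  apply: (@le_trans _ _ ((1 + y) ^+ 2)); first by rewrite lerXn2r ?nnegrE// (le_trans q0).
  by nra.
apply: (@le_trans _ _ ((1 + 3 * y) ^+ 2)); last by nra.
by rewrite lerXn2r ?nnegrE ?sqr_ge0// (le_trans (sqr_ge0 q)).
Qed.

Lemma sub2_le {R : realFieldType} (g x y : R) : 0 <= x -> 0 <= y -> g - x - y <= g.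
Proof. by lra. Qed.

Lemma le_mid {R : realFieldType} (x a c : R) : 0 <= a -> 0 <= c -> x <= a + x + c.
Proof. by lra. Qed.

Lemma disj_combine {R : realFieldType} (g x y m k b : R) :
  g <= m * (1 + 180 * k) -> m * (1 - 4 * k) <= x -> m * (1 - 4 * k) <= y ->
  m * (188 * k) <= b -> g - x - y + m <= b.
Proof. by lra. Qed.

Section edge_pairs.
Context {R : realFieldType} {n : nat} (p : R) (w : 'I_n -> R) (beta : R).
Hypothesis hp : 0 < p <= 1.
Hypothesis hb : 0 < beta.
Hypothesis hw : forall i, beta <= w i <= 1.
Hypothesis hn : 12 <= beta * n%:R.

Implicit Types (i j x y z : 'I_n).
Notation cfg := {ffun 'I_n * 'I_n -> bool}.
Notation m := (mdeg p w).
Notation M := (mtot p w).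
Notation W := (wsum w).
Notation Ex := (Ex (rq p w)).
Notation L := (avgd (n := n) p).
Notation kap := (kap beta).
Let q01 := rq01 hp hb hw.
Let p0 : 0 < p. Proof. by case/andP: hp. Qed.
Let p0' : 0 <= p. Proof. exact: ltW. Qed.

Notation k := (kap / L).

Let k0 : 0 <= k.
Proof. by rewrite ltW// divr_gt0 ?(kap_gt0 hb) ?(L_gt0 hp hb hn). Qed.

Let M0 : 0 < M. Proof. exact: M_gt0 hp hw hn. Qed.

Lemma invW_le : W^-1 <= k.
Proof.
have bn : 0 < beta * n%:R by rewrite (lt_le_trans _ hn).
apply: (@le_trans _ _ (beta * n%:R)^-1).
  by rewrite lef_pV2 ?posrE ?(W_ge hw)// (W_gt0 hw hn).
have n0 := n_gt0 hb hn; have b1 := beta_le1 hb hw hn.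
rewrite /kap /avgd [leRHS](_ : _ = (2 / (beta * p)) / (beta * n%:R)); last first.
  by field; rewrite !gt_eqF.
rewrite ler_peMl ?invr_ge0 ?(ltW bn)// ler_pdivlMr ?mulr_gt0// mul1r.
have /andP[_ p1] := hp.
apply: (@le_trans _ _ (1 * 1)); first by rewrite ler_pM// ltW.
by rewrite mulr1 ler1n.
Qed.

Lemma invW4_le : (p ^+ 2 * (W - 6) ^+ 4)^-1 <= M ^- 2 * (1 + 180 * k).
Proof.
have W0 := W_gt0 hw hn.
have W12 : 12 <= W by apply: le_trans hn (W_ge hw).
have W6 : 0 < W - 6 by rewrite subr_gt0 (lt_le_trans _ W12)// ltr_nat.
have -> : (p ^+ 2 * (W - 6) ^+ 4)^-1 = M ^- 2 * ((W / (W - 6)) ^+ 2) ^+ 2.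
  by rewrite /mtot; field; rewrite !gt_eqF.
rewrite ler_wpM2l ?invr_ge0 ?sqr_ge0//.
have q1 : W / (W - 6) <= 1 + 12 * W^-1.
  rewrite ler_pdivrMr// -subr_ge0 (_ : _ - _ = 6 * (W - 12) / W); last by field; rewrite gt_eqF.
  by rewrite divr_ge0 ?(ltW W0)// mulr_ge0// subr_ge0.
have q0 : 0 <= W / (W - 6) by rewrite divr_ge0// ltW.
have y1 : 12 * W^-1 <= 1 by rewrite ler_pdivrMr// mul1r.
have y0 : 0 <= 12 * W^-1 by rewrite mulr_ge0// invr_ge0 ltW.
apply: (@le_trans _ _ (1 + 15 * (12 * W^-1))); last first.
  have := invW_le; lra.
exact: pow4_le q0 q1 y0 y1.
Qed.

Section vertex.
Variable i : 'I_n.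

(** A covariance bound by coincidence pattern: [b3] for disjoint pairs, [b2] for a shared vertex,
    [b1] for equal edges. Writing it with indicators makes it summable over neighbours in closed
    form. *)
Definition pair_bound b1 b2 b3 (y z y' z' : 'I_n) : R :=
  b3 + b2 * ((y == y')%:R + (y == z')%:R + (z == y')%:R + (z == z')%:R)
  + b1 * ((y == y')%:R * (z == z')%:R + (y == z')%:R * (z == y')%:R).

Notation b1 := (5 * k ^+ 4 * p).
Notation b2 := (5 * k ^+ 4 * p ^+ 2).
Notation b3 := (188 * k ^+ 5 * p ^+ 2).

Lemma b1_ge0 : 0 <= b1. Proof. by rewrite mulr_ge0// mulr_ge0// exprn_ge0. Qed.
Lemma b2_ge0 : 0 <= b2. Proof. by rewrite mulr_ge0 ?sqr_ge0// mulr_ge0// exprn_ge0. Qed.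
Lemma b3_ge0 : 0 <= b3. Proof. by rewrite mulr_ge0 ?sqr_ge0// mulr_ge0// exprn_ge0. Qed.

(** For disjoint pairs the leading [M ^- 2] cancels and leaves [180 k + 4 k + 4 k = 188 k] relative
    to it. The other patterns are rarer in the sums, and the crude bound is enough for them. *)
Lemma Ex_edev2 y z y' z' : y != i -> z != i -> y' != i -> z' != i ->
  Ex (fun a => edev p w i y z a * edev p w i y' z' a) <= pair_bound b1 b2 b3 y z y' z'.
Proof.
move=> yi zi y'i z'i.
have nb (b : bool) : 0 <= b%:R :> R by rewrite ler0n.
have B1 := b1_ge0; have B2 := b2_ge0; have B3 := b3_ge0.
have PB0 : 0 <= pair_bound b1 b2 b3 y z y' z'.
  apply: addr_ge0; first apply: addr_ge0 => //.
    by apply: mulr_ge0 => //; do 3 apply: addr_ge0 => //.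
  by apply: mulr_ge0 => //; apply: addr_ge0; apply: mulr_ge0.
have [yz|yz] := eqVneq y z.
  rewrite (_ : Ex _ = 0)// -[RHS](Ex_cst (rq p w)); apply: eq_Ex => a.
  by rewrite /edev yz eqxx mul0r.
have [y'z'|y'z'] := eqVneq y' z'.
  rewrite (_ : Ex _ = 0)// -[RHS](Ex_cst (rq p w)); apply: eq_Ex => a.
  by rewrite /edev y'z' eqxx mulr0.
have -> : Ex (fun a => edev p w i y z a * edev p w i y' z' a) =
    Ex (fun a => ewt i y z a * ewt i y' z' a) - M^-1 * Ex (ewt i y z)
    - M^-1 * Ex (ewt i y' z') + M ^- 2.
  rewrite -!ExZ -!ExB -[M ^- 2](Ex_cst (rq p w)) -ExD; apply: eq_Ex => a.
  by rewrite /edev (negbTE yz) (negbTE y'z') -exprVn; ring.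
have G0 u v : 0 <= Ex (ewt i u v) by apply: Ex_ge0 => // a; exact: ewt_ge0.
have MV0 : 0 <= M^-1 by rewrite invr_ge0 ltW.
have Mk := invM2_le hp hb hw hn.
have gen : Ex (fun a => ewt i y z a * ewt i y' z' a) - M^-1 * Ex (ewt i y z)
    - M^-1 * Ex (ewt i y' z') + M ^- 2 <=
    (if edge y z == edge y' z' then p else p ^+ 2) * (4 * k ^+ 4) + k ^+ 4 * p ^+ 2.
  apply: lerD => //; apply: le_trans (Ex_ewt2 hp hb hw hn i yz y'z').
  by apply: sub2_le; rewrite mulr_ge0.
have p2p : p ^+ 2 <= p by have /andP[_ p1] := hp; rewrite expr2 ler_piMr.
have k4 : 0 <= k ^+ 4 by exact: exprn_ge0.
have [e|e] := boolP (edge y z == edge y' z').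
  rewrite e in gen; apply: (le_trans gen).
  apply: (@le_trans _ _ b1).
    have := ler_wpM2l k4 p2p; move: (k ^+ 4) => kk; lra.
  rewrite /pair_bound; move: e; rewrite edge_eq => /orP[]/andP[/eqP-> /eqP->]; rewrite !eqxx /=.
    apply: (@le_trans _ _ (b1 * (1 * 1))); first by rewrite !mulr1.
    rewrite -[leLHS]add0r; apply: lerD.
      by rewrite addr_ge0// mulr_ge0//; do 3 apply: addr_ge0 => //.
    by apply: ler_wpM2l => //; rewrite lerDl mulr_ge0.
  apply: (@le_trans _ _ (b1 * (1 * 1))); first by rewrite !mulr1.
  rewrite -[leLHS]add0r; apply: lerD.
    by rewrite addr_ge0// mulr_ge0//; do 3 apply: addr_ge0 => //.
  by apply: ler_wpM2l => //; rewrite lerDr mulr_ge0.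
rewrite (negbTE e) in gen.
have [us|us] := boolP (uniq [:: i; y; z; y'; z']).
  apply: (@le_trans _ _ b3); last first.
    by rewrite /pair_bound -addrA lerDl; apply: addr_ge0; apply: mulr_ge0; rewrite -?natrM -?natrD ?ler0n.
  have H1 := le_trans (Ex_ewt2_disj hp hb hw hn us) invW4_le.
  have H2 := ler_wpM2l MV0 (Ex_ewt_ge hp hb hw hn yz yi zi).
  have H3 := ler_wpM2l MV0 (Ex_ewt_ge hp hb hw hn y'z' y'i z'i).
  have ME : M^-1 * (M^-1 * (1 - 4 * k)) = M ^- 2 * (1 - 4 * k).
    by rewrite mulrA -expr2 exprVn.
  rewrite ME in H2 H3.
  have H4 : M ^- 2 * (188 * k) <= b3.
    rewrite [leRHS](_ : _ = (k ^+ 4 * p ^+ 2) * (188 * k)); last by ring.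
    by apply: ler_wpM2r => //; rewrite mulr_ge0.
  exact: disj_combine H1 H2 H3 H4.
apply: (le_trans gen).
apply: (@le_trans _ _ b2); first by rewrite le_eqVlt; apply/orP; left; apply/eqP; ring.
have shared : (y == y') || (y == z') || (z == y') || (z == z').
  move: us; rewrite /= !inE !negb_or yz y'z' /= !andbT.
  rewrite ![i == _]eq_sym yi zi y'i z'i /=.
  by case: (y == y'); case: (y == z'); case: (z == y'); case: (z == z').
rewrite /pair_bound; apply: (@le_trans _ _ (b2 * ((y == y')%:R + (y == z')%:R + (z == y')%:R + (z == z')%:R))).
  rewrite ler_peMr//; move: shared.
  by case: (y == y'); case: (y == z'); case: (z == y'); case: (z == z') => //= _;
    rewrite ?add0r ?addr0 -?natrD ler1n.
by apply: le_mid => //; apply: mulr_ge0; rewrite -?natrM -?natrD ?ler0n.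
Qed.

End vertex.
End edge_pairs.

(** * Fluctuations of the weight [tri_at] at one vertex *)

Lemma sqr_sum2_le {R : realFieldType} (x y : R) : (x + y) ^+ 2 <= 2 * (x ^+ 2 + y ^+ 2).
Proof. by have := sqr_ge0 (x - y); nra. Qed.

Section edge_pairs.
Context {R : realFieldType} {n : nat} (p : R) (w : 'I_n -> R) (beta : R).
Hypothesis hp : 0 < p <= 1.
Hypothesis hb : 0 < beta.
Hypothesis hw : forall i, beta <= w i <= 1.
Hypothesis hn : 12 <= beta * n%:R.

Implicit Types (i j x y z : 'I_n).
Notation cfg := {ffun 'I_n * 'I_n -> bool}.
Notation m := (mdeg p w).
Notation M := (mtot p w).
Notation W := (wsum w).
Notation Ex := (Ex (rq p w)).
Notation L := (avgd (n := n) p).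
Notation kap := (kap beta).
Let q01 := rq01 hp hb hw.
Let p0 : 0 < p. Proof. by case/andP: hp. Qed.
Let p0' : 0 <= p. Proof. exact: ltW. Qed.

Notation k := (kap / L).

Let k0 : 0 <= k.
Proof. by rewrite ltW// divr_gt0 ?(kap_gt0 hb) ?(L_gt0 hp hb hn). Qed.

Let M0 : 0 < M. Proof. exact: M_gt0 hp hw hn. Qed.

Section pair.
Variables (i j : 'I_n).
Hypothesis ij : i != j.
Notation out z := (z \notin [:: i; j]).
Notation d a := (dg i [:: j] a).

Lemma sum_adj_out a : \sum_(z | out z) (adj a i z)%:R = (d a)%:R :> R.
Proof. by rewrite -dg_self /dg natr_sum. Qed.

Lemma sum_adj_delta a (x : 'I_n) : out x ->
  \sum_(z | out z) (adj a i z)%:R * (x == z)%:R = (adj a i x)%:R :> R.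
Proof.
move=> xo; rewrite (bigD1 x)//= eqxx mulr1 big1 ?addr0// => z /andP[_ zx].
by rewrite eq_sym (negbTE zx) mulr0.
Qed.

(** Given a pair of neighbours of [i], there are [d^2] second pairs, at most [4 d] of them with a
    prescribed coincidence and at most 2 with the same edge. *)
Lemma pair_bound_sum a (b1 b2 b3 : R) : 0 <= b1 -> 0 <= b2 -> 0 <= b3 ->
  \sum_(y | out y) \sum_(z | out z) (adj a i y)%:R * (adj a i z)%:R *
    \sum_(y' | out y') \sum_(z' | out z') (adj a i y')%:R * (adj a i z')%:R *
       pair_bound b1 b2 b3 y z y' z'
  <= (d a)%:R ^+ 2 * (b3 * (d a)%:R ^+ 2 + 4 * b2 * (d a)%:R + 2 * b1).
Proof.
move=> B1 B2 B3; set D : R := (d a)%:R; have D0 : 0 <= D by rewrite ler0n.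
have A0 x : 0 <= (adj a i x)%:R :> R by rewrite ler0n.
have A1 x : (adj a i x)%:R <= 1 :> R by rewrite lern1 leq_b1.
have inner (y z : 'I_n) : out y -> out z ->
    \sum_(y' | out y') \sum_(z' | out z') (adj a i y')%:R * (adj a i z')%:R *
       pair_bound b1 b2 b3 y z y' z' <= b3 * D ^+ 2 + 4 * b2 * D + 2 * b1.
  move=> yo zo.
  have E (y' : 'I_n) : \sum_(z' | out z') (adj a i y')%:R * (adj a i z')%:R * pair_bound b1 b2 b3 y z y' z' =
     (adj a i y')%:R * (b3 * D) + (adj a i y')%:R * (y == y')%:R * (b2 * D + b1 * (adj a i z)%:R)
     + (adj a i y')%:R * (z == y')%:R * (b2 * D + b1 * (adj a i y)%:R)
     + (adj a i y')%:R * (b2 * ((adj a i y)%:R + (adj a i z)%:R)).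
    rewrite (eq_bigr (fun z' =>
       ((adj a i y')%:R * (b3 + b2 * ((y == y')%:R + (z == y')%:R))) * (adj a i z')%:R
       + ((adj a i y')%:R * (b2 + b1 * (z == y')%:R)) * ((adj a i z')%:R * (y == z')%:R)
       + ((adj a i y')%:R * (b2 + b1 * (y == y')%:R)) * ((adj a i z')%:R * (z == z')%:R))); last first.
      by move=> z' _; rewrite /pair_bound; ring.
    rewrite !big_split/= -!mulr_sumr !sum_adj_delta// sum_adj_out -/D; ring.
  rewrite (eq_bigr _ (fun y' _ => E y')) !big_split/= -!mulr_suml !sum_adj_delta// sum_adj_out -/D.
  have H1 : (adj a i y)%:R * (b2 * D + b1 * (adj a i z)%:R) <= b2 * D + b1.
    apply: (@le_trans _ _ (1 * (b2 * D + b1 * 1))); last by rewrite mul1r mulr1.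
    apply: ler_pM => //; first by rewrite addr_ge0 ?mulr_ge0.
    by rewrite lerD2l ler_wpM2l.
  have H2 : (adj a i z)%:R * (b2 * D + b1 * (adj a i y)%:R) <= b2 * D + b1.
    apply: (@le_trans _ _ (1 * (b2 * D + b1 * 1))); last by rewrite mul1r mulr1.
    apply: ler_pM => //; first by rewrite addr_ge0 ?mulr_ge0.
    by rewrite lerD2l ler_wpM2l.
  have H3 : D * (b2 * ((adj a i y)%:R + (adj a i z)%:R)) <= D * (b2 * 2).
    by do 2 apply: ler_wpM2l => //; rewrite [leRHS](_ : 2 = 1 + 1)// lerD.
  apply: (@le_trans _ _ (D * (b3 * D) + (b2 * D + b1) + (b2 * D + b1) + D * (b2 * 2))).
    by rewrite lerD// lerD// lerD.
  by rewrite le_eqVlt; apply/orP; left; apply/eqP; ring.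
set T := b3 * D ^+ 2 + _ + _ in inner *.
have T0 : 0 <= T by rewrite !addr_ge0 ?mulr_ge0 ?exprn_ge0.
apply: (@le_trans _ _ (\sum_(y | out y) \sum_(z | out z) (adj a i y)%:R * (adj a i z)%:R * T)).
  apply: ler_sum => y yo; apply: ler_sum => z zo; apply: ler_wpM2l; first exact: mulr_ge0.
  exact: inner.
under eq_bigr do rewrite -mulr_suml -mulr_sumr sum_adj_out -/D.
by rewrite -!mulr_suml sum_adj_out -/D expr2.
Qed.

Definition edev_sum (a : cfg) : R := \sum_(y | out y) \sum_(z | out z)
  (adj a i y)%:R * (adj a i z)%:R * edev p w i y z a.

Let cw (a : cfg) : R := ((d a)%:R * (d a).+1%:R)^-1.

Notation b1 := (5 * k ^+ 4 * p).
Notation b2 := (5 * k ^+ 4 * p ^+ 2).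
Notation b3 := (188 * k ^+ 5 * p ^+ 2).

(** The [edev] see only edges avoiding [i], so they are independent of the neighbourhood that
    selects them. The covariance bounds can therefore be summed over that neighbourhood before
    averaging over its size. *)
Lemma Ex_edev_sum :
  Ex (fun a => (edev_sum a / ((d a)%:R * (d a).+1%:R)) ^+ 2) <=
  b3 + 4 * b2 * k + 2 * b1 * (2 * k ^+ 2).
Proof.
have B1 : 0 <= b1 := b1_ge0 hp hb hn; have B2 : 0 <= b2 := b2_ge0 hp hb hn.
have B3 : 0 <= b3 := b3_ge0 hp hb hn.
pose e y z a := edev p w i y z a.
pose A y z (a : cfg) : R := (adj a i y)%:R * (adj a i z)%:R.
apply: (@le_trans _ _ (Ex (fun a => \sum_(y | out y) \sum_(z | out z)
    \sum_(y' | out y') \sum_(z' | out z')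
     (A y z a * A y' z' a * cw a ^+ 2) * (e y z a * e y' z' a)))).
  rewrite le_eqVlt; apply/orP; left; apply/eqP/eq_Ex => a.
  rewrite exprMn -/(cw a) expr2 mulrAC /edev_sum.
  rewrite !mulr_suml; apply: eq_bigr => y _; rewrite !mulr_suml; apply: eq_bigr => z _.
  rewrite mulr_sumr; apply: eq_bigr => y' _; rewrite mulr_sumr; apply: eq_bigr => z' _.
  by rewrite /A /e; ring.
rewrite !Ex_sum.
apply: (@le_trans _ _ (\sum_(y | out y) \sum_(z | out z) \sum_(y' | out y') \sum_(z' | out z')
    Ex (fun a => A y z a * A y' z' a * cw a ^+ 2 * pair_bound b1 b2 b3 y z y' z'))).
  apply: ler_sum => y yo; rewrite Ex_sum; apply: ler_sum => z zo.
  rewrite Ex_sum; apply: ler_sum => y' yo'; rewrite Ex_sum; apply: ler_sum => z' zo'.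
  have [yi yj] := outP yo; have [zi zj] := outP zo.
  have [yi' yj'] := outP yo'; have [zi' zj'] := outP zo'.
  have depA : dep (star i [:: j]) (fun a => A y z a * A y' z' a * cw a ^+ 2).
    apply: depM; first by apply: depM; apply: depM; apply: dep_adj => _; apply: star_edge; rewrite ?inE.
    apply: (@dep_dg _ _ _ i _ (fun d => (d%:R * d.+1%:R)^-1 ^+ 2)) => u; exact: star_edge.
  rewrite (@Ex_indep _ _ _ (star i [:: j]) (avoid i)); first last.
  - by move=> x /starP[u [-> _ _]]; rewrite avoid_edge eqxx.
  - by apply: depM; apply: dep_avoid_edev.
  - exact: depA.
  rewrite ExZr; apply: ler_wpM2l; last exact: (Ex_edev2 hp hb hw hn).
  by apply: Ex_ge0 => // a; apply: mulr_ge0; rewrite ?sqr_ge0// /A !mulr_ge0 ?ler0n.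
apply: (@le_trans _ _ (Ex (fun a => b3 + 4 * b2 * (d a).+1%:R^-1 + 2 * b1 * (d a).+1%:R ^- 2))).
  under eq_bigr do under eq_bigr do (under eq_bigr do rewrite -Ex_sum; rewrite -Ex_sum).
  under eq_bigr do rewrite -Ex_sum.
  rewrite -Ex_sum; apply: le_Ex => // a.
  apply: (@le_trans _ _ (cw a ^+ 2 * ((d a)%:R ^+ 2 * (b3 * (d a)%:R ^+ 2 + 4 * b2 * (d a)%:R + 2 * b1)))).
    apply: le_trans (ler_wpM2l (sqr_ge0 _) (pair_bound_sum a B1 B2 B3)).
    rewrite le_eqVlt; apply/orP; left; apply/eqP.
    rewrite mulr_sumr; apply: eq_bigr => y _; rewrite mulr_sumr; apply: eq_bigr => z _.
    rewrite !mulr_sumr; apply: eq_bigr => y' _; rewrite !mulr_sumr; apply: eq_bigr => z' _.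
    by rewrite /A; ring.
  have d1 : (0 : R) < (d a).+1%:R by rewrite ltr0n.
  rewrite /cw; case: (d a) d1 => [|e'] d1.
    rewrite mul0r invr0 expr0n/= mul0r; apply: addr_ge0; first apply: addr_ge0 => //.
      by apply: mulr_ge0; [apply: mulr_ge0|rewrite invr_ge0 ltW].
    by apply: mulr_ge0; [apply: mulr_ge0|rewrite invr_ge0 exprn_ge0// ltW].
  rewrite -[e'.+2%:R]natr1; set x : R := e'.+1%:R.
  have x0 : 0 < x by rewrite ltr0n.
  have x1 : 0 < x + 1 by rewrite addr_gt0.
  rewrite [leLHS](_ : _ = b3 * (x / (x + 1)) ^+ 2 + 4 * b2 * (x / (x + 1)) * (x + 1)^-1
     + 2 * b1 * (x + 1) ^- 2); last first.
    by clearbody x; field; rewrite !gt_eqF// (L_gt0 hp hb hn).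
  have q1 : x / (x + 1) <= 1 by rewrite ler_pdivrMr// mul1r lerDl.
  have q0 : 0 <= x / (x + 1) by rewrite divr_ge0 ?ltW.
  rewrite lerD2r; apply: lerD.
    by rewrite ler_piMr// exprn_ile1.
  by apply: ler_wpM2r; [rewrite invr_ge0 ltW|rewrite ler_piMr// mulr_ge0].
rewrite !ExD !ExZ Ex_cst.
apply: lerD; first apply: lerD => //.
  by apply: ler_wpM2l; [exact: mulr_ge0|exact: (dg_inv1_kap hp hb hw hn)].
by apply: ler_wpM2l; [exact: mulr_ge0|exact: (dg_inv2 hp hb hw hn)].
Qed.

(** Replacing each [ewt] by [M^-1] leaves a function of the degree [d] alone: there are [d^2 - d]
    ordered pairs of distinct neighbours. *)
Lemma tri_atE a : tri_at i j a - (2 * M)^-1 =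
  2^-1 * (edev_sum a / ((d a)%:R * (d a).+1%:R))
  + (2 * M)^-1 * (((d a)%:R ^+ 2 - (d a)%:R) / ((d a)%:R * (d a).+1%:R) - 1).
Proof.
have E : \sum_(y | out y) \sum_(z | out z)
     (adj a i y && adj a y z && adj a z i)%:R / ((dg y [::] a)%:R * (dg z [::] a)%:R) =
  edev_sum a + M^-1 * ((d a)%:R ^+ 2 - (d a)%:R).
  have -> : (d a)%:R ^+ 2 - (d a)%:R = \sum_(y | out y) \sum_(z | out z)
      ((adj a i y)%:R * (adj a i z)%:R - (adj a i y)%:R * ((adj a i z)%:R * (y == z)%:R)) :> R.
    under eq_bigr do rewrite sumrB -!mulr_sumr.
    rewrite sumrB -mulr_suml !sum_adj_out expr2; congr (_ - _).
    rewrite -sum_adj_out; apply: eq_bigr => y yo; rewrite sum_adj_delta//.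
    by case: (adj a i y); rewrite ?mulr1 ?mulr0.
  rewrite /edev_sum mulr_sumr -big_split/=; apply: eq_bigr => y yo.
  rewrite mulr_sumr -big_split/=; apply: eq_bigr => z zo.
  have [yi _] := outP yo; have [zi _] := outP zo.
  rewrite /edev; case: eqVneq => [<-|yz].
    by rewrite adjii andbF mul0r /=; ring.
  rewrite /= mulr0 mulr0 subr0.
  have [iy|_] := boolP (adj a i y); last by rewrite !mul0r; ring.
  have [yzA|yzA] := boolP (adj a y z); last first.
    by rewrite /ewt (negbTE yzA) !mul0r; ring.
  rewrite /ewt yzA (adjC a z i); have [iz|_] := boolP (adj a i z); last by rewrite /= !(mul0r, mulr0) addr0.
  have -> : dg y [::] a = (2 + dg y [:: z; i] a)%N.
    rewrite (@dg_split _ y [::] i)// (@dg_split _ y [:: i] z) ?inE// adjC iy yzA.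
    by [].
  have -> : dg z [::] a = (2 + dg z [:: y; i] a)%N.
    rewrite (@dg_split _ z [::] i)// (@dg_split _ z [:: i] y) ?inE// adjC iz adjC yzA.
    by [].
  by rewrite /= !mulr1 !mul1r subrK.
rewrite /tri_at E; move: (edev_sum a) => S; rewrite [(2 * M)^-1]invfM; set Q : R := ((d a)%:R * (d a).+1%:R)^-1; clearbody Q; set x : R := (d a)%:R; clearbody x; ring.
Qed.

Lemma Ex_tri_at : Ex (fun a => (tri_at i j a - (2 * M)^-1) ^+ 2) <=
  104 * k ^+ 5 * p ^+ 2 + 14 * k ^+ 6 * p.
Proof.
apply: (@le_trans _ _ (Ex (fun a => 2^-1 * (edev_sum a / ((d a)%:R * (d a).+1%:R)) ^+ 2
   + (2 * M ^- 2) * (d a).+1%:R ^- 2))).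
  apply: le_Ex => // a; rewrite tri_atE.
  apply: (le_trans (sqr_sum2_le _ _)); rewrite mulrDr; apply: lerD.
    by rewrite exprMn mulrA le_eqVlt; apply/orP; left; apply/eqP; congr (_ * _); field.
  set u := (X in (_ * X) ^+ 2).
  (* Here [u] is [- 2 / (d + 1)] for positive [d], and [- 1] at [d = 0], where the quotient is 0 by
     convention. *)
  have U : u ^+ 2 <= 4 * (d a).+1%:R ^- 2.
    rewrite /u; case: (d a) => [|e].
      by rewrite mul0r invr0 mulr0 sub0r sqrrN expr1n invr1 mulr1 ler1n.
    rewrite -[e.+2%:R]natr1; set x : R := e.+1%:R.
    have x0 : 0 < x by rewrite ltr0n.
    have x1 : 0 < x + 1 by rewrite addr_gt0.
    rewrite le_eqVlt; apply/orP; left; apply/eqP; clearbody x; field.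
    by rewrite !gt_eqF.
  rewrite exprMn; apply: (@le_trans _ _ (2 * ((2 * M)^-1 ^+ 2 * (4 * (d a).+1%:R ^- 2)))).
    by rewrite ler_wpM2l// ler_wpM2l ?sqr_ge0.
  rewrite le_eqVlt; apply/orP; left; apply/eqP.
  have : (0 : R) < (d a).+1%:R by rewrite ltr0n.
  by move: ((d a).+1%:R : R) => x x0; field; rewrite !gt_eqF.
rewrite ExD !ExZ.
have H1 := Ex_edev_sum.
have H2 := dg_inv2 hp hb hw hn i (s := [:: j]) isT.
have Mk := invM2_le hp hb hw hn.
have pk : k ^+ 6 * p ^+ 2 <= k ^+ 6 * p.
  have /andP[_ p1] := hp.
  by apply: ler_wpM2l; [exact: exprn_ge0|rewrite expr2 ler_piMr].
apply: (@le_trans _ _ (2^-1 * (b3 + 4 * b2 * k + 2 * b1 * (2 * k ^+ 2)) + 2 * (k ^+ 4 * p ^+ 2) * (2 * k ^+ 2))).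
  apply: lerD; first by rewrite ler_wpM2l ?invr_ge0.
  apply: ler_pM.
  - by rewrite mulr_ge0// invr_ge0 sqr_ge0.
  - by apply: Ex_ge0 => // a; rewrite invr_ge0 sqr_ge0.
  - by rewrite ler_wpM2l.
  - exact: H2.
rewrite [leLHS](_ : _ = 104 * k ^+ 5 * p ^+ 2 + 10 * k ^+ 6 * p + 4 * (k ^+ 6 * p ^+ 2)); last by field; rewrite gt_eqF// (L_gt0 hp hb hn).
rewrite -addrA lerD2l [leRHS](_ : _ = 10 * k ^+ 6 * p + 4 * (k ^+ 6 * p)); last by ring.
by rewrite lerD2l ler_wpM2l.
Qed.

End pair.
End edge_pairs.

(** * Variance of the remainder *)

Lemma sqr_sum6_le {R : realFieldType} (a b c d e f : R) :
  (a - b - c + d + e + f) ^+ 2 <=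
  6 * (a ^+ 2 + b ^+ 2 + c ^+ 2 + d ^+ 2 + e ^+ 2 + f ^+ 2).
Proof.
rewrite -subr_ge0 (_ : _ - _ =
  (a + b) ^+ 2 + (a + c) ^+ 2 + (a - d) ^+ 2 + (a - e) ^+ 2 + (a - f) ^+ 2
  + (b - c) ^+ 2 + (b + d) ^+ 2 + (b + e) ^+ 2 + (b + f) ^+ 2
  + (c + d) ^+ 2 + (c + e) ^+ 2 + (c + f) ^+ 2
  + (d - e) ^+ 2 + (d - f) ^+ 2 + (e - f) ^+ 2); last by ring.
by rewrite !addr_ge0 ?sqr_ge0.
Qed.

Lemma sqr_dist4_le {R : realFieldType} (u v : R) :
  u <= v -> v <= u + 4 -> (u - v) ^+ 2 <= 16.
Proof. by nra. Qed.

Lemma remainder_combine {R : realFieldType} (X Y K a b c d e f : R) :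
  0 <= X -> 0 <= Y -> 2 <= K ->
  a <= 504 * (K ^+ 2 * X) + 504 * (K * Y) -> b <= 104 * X + 14 * Y ->
  c <= 104 * X + 14 * Y -> d <= 2 * X + 32 * Y -> e <= 2 * X + 32 * Y ->
  f <= 4 * (K ^+ 2 * Y) -> 6 * (a + b + c + d + e + f) <= 3600 * (K ^+ 2 * (X + Y)).
Proof.
move=> X0 Y0 K2 *.
have : 4 * X <= K ^+ 2 * X by rewrite ler_wpM2r//; nra.
have : 4 * Y <= K ^+ 2 * Y by rewrite ler_wpM2r//; nra.
have : K * Y <= K ^+ 2 * Y by rewrite ler_wpM2r//; nra.
rewrite [K ^+ 2 * (_ + _)]mulrDr; lra.
Qed.

Section edge_pairs.
Context {R : realFieldType} {n : nat} (p : R) (w : 'I_n -> R) (beta : R).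
Hypothesis hp : 0 < p <= 1.
Hypothesis hb : 0 < beta.
Hypothesis hw : forall i, beta <= w i <= 1.
Hypothesis hn : 12 <= beta * n%:R.

Implicit Types (i j x y z : 'I_n).
Notation cfg := {ffun 'I_n * 'I_n -> bool}.
Notation m := (mdeg p w).
Notation M := (mtot p w).
Notation W := (wsum w).
Notation Ex := (Ex (rq p w)).
Notation L := (avgd (n := n) p).
Notation kap := (kap beta).
Let q01 := rq01 hp hb hw.
Let p0 : 0 < p. Proof. by case/andP: hp. Qed.
Let p0' : 0 <= p. Proof. exact: ltW. Qed.

Notation k := (kap / L).

Let k0 : 0 <= k.
Proof. by rewrite ltW// divr_gt0 ?(kap_gt0 hb) ?(L_gt0 hp hb hn). Qed.

Let M0 : 0 < M. Proof. exact: M_gt0 hp hw hn. Qed.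

Let kL : k * L = kap.
Proof. by rewrite mulfVK// gt_eqF// (L_gt0 hp hb hn). Qed.

(** The variance of a degree is at most [m i], and its mean is within 4 of [m i], hence the squared
    bias 16. *)
Lemma Ex_deg_dev i j : Ex (fun a => (((dg i [:: j] a)%:R / m i - 1) / M) ^+ 2) <=
  2 * k ^+ 5 * p ^+ 2 + 32 * k ^+ 6 * p.
Proof.
have mi : 0 < m i := m_gt0 hp hb hw hn i.
have mk : (m i)^-1 <= k := invm_le hp hb hw hn i.
have l1 := lamx_le hp hb hw i [:: j].
have l2 := m_lamx hp hb hw i (s := [:: j]) isT.
have V := dg_var hp hb hw i [:: j].
have Mk := invM2_le hp hb hw hn.
apply: (@le_trans _ _ (Ex (fun a => (2 * M ^- 2 * (m i) ^- 2) * ((dg i [:: j] a)%:R - lamx p w i [:: j]) ^+ 2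
    + 2 * M ^- 2 * (m i) ^- 2 * 16))).
  apply: le_Ex => // a; set x : R := (dg i [:: j] a)%:R.
  have -> : ((x / m i - 1) / M) ^+ 2 = M ^- 2 * (m i) ^- 2 *
      ((x - lamx p w i [:: j]) + (lamx p w i [:: j] - m i)) ^+ 2.
    by clearbody x; field; rewrite !gt_eqF.
  rewrite [leRHS](_ : _ = M ^- 2 * m i ^- 2 * (2 * ((x - lamx p w i [:: j]) ^+ 2 + 16))); last by ring.
  apply: ler_wpM2l; first by apply: mulr_ge0; rewrite invr_ge0 sqr_ge0.
  apply: (le_trans (sqr_sum2_le _ _)); rewrite ler_wpM2l// lerD2l.
  exact: sqr_dist4_le.
rewrite ExD ExZ Ex_cst -!mulrDr.
have c0 : 0 <= 2 * M ^- 2 * m i ^- 2.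
  by apply: mulr_ge0; [apply: mulr_ge0|]; rewrite ?invr_ge0 ?sqr_ge0.
apply: (@le_trans _ _ (2 * M ^- 2 * m i ^- 2 * (m i + 16))).
  by rewrite ler_wpM2l// lerD2r.
have -> : 2 * M ^- 2 * m i ^- 2 * (m i + 16) = M ^- 2 * (2 * (m i)^-1 + 32 * (m i)^-1 ^+ 2).
  by field; rewrite !gt_eqF.
have mi0 : 0 <= (m i)^-1 by rewrite invr_ge0 ltW.
apply: (@le_trans _ _ (k ^+ 4 * p ^+ 2 * (2 * k + 32 * k ^+ 2))).
  apply: ler_pM => //.
  - by rewrite invr_ge0 sqr_ge0.
  - by apply: addr_ge0; rewrite mulr_ge0// sqr_ge0.
  - apply: lerD; first by rewrite ler_wpM2l.
    by rewrite ler_wpM2l// lerXn2r ?nnegrE.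
have pk : k ^+ 6 * p ^+ 2 <= k ^+ 6 * p.
  have /andP[_ p1] := hp.
  by apply: ler_wpM2l; [exact: exprn_ge0|rewrite expr2 ler_piMr].
rewrite [leLHS](_ : _ = 2 * k ^+ 5 * p ^+ 2 + 32 * (k ^+ 6 * p ^+ 2)); last by move: k => kk; ring.
by rewrite lerD2l -mulrA ler_wpM2l.
Qed.

Lemma mm_bound i j : ((m i + m j) / M ^+ 2) ^+ 2 <= 4 * kap ^+ 2 * k ^+ 6 * p.
Proof.
have Mk := invM2_le hp hb hw hn.
have mi x : 0 < m x := m_gt0 hp hb hw hn x.
have ml x : m x <= L := m_le hp hb hw hn x.
have /andP[_ p1] := hp.
apply: (@le_trans _ _ ((2 * L) ^+ 2 * (k ^+ 4 * p ^+ 2) ^+ 2)).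
  rewrite exprMn; apply: ler_pM; rewrite ?sqr_ge0//.
    rewrite lerXn2r ?nnegrE ?addr_ge0 ?(ltW (mi _))//.
      by rewrite mulr_ge0// ltW// (L_gt0 hp hb hn).
    by have := ml i; have := ml j; lra.
  rewrite lerXn2r ?nnegrE ?invr_ge0 ?sqr_ge0//.
  by rewrite mulr_ge0 ?exprn_ge0.
rewrite [leLHS](_ : _ = 4 * (k * L) ^+ 2 * k ^+ 6 * p ^+ 4); last by ring.
rewrite kL; apply: ler_wpM2l.
  by apply: mulr_ge0; [apply: mulr_ge0; rewrite ?sqr_ge0|exact: exprn_ge0].
rewrite exprS ler_piMr// exprn_ile1//.
Qed.

Lemma Ex_cdiff_remainder i j : i != j ->
  Ex (fun a => cdiff (edge i j) (fun a => wtri a - lintri p w a) a ^+ 2) <=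
  3600 * kap ^+ 2 * (k ^+ 5 * p ^+ 2 + k ^+ 6 * p).
Proof.
move=> ij; have ji : j != i by rewrite eq_sym.
have K2 := kap_ge2 hb hw hn.
have H1 := Ex_cotri hp hb hw hn ij.
have H2 := Ex_tri_at hp hb hw hn i j.
have H3 := Ex_tri_at hp hb hw hn j i.
have H4 := Ex_deg_dev i j.
have H5 := Ex_deg_dev j i.
have H6 := mm_bound i j.
apply: (@le_trans _ _ (6 * (Ex (fun a => cotri p w i j a ^+ 2)
   + Ex (fun a => (tri_at i j a - (2 * M)^-1) ^+ 2)
   + Ex (fun a => (tri_at j i a - (2 * M)^-1) ^+ 2)
   + Ex (fun a => (((dg i [:: j] a)%:R / m i - 1) / M) ^+ 2)
   + Ex (fun a => (((dg j [:: i] a)%:R / m j - 1) / M) ^+ 2)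
   + ((m i + m j) / M ^+ 2) ^+ 2))).
  rewrite -[((m i + m j) / M ^+ 2) ^+ 2](Ex_cst (rq p w)) -!ExD -ExZ; apply: le_Ex => // a.
  by rewrite (cdiff_remainder hp hb hw hn ij); exact: sqr_sum6_le.
have E1 : 504 * k ^+ 7 * (L ^+ 2 * p ^+ 2 + L * p) =
    504 * (kap ^+ 2 * (k ^+ 5 * p ^+ 2)) + 504 * (kap * (k ^+ 6 * p)).
  transitivity (504 * ((k * L) ^+ 2 * (k ^+ 5 * p ^+ 2)) + 504 * ((k * L) * (k ^+ 6 * p))).
    by ring.
  by rewrite kL.
rewrite E1 in H1.
have X0 : 0 <= k ^+ 5 * p ^+ 2 by rewrite mulr_ge0 ?sqr_ge0// exprn_ge0.
have Y0 : 0 <= k ^+ 6 * p by rewrite mulr_ge0// exprn_ge0.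
rewrite -(mulrA 104) -(mulrA 14) in H2 H3; rewrite -(mulrA 2) -(mulrA 32) in H4 H5.
rewrite -(mulrA 4) -(mulrA 4) -(mulrA (kap ^+ 2)) in H6; rewrite -(mulrA 3600).
exact: remainder_combine X0 Y0 K2 H1 H2 H3 H4 H5 H6.
Qed.

Lemma dep_upper (F : cfg -> R) :
  (forall a b, (forall x y, adj a x y = adj b x y) -> F a = F b) -> dep upper F.
Proof.
move=> H a b ab; apply: H => x y; rewrite /adj; case: eqP => //= /eqP xy.
by rewrite ab// upper_edge.
Qed.

Lemma dep_upper_wtri : dep upper (wtri : cfg -> R).
Proof.
apply: dep_upper => a b ab; rewrite /wtri; congr (_ * _).
have dgE x : dg x [::] a = dg x [::] b by apply: eq_bigr => y _; rewrite ab.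
do 3 (apply: eq_bigr => ? _).
by rewrite /tri !ab !dgE.
Qed.

Lemma dep_upper_lintri : dep upper (lintri p w).
Proof.
apply: dep_upper => a b ab; rewrite /lintri; congr (_ * _).
do 3 (apply: eq_bigr => ? _).
by rewrite /ztri /zadj !ab.
Qed.

(** Only coordinates above the diagonal can contribute, each with variance at most [p]; counting all
    [n^2] pairs is generous enough. *)
Lemma efron_stein_graph (F : cfg -> R) (B : R) : dep upper F -> 0 <= B ->
  (forall i j, i != j -> Ex (fun a => cdiff (edge i j) F a ^+ 2) <= B) ->
  Ex (fun a => (F a - Ex F) ^+ 2) <= n%:R ^+ 2 * p * B.
Proof.
move=> FU B0 FB; apply: (le_trans (efron_stein q01 F)).
apply: (@le_trans _ _ (\sum_(e : 'I_n * 'I_n) p * B)); last first.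
  rewrite sumr_const card_prod card_ord -[leLHS]mulr_natr natrM.
  by rewrite le_eqVlt; apply/orP; left; apply/eqP; ring.
apply: ler_sum => e _.
have [eU|eU] := boolP (upper e); last first.
  rewrite [X in _ * X](_ : _ = 0) ?mulr0 ?mulr_ge0//.
  rewrite -[RHS](Ex_cst (rq p w)); apply: eq_Ex => a.
  by rewrite (cdiff_dep _ FU eU) expr0n.
apply: ler_pM.
- exact: evar_ge0.
- by apply: Ex_ge0 => // a; exact: sqr_ge0.
- apply: (le_trans (evar_le q01 _)); exact: (rmu_le hp hb hw).
- rewrite (upperE eU); apply: FB; move: eU; rewrite /upper.
  by apply: contraTneq => ->; rewrite ltnn.
Qed.

(** Multiplying the derivative bound by [n^2 p] and using [k * L = kap] leaves order
    [L^-3 (p + 1/L)]: smaller than the variance of [lintri] by a factor that tends to 0. *)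
Lemma var_remainder :
  Ex (fun a => ((wtri a - lintri p w a) - Ex (fun a => wtri a - lintri p w a)) ^+ 2) <=
  3600 * kap ^+ 4 * (k ^+ 3 * (p + k)).
Proof.
have dU : dep upper (fun a => wtri a - lintri p w a).
  by move=> a b ab; rewrite (dep_upper_wtri ab) (dep_upper_lintri ab).
have B0 : 0 <= 3600 * kap ^+ 2 * (k ^+ 5 * p ^+ 2 + k ^+ 6 * p).
  apply: mulr_ge0; first by rewrite mulr_ge0 ?sqr_ge0.
  by apply: addr_ge0; apply: mulr_ge0; rewrite ?exprn_ge0.
apply: (le_trans (efron_stein_graph dU B0 Ex_cdiff_remainder)).
rewrite [leLHS](_ : _ = 3600 * kap ^+ 2 * ((k * L) ^+ 2 * (k ^+ 3 * (p + k)))); last first.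
  by rewrite /avgd; ring.
by rewrite kL le_eqVlt; apply/orP; left; apply/eqP; ring.
Qed.

End edge_pairs.

(** * The centred codegrees: derivatives of the leading term *)

Section edge_pairs.
Context {R : realFieldType} {n : nat} (p : R) (w : 'I_n -> R) (beta : R).
Hypothesis hp : 0 < p <= 1.
Hypothesis hb : 0 < beta.
Hypothesis hw : forall i, beta <= w i <= 1.
Hypothesis hn : 12 <= beta * n%:R.

Implicit Types (i j x y z : 'I_n).
Notation cfg := {ffun 'I_n * 'I_n -> bool}.
Notation m := (mdeg p w).
Notation M := (mtot p w).
Notation W := (wsum w).
Notation Ex := (Ex (rq p w)).
Notation L := (avgd (n := n) p).
Notation kap := (kap beta).
Let q01 := rq01 hp hb hw.
Let p0 : 0 < p. Proof. by case/andP: hp. Qed.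
Let p0' : 0 <= p. Proof. exact: ltW. Qed.

Notation k := (kap / L).
Notation sg x y := (evar (rq p w) (edge x y)).

Let k0 : 0 <= k.
Proof. by rewrite ltW// divr_gt0 ?(kap_gt0 hb) ?(L_gt0 hp hb hn). Qed.

Let mi0 x : 0 < m x. Proof. exact: m_gt0 hp hb hw hn x. Qed.

Definition tcoef x y z : R := (m x * m y * m z)^-1.

Lemma tcoef_bound x y z : 0 <= tcoef x y z <= k ^+ 3.
Proof.
have h u : 0 <= (m u)^-1 by rewrite invr_ge0 ltW.
have hk u : (m u)^-1 <= k := invm_le hp hb hw hn u.
rewrite /tcoef invfM invfM; apply/andP; split; first exact: (mulr_ge0 (mulr_ge0 (h _) (h _)) (h _)).
rewrite [k ^+ 3](_ : _ = k * k * k); last by ring.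
by apply: ler_pM => //; [rewrite mulr_ge0|apply: ler_pM].
Qed.

Lemma tcoef_pow_le x y z l : tcoef x y z ^+ l <= (k ^+ 3) ^+ l.
Proof.
have /andP[t0 t1] := tcoef_bound x y z.
by rewrite lerXn2r ?nnegrE ?exprn_ge0.
Qed.

Lemma sg_ge0 x y : 0 <= sg x y. Proof. exact: evar_ge0. Qed.

Lemma sg_le x y : sg x y <= p.
Proof. by apply: (le_trans (evar_le q01 _)); rewrite rq_edge (rmu_le hp hb hw). Qed.

Lemma nodep_zadj x y e : (x != y -> edge x y != e) -> nodep e (zadj p w x y).
Proof.
move=> h a c; rewrite /zadj /adj; case: (eqVneq x y) => //= xy.
by rewrite updE (negbTE (h xy)).
Qed.

Lemma zadj_fun x y : x != y -> zadj p w x y =1 centered (rq p w) (edge x y).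
Proof. by move=> xy a; rewrite zadjE. Qed.

(** The derivative of [lintri] at ij ([cdiff_lintri_ycod]); it does not involve the edge ij
    ([nodep_ycod]). *)
Definition ycod i j (a : cfg) : R :=
  \sum_(z | z \notin [:: i; j]) zadj p w i z a * (zadj p w j z a * tcoef i j z).

Lemma cdiff_lintri_ycod i j a : i != j -> cdiff (edge i j) (lintri p w) a = ycod i j a.
Proof.
by move=> ij; rewrite cdiff_lintri//; apply: eq_bigr => z _; rewrite -mulrA.
Qed.

Lemma ycodC i j a : ycod i j a = ycod j i a.
Proof.
rewrite /ycod; apply: eq_big => [z|z _]; first by rewrite !inE orbC.
by rewrite /tcoef [m i * m j]mulrC; ring.
Qed.

Lemma nodep_ycod i j : i != j -> nodep (edge i j) (ycod i j).
Proof.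
move=> ij; apply: nodep_sum => z /outP[zi zj].
apply: nodepM; last apply: nodepM => //.
- by apply: nodep_zadj => _; rewrite edge_eq eqxx/= (negbTE zj) (negbTE ij).
- by apply: nodep_zadj => _; rewrite edge_eq eqxx/= (negbTE zi) eq_sym (negbTE ij) .
Qed.

Lemma lintri_ycod a : lintri p w a =
  6^-1 * \sum_x \sum_(y | y != x) zadj p w x y a * ycod x y a.
Proof.
rewrite /lintri; congr (_ * _); apply: eq_bigr => x _.
rewrite (bigD1 x)//= big1 ?add0r; last by move=> z _; exact: ztri_diag.
apply: eq_bigr => y yx; have xy : x != y by rewrite eq_sym.
rewrite (sum_split2 _ xy) (_ : ztri p w a x y x = 0); last first.
  by rewrite ztri_swap23 ztri_diag.
rewrite (_ : ztri p w a x y y = 0) ?add0r; last first.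
  by rewrite ztri_swap12 ztri_swap23 ztri_diag.
rewrite /ycod mulr_sumr; apply: eq_bigr => z _.
by rewrite /ztri (zadjC _ _ z x) /tcoef; ring.
Qed.

Lemma ycod_centered i j a : i != j -> ycod i j a =
  \sum_(z | z \notin [:: i; j]) centered (rq p w) (edge i z) a * (zadj p w j z a * tcoef i j z).
Proof.
move=> ij; apply: eq_bigr => z /outP[zi zj].
by rewrite zadjE// eq_sym.
Qed.

Lemma edge_injl i (P : pred 'I_n) : {in P &, injective (edge i)}.
Proof.
by move=> x y _ _ /edge_inj[[_ ->]|[-> ->]].
Qed.

Lemma nodep_star i j (z z' : 'I_n) : i != j -> z \notin [:: i; j] -> z' \notin [:: i; j] ->
  nodep (edge i z') (fun a => zadj p w j z a * tcoef i j z).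
Proof.
move=> ij /outP[zi zj] /outP[zi' zj']; apply: nodepM => //.
apply: nodep_zadj => _; rewrite edge_eq (eq_sym j i) (negbTE ij)/=.
by rewrite (negbTE zi) andbF.
Qed.

Lemma Ex_zadj2 x y : x != y -> Ex (fun a => zadj p w x y a ^+ 2) = sg x y.
Proof.
move=> xy; rewrite (@eq_Ex _ _ _ _ (fun a => centered (rq p w) (edge x y) a ^+ 2 * 1)).
  by rewrite Ex_centered_sq ?Ex_cst ?mulr1.
by move=> a; rewrite zadj_fun// mulr1.
Qed.

Lemma zadj_sqr_le1 x y a : zadj p w x y a ^+ 2 <= 1.
Proof.
rewrite /zadj; have := rmu_ge0 hp hb hw x y; have := rmu_le hp hb hw x y.
move=> h1 h0; have h2 : rmu p w x y <= 1 by case/andP: hp => _; exact: le_trans.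
move: (rmu p w x y) h0 h2 => u h0 h2.
by case: (adj a x y) => /=; nra.
Qed.

Lemma Ex_ycod2 i j : i != j -> Ex (fun a => ycod i j a ^+ 2) =
  \sum_(z | z \notin [:: i; j]) sg i z * (sg j z * tcoef i j z ^+ 2).
Proof.
move=> ij; rewrite (@eq_Ex _ _ _ _ (fun a => (\sum_(z | z \notin [:: i; j])
  centered (rq p w) (edge i z) a * (zadj p w j z a * tcoef i j z)) ^+ 2)); last first.
  by move=> a; rewrite ycod_centered.
rewrite Ex_sq_sum_centered.
- apply: eq_bigr => z /outP[zi zj]; congr (_ * _).
  rewrite (@eq_Ex _ _ _ _ (fun a => zadj p w j z a ^+ 2 * tcoef i j z ^+ 2)); last first.
    by move=> a; rewrite exprMn.
  by rewrite ExZr Ex_zadj2// eq_sym.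
- exact: edge_injl.
- by move=> z z' zo zo'; exact: nodep_star.
Qed.

(** A linear form in the centred edges at [i] whose coefficients involve edges at [j] only, so
    [Ex_pow4_sum_centered] applies; each [tcoef] costs [k ^+ 3]. *)
Lemma Ex_ycod4 i j : i != j -> Ex (fun a => ycod i j a ^+ 4) <=
  k ^+ 12 * (9 / 2 * (L * p) ^+ 2 + 5 / 2 * (L * p)).
Proof.
move=> ij; rewrite (@eq_Ex _ _ _ _ (fun a => (\sum_(z | z \notin [:: i; j])
  centered (rq p w) (edge i z) a * (zadj p w j z a * tcoef i j z)) ^+ 4)); last first.
  by move=> a; rewrite ycod_centered.
apply: le_trans (Ex_pow4_sum_centered q01 (@edge_injl _ _) (fun z z' zo zo' => nodep_star ij zo zo')) _.
have p0l : 0 <= L by rewrite ltW// (L_gt0 hp hb hn).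
have K0 l : 0 <= k ^+ l by exact: exprn_ge0.
have S1 z (P : pred 'I_n) : z \notin [:: i; j] ->
   \sum_(l | (l \notin [:: i; j]) && (l != z)) sg i l *
     Ex (fun a => (zadj p w j l a * tcoef i j l) ^+ 2 * (zadj p w j z a * tcoef i j z) ^+ 2)
   <= (L * p) * (p * k ^+ 12).
  move=> /outP[zi zj].
  apply: (@le_trans _ _ (\sum_(l : 'I_n) p * (p * (p * k ^+ 12)))); last first.
    rewrite sumr_const card_ord -mulr_natl /avgd le_eqVlt; apply/orP; left; apply/eqP; ring.
  rewrite big_mkcond/=; apply: ler_sum => l _; case: ifP; last first.
    by move=> _; do 3 apply: mulr_ge0 => //.
  move=> /andP[/outP[li lj] lz]; apply: ler_pM.
  - exact: sg_ge0.
  - by apply: Ex_ge0 => // a; rewrite mulr_ge0 ?sqr_ge0.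
  - exact: sg_le.
  rewrite (@eq_Ex _ _ _ _ (fun a => (centered (rq p w) (edge j l) a ^+ 2 * zadj p w j z a ^+ 2) *
     (tcoef i j l ^+ 2 * tcoef i j z ^+ 2))); last first.
    by move=> a; rewrite -zadjE 1?eq_sym//; ring.
  rewrite ExZr Ex_centered_sq; last first.
    have h : nodep (edge j l) (zadj p w j z).
      apply: nodep_zadj => _; rewrite edge_eq eqxx/= (eq_sym z l) (negbTE lz)/=.
      by rewrite (negbTE zj) andbF.
    by move=> a c; rewrite h.
  rewrite Ex_zadj2 1?eq_sym//.
  rewrite [k ^+ 12](_ : _ = (k ^+ 3) ^+ 2 * (k ^+ 3) ^+ 2); last by rewrite -!exprM -exprD.
  rewrite [leRHS]mulrA; apply: ler_pM.
  - by apply: mulr_ge0; exact: sg_ge0.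
  - by apply: mulr_ge0; exact: sqr_ge0.
  - by apply: ler_pM; rewrite ?sg_ge0 ?sg_ge0 ?sg_le ?sg_le.
  - by apply: ler_pM; rewrite ?sqr_ge0 ?sqr_ge0 ?tcoef_pow_le ?tcoef_pow_le.
have S2 z : z \notin [:: i; j] ->
   Ex (fun a => (zadj p w j z a * tcoef i j z) ^+ 4) <= p * k ^+ 12.
  move=> /outP[zi zj].
  apply: (@le_trans _ _ (Ex (fun a => zadj p w j z a ^+ 2 * (k ^+ 3) ^+ 4))).
    apply: le_Ex => // a; rewrite exprMn; apply: ler_pM.
    - by rewrite (_ : 4 = 2 * 2)%N// exprM sqr_ge0.
    - by rewrite (_ : 4 = 2 * 2)%N// exprM sqr_ge0.
    - rewrite [leLHS](_ : _ = zadj p w j z a ^+ 2 * zadj p w j z a ^+ 2); last by ring.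
      by rewrite ler_piMr ?sqr_ge0 ?zadj_sqr_le1.
    - exact: tcoef_pow_le.
  rewrite ExZr Ex_zadj2 1?eq_sym// -exprM; apply: ler_wpM2r => //; exact: sg_le.
apply: (@le_trans _ _ (\sum_(z : 'I_n) p * (9 / 2 * ((L * p) * (p * k ^+ 12)) + 5 / 2 * (p * k ^+ 12)))); last first.
  rewrite sumr_const card_ord -mulr_natl /avgd le_eqVlt; apply/orP; left; apply/eqP; move: (k ^+ 12) => kk; ring.
have pk : 0 <= p * k ^+ 12 by apply: mulr_ge0.
rewrite big_mkcond/=; apply: ler_sum => z _; case: ifP; last first.
  move=> _; apply: mulr_ge0 => //; apply: addr_ge0; apply: mulr_ge0; rewrite ?divr_ge0//.
  by apply: mulr_ge0 => //; apply: mulr_ge0.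
move=> zo; apply: ler_pM.
- exact: sg_ge0.
- apply: addr_ge0; apply: mulr_ge0; rewrite ?divr_ge0//.
    apply: sumr_ge0 => l _; apply: mulr_ge0; first exact: sg_ge0.
    by apply: Ex_ge0 => // a; rewrite mulr_ge0 ?sqr_ge0.
  by apply: Ex_ge0 => // a; rewrite (_ : 4 = 2 * 2)%N// exprM sqr_ge0.
- exact: sg_le.
- by apply: lerD; apply: ler_wpM2l; rewrite ?divr_ge0//; [exact: (S1 z xpredT)|exact: S2].
Qed.

End edge_pairs.

(** * Concentration of the quadratic form [vsum] *)

Lemma vsum_combine {R : realFieldType} (X X' Y s t : R) :
  0 <= X -> 0 <= Y -> X' <= X -> s <= 2 * (4 * X' + (Y + X)) ->
  t <= 2 * (4 * X' + (Y + X)) -> 2 / 9 * (s + t) <= 5 * X + Y.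
Proof. by lra. Qed.

Section edge_pairs.
Context {R : realFieldType} {n : nat} (p : R) (w : 'I_n -> R) (beta : R).
Hypothesis hp : 0 < p <= 1.
Hypothesis hb : 0 < beta.
Hypothesis hw : forall i, beta <= w i <= 1.
Hypothesis hn : 12 <= beta * n%:R.

Implicit Types (i j x y z : 'I_n).
Notation cfg := {ffun 'I_n * 'I_n -> bool}.
Notation m := (mdeg p w).
Notation M := (mtot p w).
Notation W := (wsum w).
Notation Ex := (Ex (rq p w)).
Notation L := (avgd (n := n) p).
Notation kap := (kap beta).
Let q01 := rq01 hp hb hw.
Let p0 : 0 < p. Proof. by case/andP: hp. Qed.
Let p0' : 0 <= p. Proof. exact: ltW. Qed.

Notation k := (kap / L).
Notation sg x y := (evar (rq p w) (edge x y)).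

Let k0 : 0 <= k.
Proof. by rewrite ltW// divr_gt0 ?(kap_gt0 hb) ?(L_gt0 hp hb hn). Qed.

Let K0 l : 0 <= k ^+ l. Proof. exact: exprn_ge0. Qed.

Let L0 : 0 <= L. Proof. by rewrite ltW// (L_gt0 hp hb hn). Qed.

Let sg0 x y : 0 <= sg x y. Proof. exact: (sg_ge0 hp hb hw). Qed.

(** One third of the sum over edges of variance times squared derivative of [lintri]; 1/6 since each
    edge is met in both orientations. As [lintri] is homogeneous of degree 3, its mean is the
    variance of [lintri] ([Ex_lintri2]). *)
Definition vsum (a : cfg) : R :=
  6^-1 * \sum_x \sum_(y | y != x) sg x y * ycod p w x y a ^+ 2.

Section pair.
Variables (i j : 'I_n).
Hypothesis ij : i != j.
Notation out z := (z \notin [:: i; j]).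

Let gco y (a : cfg) : R := zadj p w j y a * tcoef p w i y j.
Let ycod' y (a : cfg) : R := \sum_(z | (z \notin [:: i; y]) && (z != j))
  zadj p w i z a * (zadj p w y z a * tcoef p w i y z).

Lemma ycod_upd y a c : out y ->
  ycod p w i y (upd a (edge i j) c) = (c%:R - rmu p w i j) * gco y a + ycod' y a.
Proof.
move=> /outP[yi yj]; rewrite /ycod (bigD1 j)/=; last first.
  by rewrite !inE negb_or (eq_sym j i) ij (eq_sym j y) yj.
congr (_ + _).
  rewrite /gco (zadjC p w j y) (@nodep_zadj _ _ _ _ y j); last first.
    by move=> _; rewrite edge_eq (negbTE yi) (negbTE yj).
  by rewrite {1}/zadj adj_upd// !eqxx/=.
apply: eq_bigr => z /andP[+ zj]; rewrite !inE negb_or => /andP[zi zy].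
rewrite (@nodep_zadj _ _ _ _ i z); last first.
  by move=> _; rewrite edge_eq eqxx/= (negbTE zj) (negbTE ij).
rewrite (@nodep_zadj _ _ _ _ y z)//.
by move=> _; rewrite edge_eq (negbTE yi) (negbTE yj).
Qed.

Lemma cdiff_ycod_sq y a : out y ->
  cdiff (edge i j) (fun a => ycod p w i y a ^+ 2) a =
  gco y a * (2 * ycod' y a) + (1 - 2 * rmu p w i j) * gco y a ^+ 2.
Proof. by move=> yo; rewrite /cdiff !ycod_upd//=; ring. Qed.

(** The effect of the edge ij on the squares [ycod i y ^+ 2]: each contains the path from [i]
    through [j] to [y]. *)
Definition tside (a : cfg) : R :=
  \sum_(y | out y) sg i y * cdiff (edge i j) (fun a => ycod p w i y a ^+ 2) a.

Let Ex_ycod' y : out y -> Ex (fun a => ycod' y a ^+ 2) <= L * p * k ^+ 6.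
Proof.
move=> /outP[yi yj].
rewrite (@eq_Ex _ _ _ _ (fun a => (\sum_(z | (z \notin [:: i; y]) && (z != j))
  centered (rq p w) (edge i z) a * (zadj p w y z a * tcoef p w i y z)) ^+ 2)); last first.
  move=> a; congr (_ ^+ 2); apply: eq_bigr => z /andP[/outP[zi zy] zj].
  by rewrite zadjE// eq_sym.
rewrite Ex_sq_sum_centered; first last.
- move=> z z' /andP[zo _] /andP[zo' _]; apply: nodep_star => //.
  by rewrite eq_sym.
- exact: edge_injl.
apply: (@le_trans _ _ (\sum_(z : 'I_n) p * (p * k ^+ 6))); last first.
  rewrite sumr_const card_ord -mulr_natl /avgd le_eqVlt; apply/orP; left; apply/eqP; move: (k ^+ 6) => kk; ring.
rewrite big_mkcond/=; apply: ler_sum => z _; case: ifP; last first.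
  by move=> _; apply: mulr_ge0 => //; apply: mulr_ge0.
move=> /andP[/outP[zi zy] zj]; apply: ler_pM => //.
- by apply: Ex_ge0 => // a; exact: sqr_ge0.
- exact: (sg_le hp hb hw).
rewrite (@eq_Ex _ _ _ _ (fun a => zadj p w y z a ^+ 2 * tcoef p w i y z ^+ 2)); last first.
  by move=> a; rewrite exprMn.
rewrite ExZr Ex_zadj2 1?eq_sym// [k ^+ 6](_ : _ = (k ^+ 3) ^+ 2); last by rewrite -exprM.
by apply: ler_pM => //; [exact: sqr_ge0|exact: (sg_le hp hb hw)|exact: (tcoef_pow_le hp hb hw hn)].
Qed.

Let dep_ycod' y : out y -> dep (avoid j) (ycod' y).
Proof.
move=> /outP[yi yj]; apply: dep_sum => z /andP[_ zj].
apply: depM; last apply: depM => //.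
  by move=> a b ab; rewrite /zadj /adj; case: eqP => //= _; rewrite ab// avoid_edge ij.
by move=> a b ab; rewrite /zadj /adj; case: eqP => //= _; rewrite ab// avoid_edge yj.
Qed.

(** Split into [A], linear in the centred edges jy with coefficients avoiding [j], hence with
    orthogonal terms, and [B], a sum of squared centred edges, bounded through the second moment of
    their total. *)
Lemma Ex_tside : Ex (fun a => tside a ^+ 2) <=
  2 * (4 * L ^+ 2 * p ^+ 3 * k ^+ 12 + (p * k ^+ 6) ^+ 2 * (L + L ^+ 2)).
Proof.
pose A (a : cfg) := \sum_(y | out y) centered (rq p w) (edge j y) a *
  (2 * sg i y * tcoef p w i y j * ycod' y a).
pose B (a : cfg) := \sum_(y | out y) zadj p w j y a ^+ 2 *
  (sg i y * (1 - 2 * rmu p w i j) * tcoef p w i y j ^+ 2).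
have TE a : tside a = A a + B a.
  rewrite /tside /A /B -big_split/=; apply: eq_bigr => y yo.
  rewrite cdiff_ycod_sq// /gco; have [yi yj] := outP yo.
  by rewrite -zadjE 1?eq_sym//; ring.
have EA : Ex (fun a => A a ^+ 2) <= 4 * L ^+ 2 * p ^+ 3 * k ^+ 12.
  rewrite Ex_sq_sum_centered; first last.
  - move=> y y' yo /outP[yi' yj']; apply: nodepM => //.
    by apply: (dep_nodep (dep_ycod' yo)); rewrite avoid_edge eqxx.
  - exact: edge_injl.
  apply: (@le_trans _ _ (\sum_(y : 'I_n) p * ((2 * p * k ^+ 3) ^+ 2 * (L * p * k ^+ 6)))); last first.
    rewrite sumr_const card_ord -mulr_natl /avgd le_eqVlt; apply/orP; left; apply/eqP.
    by move: k => kk; ring.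
  rewrite big_mkcond/=; apply: ler_sum => y _.
  have R0 : 0 <= p * ((2 * p * k ^+ 3) ^+ 2 * (L * p * k ^+ 6)).
    apply: mulr_ge0 => //; apply: mulr_ge0; first exact: sqr_ge0.
    by apply: mulr_ge0 => //; apply: mulr_ge0.
  case: ifP => // yo; apply: ler_pM => //.
  - by apply: Ex_ge0 => // a; exact: sqr_ge0.
  - exact: (sg_le hp hb hw).
  rewrite (@eq_Ex _ _ _ _ (fun a => (2 * sg i y * tcoef p w i y j) ^+ 2 * ycod' y a ^+ 2)); last first.
    by move=> a; rewrite exprMn.
  have /andP[t0 t1] := tcoef_bound hp hb hw hn i y j.
  rewrite ExZ; apply: ler_pM; rewrite ?sqr_ge0//.
  - by apply: Ex_ge0 => // a; exact: sqr_ge0.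
  - apply: lerXn2r; rewrite ?nnegrE.
    + by apply: mulr_ge0 => //; apply: mulr_ge0.
    + by apply: mulr_ge0 => //; apply: mulr_ge0.
    + apply: ler_pM => //; first by apply: mulr_ge0.
      by apply: ler_wpM2l => //; exact: (sg_le hp hb hw).
  - exact: Ex_ycod'.
have EZ : Ex (fun a => (\sum_(y | out y) zadj p w j y a ^+ 2) ^+ 2) <= L + L ^+ 2.
  rewrite (@eq_Ex _ _ _ _ (fun a => \sum_(y | out y) \sum_(y' | out y')
      zadj p w j y a ^+ 2 * zadj p w j y' a ^+ 2)); last first.
    by move=> a; rewrite expr2 mulr_suml; apply: eq_bigr => y _; rewrite mulr_sumr.
  rewrite Ex_sum; apply: (@le_trans _ _ (\sum_(y : 'I_n) (\sum_(y' : 'I_n) p ^+ 2 + p))); last first.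
    rewrite !sumr_const !card_ord -[(_ + _) *+ n]mulr_natr -[p ^+ 2 *+ n]mulr_natr /avgd.
    by rewrite le_eqVlt; apply/orP; left; apply/eqP; ring.
  rewrite [leLHS]big_mkcond/=; apply: ler_sum => y _.
  have S0 : 0 <= \sum_(y' : 'I_n) p ^+ 2 + p.
    by apply: addr_ge0 => //; apply: sumr_ge0 => *; exact: sqr_ge0.
  case: ifP => // /outP[yi yj]; rewrite Ex_sum [leLHS]big_mkcond/= (bigD1 y)//= addrC.
  apply: lerD; last first.
    case: ifP => // _; apply: (@le_trans _ _ (Ex (fun a => zadj p w j y a ^+ 2))).
      by apply: le_Ex => // a; rewrite ler_piMr ?sqr_ge0 ?(zadj_sqr_le1 hp hb hw).
    by rewrite Ex_zadj2 1?eq_sym//; exact: (sg_le hp hb hw).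
  rewrite [leRHS](bigD1 y)//=; apply: (@le_trans _ _ (\sum_(y' | y' != y) p ^+ 2)).
    apply: ler_sum => y' y'y; case: ifP => [/outP[yi' yj']|_]; last exact: sqr_ge0.
    rewrite (@eq_Ex _ _ _ _ (fun a => centered (rq p w) (edge j y) a ^+ 2 * zadj p w j y' a ^+ 2)); last first.
      by move=> a; rewrite -zadjE 1?eq_sym.
    rewrite Ex_centered_sq; last first.
      have h : nodep (edge j y) (zadj p w j y').
        apply: nodep_zadj => _; rewrite edge_eq eqxx/= (negbTE y'y)/=.
        by rewrite (negbTE yj') andbF.
      by move=> a c; rewrite h.
    by rewrite Ex_zadj2 1?eq_sym// expr2; apply: ler_pM => //; exact: (sg_le hp hb hw).
  by rewrite lerDr sqr_ge0.
have EB : Ex (fun a => B a ^+ 2) <= (p * k ^+ 6) ^+ 2 * (L + L ^+ 2).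
  apply: (@le_trans _ _ (Ex (fun a => (p * k ^+ 6) ^+ 2 * (\sum_(y | out y) zadj p w j y a ^+ 2) ^+ 2))); last first.
    by rewrite ExZ; apply: ler_wpM2l => //; exact: sqr_ge0.
  apply: le_Ex => // a; rewrite -exprMn -[leLHS]real_normK ?num_real//.
  apply: lerXn2r; rewrite ?nnegrE ?normr_ge0//.
    by apply: mulr_ge0; [apply: mulr_ge0|apply: sumr_ge0 => *; exact: sqr_ge0].
  rewrite /B (le_trans (ler_norm_sum _ _ _))// mulr_sumr; apply: ler_sum => y yo.
  rewrite normrM ger0_norm ?sqr_ge0// mulrC; apply: ler_wpM2r; first exact: sqr_ge0.
  have m1 : `|1 - 2 * rmu p w i j| <= 1.
    have h0 := rmu_ge0 hp hb hw i j; have h1 := rmu_le hp hb hw i j.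
    have h2 : rmu p w i j <= 1 by case/andP: hp => _; exact: le_trans.
    by rewrite ler_norml; apply/andP; split; move: (rmu _ _ _ _) h0 h2 => u h0 h2; lra.
  rewrite normrM normrM (ger0_norm (sg0 _ _)) (ger0_norm (sqr_ge0 _)).
  have -> : p * k ^+ 6 = p * 1 * (k ^+ 3) ^+ 2 by rewrite mulr1 -exprM.
  apply: ler_pM; rewrite ?sqr_ge0//.
  - by apply: mulr_ge0.
  - by apply: ler_pM => //; exact: (sg_le hp hb hw).
  - exact: (tcoef_pow_le hp hb hw hn).
apply: (@le_trans _ _ (Ex (fun a => 2 * (A a ^+ 2 + B a ^+ 2)))).
  by apply: le_Ex => // a; rewrite TE; exact: sqr_sum2_le.
by rewrite ExZ ExD ler_wpM2l// lerD.
Qed.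

End pair.

Lemma ycod_out_nodep (i j x y : 'I_n) : i != j -> x \notin [:: i; j] -> y \notin [:: i; j] ->
  nodep (edge i j) (ycod p w x y).
Proof.
move=> ij /outP[xi xj] /outP[yi yj]; apply: nodep_sum => z _.
apply: nodepM; last apply: nodepM => //; apply: nodep_zadj => _; rewrite edge_eq.
  by rewrite (negbTE xi) (negbTE xj).
by rewrite (negbTE yi) (negbTE yj).
Qed.

(** Pairs disjoint from [i], [j] and the pair ij itself do not react to the edge ij; the others
    occur in both orders, which turns 1/6 into 1/3. *)
Lemma cdiff_vsum (i j : 'I_n) a : i != j ->
  cdiff (edge i j) vsum a = 3^-1 * (tside i j a + tside j i a).
Proof.
move=> ij; have ji : j != i by rewrite eq_sym.
pose t x y := if x == y then 0 else sg x y * cdiff (edge i j) (fun a => ycod p w x y a ^+ 2) a.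
have tC x y : t x y = t y x.
  rewrite /t eq_sym edgeC; case: eqP => // _; congr (_ * _).
  by rewrite /cdiff !(ycodC _ _ x y).
have -> : cdiff (edge i j) vsum a = 6^-1 * \sum_x \sum_y t x y.
  rewrite /vsum cdiffZ; congr (_ * _); rewrite cdiff_sum; apply: eq_bigr => x _.
  rewrite cdiff_sum big_mkcond/=; apply: eq_bigr => y _; rewrite /t eq_sym.
  by case: eqP => //= _; rewrite cdiffZ.
have t0 x : t x x = 0 by rewrite /t eqxx.
have tij : t i j = 0.
  rewrite /t (negbTE ij) cdiff_nodep ?mulr0// => b c.
  by rewrite (nodep_ycod p w ij).
have tout x y : x \notin [:: i; j] -> y \notin [:: i; j] -> t x y = 0.
  move=> xo yo; rewrite /t; case: eqP => // _; rewrite cdiff_nodep ?mulr0// => b c.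
  by rewrite (ycod_out_nodep ij xo yo).
have inner x : \sum_y t x y = t x i + t x j + \sum_(y | y \notin [:: i; j]) t x y.
  exact: sum_split2.
rewrite (sum_split2 _ ij) !inner (eq_bigr _ (fun y _ => inner y)) !big_split/=.
rewrite [X in _ + (_ + X)]big1 ?addr0; last first.
  by move=> x xo; apply: big1 => y yo; exact: tout.
have Ti : \sum_(y | y \notin [:: i; j]) t i y = tside i j a.
  by apply: eq_bigr => y /outP[yi yj]; rewrite /t eq_sym (negbTE yi).
have Tj : \sum_(y | y \notin [:: i; j]) t j y = tside j i a.
  rewrite /tside; apply: eq_big => [y|y /outP[yi yj]]; first by rewrite !inE orbC.
  by rewrite /t eq_sym (negbTE yj) (edgeC j i).
have Ti' : \sum_(x | x \notin [:: i; j]) t x i = tside i j a.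
  by rewrite -Ti; apply: eq_bigr => x _; rewrite tC.
have Tj' : \sum_(x | x \notin [:: i; j]) t x j = tside j i a.
  by rewrite -Tj; apply: eq_bigr => x _; rewrite tC.
rewrite Ti Tj Ti' Tj' !t0 (tC j i) tij; by field.
Qed.

Lemma dep_upper_vsum : dep upper vsum.
Proof.
apply: dep_upper => a b ab; rewrite /vsum; congr (_ * _).
do 2 (apply: eq_bigr => ? _); congr (_ * _ ^+ 2).
by apply: eq_bigr => z _; rewrite /zadj !ab.
Qed.

Lemma var_vsum : Ex (fun a => (vsum a - Ex vsum) ^+ 2) <=
  k ^+ 12 * L ^+ 2 * (5 * L ^+ 2 + L) * p.
Proof.
have /andP[_ p1] := hp.
have H (i j : 'I_n) : i != j -> Ex (fun a => cdiff (edge i j) vsum a ^+ 2) <=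
   k ^+ 12 * p ^+ 2 * (5 * L ^+ 2 + L).
  move=> ij; have ji : j != i by rewrite eq_sym.
  apply: (@le_trans _ _ (2 / 9 * (Ex (fun a => tside i j a ^+ 2) + Ex (fun a => tside j i a ^+ 2)))).
    rewrite -ExD -ExZ; apply: le_Ex => // a; rewrite cdiff_vsum// exprMn.
    rewrite [2 / 9](_ : _ = 3^-1 ^+ 2 * 2); last by field.
    by rewrite -[leRHS]mulrA; apply: ler_wpM2l; [exact: sqr_ge0|exact: sqr_sum2_le].
  have H1 := Ex_tside ij; have H2 := Ex_tside ji.
  have p3 : L ^+ 2 * p ^+ 3 * k ^+ 12 <= L ^+ 2 * p ^+ 2 * k ^+ 12.
    apply: ler_wpM2r => //; apply: ler_wpM2l; first exact: sqr_ge0.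
    by rewrite exprSr ler_piMr// sqr_ge0.
  have E : (p * k ^+ 6) ^+ 2 * (L + L ^+ 2) = p ^+ 2 * k ^+ 12 * L + L ^+ 2 * p ^+ 2 * k ^+ 12.
    by rewrite exprMn -exprM; move: (k ^+ _) => kk; ring.
  rewrite E in H1 H2; rewrite -2!(mulrA 4) in H1 H2.
  have E' : k ^+ 12 * p ^+ 2 * (5 * L ^+ 2 + L) = 5 * (L ^+ 2 * p ^+ 2 * k ^+ 12) + p ^+ 2 * k ^+ 12 * L.
    by move: (k ^+ 12) => kk; ring.
  rewrite E'.
  have X0 : 0 <= L ^+ 2 * p ^+ 2 * k ^+ 12.
    by apply: mulr_ge0 => //; apply: mulr_ge0; exact: sqr_ge0.
  have Y0 : 0 <= p ^+ 2 * k ^+ 12 * L.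
    by apply: mulr_ge0 => //; apply: mulr_ge0 => //; exact: sqr_ge0.
  exact: vsum_combine X0 Y0 p3 H1 H2.
have B0 : 0 <= k ^+ 12 * p ^+ 2 * (5 * L ^+ 2 + L).
  apply: mulr_ge0; first by apply: mulr_ge0 => //; exact: sqr_ge0.
  by apply: addr_ge0 => //; apply: mulr_ge0 => //; exact: sqr_ge0.
apply: (le_trans (efron_stein_graph hp hb hw dep_upper_vsum B0 H)).
by rewrite le_eqVlt; apply/orP; left; apply/eqP; move: (k ^+ 12) => kk; rewrite /avgd; ring.
Qed.

End edge_pairs.

(** * Stein's method for the leading term *)

(** A substitute for Cauchy-Schwarz that needs no square roots: [d] stays free and is fixed only
    when the limit is taken. *)
Lemma norm_le_amgm {R : realFieldType} (u d : R) : 0 < d ->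
  `|u| <= d / 2 + u ^+ 2 / (2 * d).
Proof.
move=> d0; rewrite -[u ^+ 2]real_normK ?num_real//; set x := `|u|.
rewrite -subr_ge0 (_ : _ - _ = (x - d) ^+ 2 / (2 * d)); last by field; rewrite gt_eqF.
by rewrite divr_ge0 ?sqr_ge0// mulr_ge0// ltW.
Qed.

Lemma cube_le_amgm {R : realFieldType} (u d : R) : 0 < d ->
  `|u| ^+ 3 <= d / 2 * u ^+ 2 + u ^+ 4 / (2 * d).
Proof.
move=> d0; have -> : u ^+ 4 = `|u| ^+ 4 by rewrite -normrX ger0_norm// (exprM u 2 2) sqr_ge0.
rewrite -[u ^+ 2]real_normK ?num_real//; set x := `|u|.
rewrite -subr_ge0 (_ : _ - _ = x ^+ 2 * ((x - d) ^+ 2 / (2 * d))); last by field; rewrite gt_eqF.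
by rewrite mulr_ge0 ?sqr_ge0// divr_ge0 ?sqr_ge0// mulr_ge0// ltW.
Qed.

Section edge_pairs.
Context {R : realFieldType} {n : nat} (p : R) (w : 'I_n -> R) (beta : R).
Hypothesis hp : 0 < p <= 1.
Hypothesis hb : 0 < beta.
Hypothesis hw : forall i, beta <= w i <= 1.
Hypothesis hn : 12 <= beta * n%:R.

Implicit Types (i j x y z : 'I_n).
Notation cfg := {ffun 'I_n * 'I_n -> bool}.
Notation m := (mdeg p w).
Notation M := (mtot p w).
Notation W := (wsum w).
Notation Ex := (Ex (rq p w)).
Notation L := (avgd (n := n) p).
Notation kap := (kap beta).
Let q01 := rq01 hp hb hw.
Let p0 : 0 < p. Proof. by case/andP: hp. Qed.
Let p0' : 0 <= p. Proof. exact: ltW. Qed.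

Notation k := (kap / L).
Notation sg x y := (evar (rq p w) (edge x y)).
Notation Y := (ycod p w).
Notation V0 := (vsum p w).
Notation T := (lintri p w).

Let k0 : 0 <= k.
Proof. by rewrite ltW// divr_gt0 ?(kap_gt0 hb) ?(L_gt0 hp hb hn). Qed.

Let K0 l : 0 <= k ^+ l. Proof. exact: exprn_ge0. Qed.

Let L0 : 0 <= L. Proof. by rewrite ltW// (L_gt0 hp hb hn). Qed.

Let sg0 x y : 0 <= sg x y. Proof. exact: (sg_ge0 hp hb hw). Qed.

Lemma norm_Ex_le (F : cfg -> R) : `|Ex F| <= Ex (fun a => `|F a|).
Proof.
rewrite /Ex (le_trans (ler_norm_sum _ _ _))//; apply: ler_sum => a _.
by rewrite normrM ger0_norm// weight_ge0.
Qed.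

(** Integration by parts in each edge xy, whose cofactor [Y x y] is free of that edge. *)
Lemma Ex_lintri_mul (g : cfg -> R) :
  Ex (fun a => T a * g a) =
  6^-1 * \sum_x \sum_(y | y != x) sg x y * Ex (fun a => Y x y a * cdiff (edge x y) g a).
Proof.
rewrite (@eq_Ex _ _ _ _ (fun a => 6^-1 * \sum_x \sum_(y | y != x)
   zadj p w x y a * (Y x y a * g a))); last first.
  move=> a; rewrite lintri_ycod -mulrA; congr (_ * _).
  rewrite mulr_suml; apply: eq_bigr => x _; rewrite mulr_suml; apply: eq_bigr => y _.
  by rewrite mulrA.
rewrite ExZ Ex_sum; congr (_ * _); apply: eq_bigr => x _; rewrite Ex_sum.
apply: eq_bigr => y yx; have xy : x != y by rewrite eq_sym.
rewrite (@eq_Ex _ _ _ _ (fun a => centered (rq p w) (edge x y) a * (Y x y a * g a))); last first.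
  by move=> a; rewrite zadjE.
rewrite Ex_centered; congr (_ * _); apply: eq_Ex => a.
by rewrite cdiffMl//; exact: nodep_ycod.
Qed.

Lemma Ex_vsumE : Ex V0 =
  6^-1 * \sum_x \sum_(y | y != x) sg x y * Ex (fun a => Y x y a ^+ 2).
Proof.
rewrite /vsum ExZ Ex_sum; congr (_ * _); apply: eq_bigr => x _; rewrite Ex_sum.
by apply: eq_bigr => y _; rewrite ExZ.
Qed.

Lemma Ex_lintri2 : Ex (fun a => T a ^+ 2) = Ex V0.
Proof.
rewrite Ex_vsumE (@eq_Ex _ _ _ _ (fun a => T a * T a)); last by move=> a; rewrite expr2.
rewrite Ex_lintri_mul; congr (_ * _); apply: eq_bigr => x _; apply: eq_bigr => y yx.
congr (_ * _); apply: eq_Ex => a; rewrite cdiff_lintri_ycod ?expr2//.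
by rewrite eq_sym.
Qed.

Lemma Ex_lintri : Ex T = 0.
Proof.
rewrite (@eq_Ex _ _ _ _ (fun a => T a * 1)); last by move=> a; rewrite mulr1.
rewrite (Ex_lintri_mul (fun=> 1)) big1 ?mulr0// => x _; rewrite big1// => y _.
rewrite (@eq_Ex _ _ _ _ (fun=> 0)) ?Ex_cst ?mulr0// => a.
by rewrite /cdiff subrr mulr0.
Qed.

Section stein.
Variables (s : R) (f df : R -> R) (C K : R).
Hypothesis s0 : 0 <= s.
Hypothesis C0 : 0 <= C.
Hypothesis KK0 : 0 <= K.
Hypothesis dfC : forall x : R, `|df x| <= C.
Hypothesis taylor : forall x y : R, `|f y - f x - (y - x) * df x| <= K * (y - x) ^+ 2.

Let cdiff_taylor (x y : 'I_n) a : x != y ->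
  `|cdiff (edge x y) (fun a => f (s * T a)) a - df (s * T a) * (s * Y x y a)|
  <= K * (s * Y x y a) ^+ 2.
Proof.
move=> xy; rewrite -(cdiff_lintri_ycod p w a xy) /cdiff mulrBr.
set u := s * T (upd a _ true); set v := s * T (upd a _ false).
(* The current configuration is one of the two endpoints, so the expansion around it is a one-step
   Taylor expansion in either case. *)
have [aE|aE] : upd a (edge x y) true = a \/ upd a (edge x y) false = a.
  by case: (boolP (a (edge x y))) => [|/negbTE] e; [left|right]; rewrite -[in LHS]e upd_id.
- have -> : s * T a = u by rewrite /u aE.
  rewrite (_ : _ - _ = - (f v - f u - (v - u) * df u)); last by ring.
  by rewrite normrN (_ : (u - v) ^+ 2 = (v - u) ^+ 2)//; ring.
- have -> : s * T a = v by rewrite /v aE.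
  by rewrite [df v * _]mulrC.
Qed.

(** By [Ex_lintri_mul] the second term is an average of derivatives of [f (s * T)]. Their linear
    parts add up to [df (s * T) * s ^+ 2 * V0], and comparison with 1 costs the distance of the mean
    from 1 plus the spread given by [var_vsum]. The quadratic Taylor errors give third absolute
    moments of [ycod], bounded by second and fourth ones. *)
Lemma stein_bound (d : R) : 0 < d ->
  `|Ex (fun a => df (s * T a) - (s * T a) * f (s * T a))| <=
  C * (`|1 - s ^+ 2 * Ex V0| + d / 2 + s ^+ 4 * (k ^+ 12 * L ^+ 2 * (5 * L ^+ 2 + L) * p) / (2 * d))
  + K * (d / 2 * (s ^+ 2 * Ex V0) + s ^+ 4 * (k ^+ 12 * L ^+ 2 * (L ^+ 2 * p + L)) / d).
Proof.
move=> d0.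
pose rem x y a := Y x y a * (cdiff (edge x y) (fun a => f (s * T a)) a - df (s * T a) * (s * Y x y a)).
have E1 : Ex (fun a => df (s * T a) - (s * T a) * f (s * T a)) =
    Ex (fun a => df (s * T a) * (1 - s ^+ 2 * V0 a))
    - s * (6^-1 * \sum_x \sum_(y | y != x) sg x y * Ex (rem x y)).
  rewrite ExB (@eq_Ex _ _ _ (fun a => (s * T a) * f (s * T a)) (fun a => s * (T a * f (s * T a)))); last first.
    by move=> a; rewrite mulrA.
  rewrite ExZ Ex_lintri_mul.
  have -> : Ex (fun a => df (s * T a) * (1 - s ^+ 2 * V0 a)) =
     Ex (fun a => df (s * T a)) - s * (6^-1 * \sum_x \sum_(y | y != x) sg x y * Ex (fun a => Y x y a * (df (s * T a) * (s * Y x y a)))).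
    rewrite (@eq_Ex _ _ _ (fun a => df (s * T a) * (1 - s ^+ 2 * V0 a))
      (fun a => df (s * T a) - s * (6^-1 * \sum_x \sum_(y | y != x) sg x y * (Y x y a * (df (s * T a) * (s * Y x y a)))))).
      rewrite ExB ExZ ExZ Ex_sum; congr (_ - _ * (_ * _)); apply: eq_bigr => x _.
      by rewrite Ex_sum; apply: eq_bigr => y _; rewrite ExZ.
    move=> a; rewrite mulrBr mulr1; congr (_ - _).
    rewrite /vsum !mulr_sumr; apply: eq_bigr => x _; rewrite !mulr_sumr; apply: eq_bigr => y _.
    by ring.
  rewrite -addrA -opprD -mulrDr -mulrDr -big_split/=; congr (_ - _ * (_ * _)).
  apply: eq_bigr => x _; rewrite -big_split/=; apply: eq_bigr => y _.
  rewrite -mulrDr -ExD; congr (_ * _); apply: eq_Ex => a.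
  by rewrite /rem -mulrDr addrC subrK.
have B1 : `|Ex (fun a => df (s * T a) * (1 - s ^+ 2 * V0 a))| <=
   C * (`|1 - s ^+ 2 * Ex V0| + d / 2 + s ^+ 4 * (k ^+ 12 * L ^+ 2 * (5 * L ^+ 2 + L) * p) / (2 * d)).
  apply: (le_trans (norm_Ex_le _)).
  apply: (@le_trans _ _ (Ex (fun a => C * ((`|1 - s ^+ 2 * Ex V0| + d / 2) + s ^+ 4 / (2 * d) * (V0 a - Ex V0) ^+ 2)))).
    apply: le_Ex => // a; rewrite normrM; apply: ler_pM => //.
    rewrite (_ : 1 - _ = (1 - s ^+ 2 * Ex V0) + (- (s ^+ 2 * (V0 a - Ex V0)))); last by ring.
    rewrite (le_trans (ler_normD _ _))// -addrA lerD2l normrN.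
    apply: (le_trans (norm_le_amgm _ d0)); rewrite lerD2l le_eqVlt; apply/orP; left; apply/eqP.
    by rewrite exprMn -exprM; field; rewrite gt_eqF.
  rewrite ExZ ExD Ex_cst ExZ; apply: ler_wpM2l => //; rewrite lerD2l.
  rewrite mulrAC; apply: ler_wpM2r; first by rewrite invr_ge0 mulr_ge0// ltW.
  by apply: ler_wpM2l; [exact: exprn_ge0|exact: var_vsum].
have B2 : `|s * (6^-1 * \sum_x \sum_(y | y != x) sg x y * Ex (rem x y))| <=
   K * (d / 2 * (s ^+ 2 * Ex V0) + s ^+ 4 * (k ^+ 12 * L ^+ 2 * (L ^+ 2 * p + L)) / d).
  have s6 : 0 <= s * 6^-1 by rewrite mulr_ge0// invr_ge0.
  rewrite [s * (_ * _)]mulrA normrM (ger0_norm s6).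
  have R1 (x y : 'I_n) : y != x -> s * `|Ex (rem x y)| <=
      K * (d / 2 * (s ^+ 2 * Ex (fun a => Y x y a ^+ 2)) + s ^+ 4 / (2 * d) * Ex (fun a => Y x y a ^+ 4)).
    move=> yx; have xy : x != y by rewrite eq_sym.
    apply: (@le_trans _ _ (s * Ex (fun a => `|rem x y a|))).
      by apply: ler_wpM2l => //; exact: norm_Ex_le.
    rewrite -!ExZ -ExD -ExZ; apply: le_Ex => // a.
    rewrite /rem normrM [s * (_ * _)]mulrA (_ : s * `|Y x y a| = `|s * Y x y a|); last by rewrite normrM (ger0_norm s0).
    apply: (@le_trans _ _ (`|s * Y x y a| * (K * (s * Y x y a) ^+ 2))).
      by apply: ler_wpM2l => //; exact: cdiff_taylor.
    rewrite mulrCA; apply: ler_wpM2l => //.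
    rewrite -[X in _ * X]real_normK ?num_real// -exprS.
    apply: (le_trans (cube_le_amgm _ d0)); rewrite le_eqVlt; apply/orP; left; apply/eqP.
    by rewrite !exprMn; field; rewrite gt_eqF.
  apply: (@le_trans _ _ (6^-1 * \sum_x \sum_(y | y != x) sg x y *
     (K * (d / 2 * (s ^+ 2 * Ex (fun a => Y x y a ^+ 2)) + s ^+ 4 / (2 * d) * Ex (fun a => Y x y a ^+ 4))))).
    rewrite [s * _]mulrC -mulrA; apply: ler_wpM2l; first by rewrite invr_ge0.
    apply: (@le_trans _ _ (s * (\sum_x \sum_(y | y != x) sg x y * `|Ex (rem x y)|))).
      apply: ler_wpM2l => //; apply: (le_trans (ler_norm_sum _ _ _)); apply: ler_sum => x _.
      apply: (le_trans (ler_norm_sum _ _ _)); apply: ler_sum => y _.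
      by rewrite normrM (ger0_norm (sg0 _ _)).
    rewrite mulr_sumr; apply: ler_sum => x _; rewrite mulr_sumr; apply: ler_sum => y yx.
    by rewrite mulrCA; apply: ler_wpM2l => //; exact: R1.
  have Q : 6^-1 * \sum_x \sum_(y | y != x) sg x y * Ex (fun a => Y x y a ^+ 4) <=
      k ^+ 12 * L ^+ 2 * (L ^+ 2 * p + L).
    apply: (@le_trans _ _ (6^-1 * \sum_(x : 'I_n) \sum_(y : 'I_n)
       p * (k ^+ 12 * (9 / 2 * (L * p) ^+ 2 + 5 / 2 * (L * p))))).
      have W0 : 0 <= k ^+ 12 * (9 / 2 * (L * p) ^+ 2 + 5 / 2 * (L * p)).
        apply: mulr_ge0 => //; apply: addr_ge0; apply: mulr_ge0; rewrite ?divr_ge0 ?sqr_ge0//.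
        exact: mulr_ge0.
      apply: ler_wpM2l; first by rewrite invr_ge0.
      apply: ler_sum => x _; rewrite big_mkcond/=; apply: ler_sum => y _.
      case: ifP => [yx|_]; last exact: mulr_ge0.
      apply: ler_pM => //.
      - by apply: Ex_ge0 => // a; rewrite (exprM _ 2 2) sqr_ge0.
      - exact: (sg_le hp hb hw).
      - by apply: (Ex_ycod4 hp hb hw hn); rewrite eq_sym yx.
    rewrite !sumr_const !card_ord -[(_ * _) *+ n]mulr_natr -[(_ * _ * _) *+ n]mulr_natr.
    rewrite [leLHS](_ : _ = k ^+ 12 * L ^+ 2 * (3 / 4 * (L ^+ 2 * p) + 5 / 12 * L)); last first.
      by move: (k ^+ 12) => kk; rewrite /avgd; field.
    apply: ler_wpM2l; first by apply: mulr_ge0 => //; exact: sqr_ge0.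
    have u0 : 0 <= L ^+ 2 * p by apply: mulr_ge0 => //; exact: sqr_ge0.
    apply: lerD; first by rewrite ler_piMl// ler_pdivrMr// mul1r ler_nat.
    by rewrite ler_piMl// ler_pdivrMr// mul1r ler_nat.
  rewrite [leLHS](_ : _ = K * (d / 2 * (s ^+ 2 * Ex V0) + s ^+ 4 / (2 * d) *
      (6^-1 * \sum_x \sum_(y | y != x) sg x y * Ex (fun a => Y x y a ^+ 4)))); last first.
    rewrite Ex_vsumE !mulrDr !mulr_sumr -big_split/=; apply: eq_bigr => x _.
    rewrite !mulr_sumr -big_split/=; apply: eq_bigr => y _.
    by field; rewrite gt_eqF.
  apply: ler_wpM2l => //; rewrite lerD2l [leRHS]mulrAC.
  have sd : 0 <= s ^+ 4 / d by apply: divr_ge0; [exact: exprn_ge0|exact: ltW].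
  apply: le_trans (ler_wpM2l sd Q); apply: ler_wpM2r.
    apply: mulr_ge0; first by rewrite invr_ge0.
    apply: sumr_ge0 => x _; apply: sumr_ge0 => y _; apply: mulr_ge0 => //.
    by apply: Ex_ge0 => // a; rewrite (exprM _ 2 2) sqr_ge0.
  apply: ler_wpM2l; first exact: exprn_ge0.
  by rewrite lef_pV2 ?posrE ?mulr_gt0// ler_peMl ?(ltW d0)// ler1n.
rewrite E1 (le_trans (ler_normB _ _))//; exact: lerD.
Qed.

End stein.
End edge_pairs.

(** * Counting triples; the variance of the leading term *)

Section ordered_triples.
Context {V : realFieldType} {n : nat}.

(** Off the diagonals exactly one of the six orderings of the indices holds, and by symmetry each
    contributes the same. *)
Lemma triple_sum_ord (t : 'I_n -> 'I_n -> 'I_n -> V) :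
  (forall x y z, t x y z = t y x z) -> (forall x y z, t x y z = t x z y) ->
  (forall x z, t x x z = 0) ->
  \sum_x \sum_y \sum_z t x y z =
  6 * \sum_(i < n) \sum_(j < n | (i < j)%N) \sum_(k < n | (j < k)%N) t i j k.
Proof.
move=> tC1 tC2 t0.
have t0' x z : t x z x = 0 by rewrite tC2 t0.
have t0'' x z : t z x x = 0 by rewrite tC1 t0'.
pose o x y z : V := ((x < y)%N && (y < z)%N)%:R.
pose S := \sum_(x : 'I_n) \sum_(y : 'I_n) \sum_(z : 'I_n) t x y z * o x y z.
have -> : \sum_(i < n) \sum_(j < n | (i < j)%N) \sum_(k < n | (j < k)%N) t i j k = S.
  apply: eq_bigr => i _; rewrite big_mkcond; apply: eq_bigr => j _.
  rewrite big_mkcond /o; case: ifP => _ /=.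
    by apply: eq_bigr => k _; case: ifP => _; rewrite ?mulr1 ?mulr0.
  by rewrite big1// => k _; rewrite mulr0.
have E x y z : t x y z = t x y z * o x y z + t x y z * o x z y + t x y z * o y x z
    + t x y z * o y z x + t x y z * o z x y + t x y z * o z y x.
  have [<-|xy] := eqVneq x y; first by rewrite t0 !mul0r !addr0.
  have [<-|xz] := eqVneq x z; first by rewrite t0' !mul0r !addr0.
  have [<-|yz] := eqVneq y z; first by rewrite t0'' !mul0r !addr0.
  rewrite -!mulrDr -[LHS]mulr1; congr (_ * _).
  move: xy xz yz; rewrite -!(inj_eq val_inj)/= /o.
  case: (ltngtP x y) => //= xy _; case: (ltngtP x z) => //= xz _; case: (ltngtP y z) => //= yz _;
    rewrite ?addr0 ?add0r//; lia.
have S2 : \sum_(x : 'I_n) \sum_(y : 'I_n) \sum_(z : 'I_n) t x y z * o x z y = S.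
  apply: eq_bigr => x _; rewrite exchange_big; apply: eq_bigr => y _.
  by apply: eq_bigr => z _; rewrite tC2.
have S3 : \sum_(x : 'I_n) \sum_(y : 'I_n) \sum_(z : 'I_n) t x y z * o y x z = S.
  rewrite exchange_big; apply: eq_bigr => x _; apply: eq_bigr => y _.
  by apply: eq_bigr => z _; rewrite tC1.
have S4 : \sum_(x : 'I_n) \sum_(y : 'I_n) \sum_(z : 'I_n) t x y z * o y z x = S.
  rewrite exchange_big -S2; apply: eq_bigr => x _; apply: eq_bigr => y _.
  by apply: eq_bigr => z _; rewrite tC1.
have S5 : \sum_(x : 'I_n) \sum_(y : 'I_n) \sum_(z : 'I_n) t x y z * o z x y = S.
  rewrite -S3; apply: eq_bigr => x _; rewrite exchange_big; apply: eq_bigr => y _.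
  by apply: eq_bigr => z _; rewrite tC2.
have S6 : \sum_(x : 'I_n) \sum_(y : 'I_n) \sum_(z : 'I_n) t x y z * o z y x = S.
  rewrite -S4; apply: eq_bigr => x _; rewrite exchange_big; apply: eq_bigr => y _.
  by apply: eq_bigr => z _; rewrite tC2.
under eq_bigr => x _ do under eq_bigr => y _ do under eq_bigr => z _ do rewrite E.
under eq_bigr => x _ do under eq_bigr => y _ do rewrite !big_split/=.
under eq_bigr => x _ do rewrite !big_split/=.
rewrite !big_split/= S2 S3 S4 S5 S6 -/S; ring.
Qed.

Definition ntri : V := n%:R * (n%:R - 1) * (n%:R - 2).

Lemma count_ordered : \sum_(x : 'I_n) \sum_(y | y != x) \sum_(z | z \notin [:: x; y]) (1 : V) = ntri.
Proof.
have c1 (x y : 'I_n) : y != x -> \sum_(z | z \notin [:: x; y]) (1 : V) = n%:R - 2.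
  move=> yx; have xy : x != y by rewrite eq_sym.
  have := sum_split2 (fun=> (1 : V)) xy.
  by rewrite sumr_const card_ord => ->; ring.
have c2 (x : 'I_n) : \sum_(y | y != x) \sum_(z | z \notin [:: x; y]) (1 : V) = (n%:R - 1) * (n%:R - 2).
  rewrite (eq_bigr _ (fun y yx => c1 x y yx)).
  have : \sum_(y : 'I_n) (1 : V) = 1 + \sum_(y | y != x) 1 by rewrite (bigD1 x).
  rewrite sumr_const card_ord => H.
  rewrite (eq_bigr (fun=> 1 * (n%:R - 2))); last by move=> y _; rewrite mul1r.
  by rewrite -mulr_suml H; congr (_ * _); ring.
rewrite (eq_bigr _ (fun x _ => c2 x)) sumr_const card_ord -[LHS]mulr_natl /ntri.
by rewrite mulrA.
Qed.

End ordered_triples.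

Section edge_pairs.
Context {R : realFieldType} {n : nat} (p : R) (w : 'I_n -> R) (beta : R).
Hypothesis hp : 0 < p <= 1.
Hypothesis hb : 0 < beta.
Hypothesis hw : forall i, beta <= w i <= 1.
Hypothesis hn : 12 <= beta * n%:R.

Implicit Types (i j x y z : 'I_n).
Notation cfg := {ffun 'I_n * 'I_n -> bool}.
Notation m := (mdeg p w).
Notation M := (mtot p w).
Notation W := (wsum w).
Notation Ex := (Ex (rq p w)).
Notation L := (avgd (n := n) p).
Notation kap := (kap beta).
Let q01 := rq01 hp hb hw.
Let p0 : 0 < p. Proof. by case/andP: hp. Qed.
Let p0' : 0 <= p. Proof. exact: ltW. Qed.

Notation k := (kap / L).
Notation sg x y := (evar (rq p w) (edge x y)).
Notation V0 := (vsum p w).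
Notation T := (lintri p w).

(** Each vertex weight occurs squared in the edge variances and in the normalisation, so it cancels.
    This is why the variance depends on the weights through [W] only, up to the factors
    [1 - rmu]. *)
Lemma sg_prod (x y z : 'I_n) : y != x -> z != x -> z != y ->
  sg x y * (sg x z * (sg y z * tcoef p w x y z ^+ 2)) =
  (1 - rmu p w x y) * (1 - rmu p w x z) * (1 - rmu p w y z) / (p ^+ 3 * W ^+ 6).
Proof.
move=> yx zx zy; have xy : x != y by rewrite eq_sym.
have xz : x != z by rewrite eq_sym. have yz : y != z by rewrite eq_sym.
rewrite /evar !rq_edge /rmu (negbTE xy) (negbTE xz) (negbTE yz) /tcoef /mdeg.
have w0 u := w_gt0 hb hw u; have W0 := W_gt0 hw hn.
by field; rewrite !gt_eqF.
Qed.

Lemma one_sub_rmu x y : 1 - p <= 1 - rmu p w x y <= 1.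
Proof. by rewrite lerD2l lerN2 (rmu_le hp hb hw) gerBl (rmu_ge0 hp hb hw). Qed.

Lemma prod3_bounds x y z :
  (1 - p) ^+ 3 <= (1 - rmu p w x y) * (1 - rmu p w x z) * (1 - rmu p w y z) <= 1.
Proof.
have /andP[_ p1] := hp; have q0 : 0 <= 1 - p by rewrite subr_ge0.
have /andP[a1 a2] := one_sub_rmu x y; have /andP[b1 b2] := one_sub_rmu x z.
have /andP[c1 c2] := one_sub_rmu y z.
have a0 := le_trans q0 a1; have b0 := le_trans q0 b1; have c0 := le_trans q0 c1.
apply/andP; split.
  rewrite [leLHS](_ : _ = (1 - p) * (1 - p) * (1 - p)); last by ring.
  by apply: ler_pM => //; [exact: mulr_ge0|exact: ler_pM].
have ab : (1 - rmu p w x y) * (1 - rmu p w x z) <= 1 by rewrite mulr_ile1.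
by rewrite mulr_ile1// mulr_ge0.
Qed.

Lemma Ex_vsum_bounds :
  (1 - p) ^+ 3 * (@ntri R n / (6 * p ^+ 3 * W ^+ 6)) <= Ex V0 <= @ntri R n / (6 * p ^+ 3 * W ^+ 6).
Proof.
have W0 := W_gt0 hw hn.
have c0 : 0 <= (p ^+ 3 * W ^+ 6)^-1.
  by rewrite invr_ge0 mulr_ge0// exprn_ge0// ltW.
have E : @ntri R n / (6 * p ^+ 3 * W ^+ 6) = 6^-1 * (@ntri R n * (p ^+ 3 * W ^+ 6)^-1).
  by field; rewrite !gt_eqF.
rewrite E -count_ordered Ex_vsumE.
have H (x y z : 'I_n) : y != x -> z \notin [:: x; y] ->
   (1 - p) ^+ 3 * (1 * (p ^+ 3 * W ^+ 6)^-1) <= sg x y * (sg x z * (sg y z * tcoef p w x y z ^+ 2))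
   <= 1 * (p ^+ 3 * W ^+ 6)^-1.
  move=> yx /outP[zx zy]; rewrite sg_prod// mul1r.
  have /andP[h1 h2] := prod3_bounds x y z.
  by rewrite !ler_wpM2r//= ler_piMl.
apply/andP; split.
  rewrite mulrCA; apply: ler_wpM2l; first by rewrite invr_ge0.
  rewrite !mulr_suml !mulr_sumr; apply: ler_sum => x _; rewrite !mulr_suml !mulr_sumr.
  apply: ler_sum => y yx; have xy : x != y by rewrite eq_sym.
  rewrite Ex_ycod2// !mulr_suml !mulr_sumr; apply: ler_sum => z zo.
  by have /andP[] := H x y z yx zo.
apply: ler_wpM2l; first by rewrite invr_ge0.
rewrite !mulr_suml; apply: ler_sum => x _; rewrite !mulr_suml.
apply: ler_sum => y yx; have xy : x != y by rewrite eq_sym.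
rewrite Ex_ycod2// !mulr_suml !mulr_sumr; apply: ler_sum => z zo.
by have /andP[] := H x y z yx zo.
Qed.

End edge_pairs.

Lemma sum_ordered_triples (V : realFieldType) n :
  \sum_(i < n) \sum_(j < n | (i < j)%N) \sum_(k < n | (j < k)%N) (1 : V) = @ntri V n / 6.
Proof.
pose t (x y z : 'I_n) : V := [&& y != x, z != x & z != y]%:R.
have H : \sum_x \sum_y \sum_z t x y z = @ntri V n.
  rewrite -count_ordered; apply: eq_bigr => x _; rewrite [RHS]big_mkcond; apply: eq_bigr => y _.
  rewrite /t; case: (y != x) => /=; last by rewrite big1.
  rewrite [RHS]big_mkcond; apply: eq_bigr => z _; rewrite !inE negb_or.
  by case: andP.
have := triple_sum_ord (t := t); rewrite H => -> //; first last.
- by move=> x z; rewrite /t eqxx.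
- by move=> x y z; rewrite /t andbCA [y == z]eq_sym.
- by move=> x y z; rewrite /t [x == y]eq_sym [(z != x) && _]andbC.
rewrite mulrAC divff ?pnatr_eq0// mul1r; apply: eq_bigr => i _; apply: eq_bigr => j ij.
apply: eq_bigr => k jk; rewrite /t -!(inj_eq val_inj)/=.
by rewrite !gtn_eqF// (ltn_trans ij jk).
Qed.

Lemma pow6_le {R : realFieldType} (q y : R) :
  0 <= q -> q <= 1 + y -> 0 <= y -> y <= 1 -> q ^+ 6 <= 1 + 63 * y.
Proof.
move=> q0 qy y0 y1; have h4 := pow4_le q0 qy y0 y1.
have q2 : q ^+ 2 <= 1 + 3 * y by nra.
have e : q ^+ 6 = (q ^+ 2) ^+ 2 * q ^+ 2 by ring.
rewrite e; apply: (@le_trans _ _ ((1 + 15 * y) * (1 + 3 * y))); last by nra.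
by apply: ler_pM => //; apply: sqr_ge0.
Qed.

(** * Asymptotics of the variance formula of the theorem *)

Section variance.
Context {R : realFieldType} {n : nat} (p : R) (w : 'I_n -> R) (beta : R).
Hypothesis hp : 0 < p <= 1.
Hypothesis hb : 0 < beta.
Hypothesis hw : forall i, beta <= w i <= 1.
Hypothesis hn : 12 <= beta * n%:R.
Variable mu : 'I_n -> 'I_n -> R.
Hypothesis muE : forall i j, mu i j = rmu p w i j.

Implicit Types (i j x y z : 'I_n).
Notation W := (wsum w).
Let p0 : 0 < p. Proof. by case/andP: hp. Qed.
Let W12 : 12 <= W. Proof. exact: le_trans hn (W_ge hw). Qed.
Let W0 : 0 < W. Proof. exact: W_gt0 hw hn. Qed.
Let w0 i : 0 < w i. Proof. exact: w_gt0 hb hw i. Qed.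
Let w1 i : w i <= 1. Proof. by have /andP[] := hw i. Qed.

Notation md i := (\sum_j mu i j).
Notation U := (W - 1).

Let U0 : 0 < U. Proof. by rewrite subr_gt0 (lt_le_trans _ W12)// ltr1n. Qed.

Lemma rmu_neq i j : i != j -> mu i j = p * (w i * w j).
Proof. by move=> ij; rewrite muE /rmu (negbTE ij). Qed.

Lemma mean_degE i : md i = p * w i * (W - w i).
Proof.
rewrite (bigD1 i)//= muE /rmu eqxx add0r.
rewrite /wsum [in RHS](bigD1 i)//= [w i + _]addrC addrK mulr_sumr; apply: eq_bigr => j ji.
by rewrite muE /rmu eq_sym (negbTE ji) mulrA.
Qed.

Notation r i := (W - w i)^-1.
Let D0 i : 0 < W - w i. Proof. by rewrite (lt_le_trans U0)// lerB. Qed.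
Let rle i : W^-1 <= r i <= U^-1.
Proof. by rewrite !lef_pV2 ?posrE// gerBl ltW//= lerB. Qed.
Let a0 : 0 <= W^-1. Proof. by rewrite invr_ge0 ltW. Qed.
Let r0 i : 0 <= r i. Proof. by rewrite invr_ge0 ltW. Qed.
Let pi0 : 0 <= p^-1. Proof. by rewrite invr_ge0 ltW. Qed.

Lemma v1_term i j k' : i != j -> j != k' -> k' != i ->
  mu i j * (1 - mu i j) * (mu j k' * (1 - mu j k')) * (mu k' i * (1 - mu k' i))
    / (md i ^+ 2 * md j ^+ 2 * md k' ^+ 2) =
  (1 - rmu p w i j) * (1 - rmu p w i k') * (1 - rmu p w j k') * (p^-1 ^+ 3 * (r i * r j * r k') ^+ 2).
Proof.
move=> ij jk ki; rewrite !mean_degE !rmu_neq// /rmu (negbTE ij) (negbTE jk).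
rewrite eq_sym (negbTE ki).
by field; rewrite !gt_eqF.
Qed.

Lemma v1_bounds :
  (1 - p) ^+ 3 * (@ntri R n / 6 * (p^-1 ^+ 3 * W^-1 ^+ 6)) <=
  \sum_(i < n) \sum_(j < n | (i < j)%N) \sum_(k < n | (j < k)%N)
    (mu i j * (1 - mu i j) * (mu j k * (1 - mu j k)) * (mu k i * (1 - mu k i)))
    / (md i ^+ 2 * md j ^+ 2 * md k ^+ 2)
  <= @ntri R n / 6 * (p^-1 ^+ 3 * U^-1 ^+ 6).
Proof.
rewrite -sum_ordered_triples.
have H (i j k : 'I_n) : (i < j)%N -> (j < k)%N ->
   (1 - p) ^+ 3 * (1 * (p^-1 ^+ 3 * W^-1 ^+ 6)) <=
   (mu i j * (1 - mu i j) * (mu j k * (1 - mu j k)) * (mu k i * (1 - mu k i)))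
    / (md i ^+ 2 * md j ^+ 2 * md k ^+ 2) <= 1 * (p^-1 ^+ 3 * U^-1 ^+ 6).
  move=> ij jk; rewrite v1_term; first last.
  - by rewrite -(inj_eq val_inj)/= gtn_eqF// (ltn_trans ij).
  - by rewrite -(inj_eq val_inj)/= ltn_eqF.
  - by rewrite -(inj_eq val_inj)/= ltn_eqF.
  have /andP[h1 h2] := prod3_bounds hp hb hw i j k; rewrite !(mul1r (_ * _)).
  have p10 : 0 <= (1 - p) ^+ 3 by rewrite exprn_ge0// subr_ge0; case/andP: hp.
  have /andP[i1 i2] := rle i; have /andP[j1 j2] := rle j; have /andP[k1 k2] := rle k.
  have eW (a : R) : a ^+ 6 = (a * a * a) ^+ 2 by ring.
  have lo : (W^-1 * W^-1 * W^-1) ^+ 2 <= (r i * r j * r k) ^+ 2.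
    rewrite ler_sqr ?nnegrE; [|by do 2![apply: mulr_ge0 => //]..].
    by apply: ler_pM => //; [exact: mulr_ge0|exact: ler_pM].
  have hi : (r i * r j * r k) ^+ 2 <= (U^-1 * U^-1 * U^-1) ^+ 2.
    have U'0 : 0 <= U^-1 by rewrite invr_ge0 ltW.
    rewrite ler_sqr ?nnegrE; [|by do 2![apply: mulr_ge0 => //]..].
    by apply: ler_pM => //; [exact: mulr_ge0|exact: ler_pM].
  have p30 : 0 <= p^-1 ^+ 3 by rewrite exprn_ge0.
  rewrite !eW; apply/andP; split.
    apply: ler_pM => //; first by apply: mulr_ge0 => //; apply: sqr_ge0.
    exact: ler_wpM2l.
  apply: (@le_trans _ _ (p^-1 ^+ 3 * (r i * r j * r k) ^+ 2)); last exact: ler_wpM2l.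
  by apply: ler_piMl => //; apply: mulr_ge0 => //; apply: sqr_ge0.
apply/andP; split; rewrite !mulr_suml ?mulr_sumr; apply: ler_sum => i _; rewrite !mulr_suml ?mulr_sumr.
  apply: ler_sum => j ij; rewrite !mulr_suml ?mulr_sumr; apply: ler_sum => k jk.
  by have /andP[] := H i j k ij jk.
apply: ler_sum => j ij; rewrite !mulr_suml; apply: ler_sum => k jk.
by have /andP[] := H i j k ij jk.
Qed.

Let b0 : 0 <= U^-1. Proof. by rewrite invr_ge0 ltW. Qed.

Lemma prod4_bounds i j k :
  W^-1 ^+ 4 <= r i ^+ 2 * (r j * r k) <= U^-1 ^+ 4.
Proof.
have /andP[i1 i2] := rle i; have /andP[j1 j2] := rle j; have /andP[k1 k2] := rle k.
have e (a : R) : a ^+ 4 = a ^+ 2 * (a * a) by ring.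
rewrite !e; apply/andP; split; apply: ler_pM => //; rewrite ?sqr_ge0 ?mulr_ge0 ?ler_sqr ?nnegrE//.
  exact: ler_pM.
exact: ler_pM.
Qed.

Lemma sum_out_w i j : i != j -> W - 2 <= \sum_(k | k \notin [:: i; j]) w k <= W.
Proof.
move=> ij; rewrite /wsum (sum_split2 w ij).
have := w1 i; have := w1 j; have := w0 i; have := w0 j.
move: (\sum_(k | _) _) (w i) (w j) => s a b; lra.
Qed.

(** The exact mean degree is [p w_i (W - w_i)], with [W - w_i] between [W - 1] and [W]; the
    remaining sums of weights are within 2 of [W]. Both ends are [1 / M] up to a relative error of
    order [1 / W]. *)
Lemma eta_bounds i :
  p^-1 * ((W - 1) * (W - 2) * W^-1 ^+ 4) <=
  \sum_j \sum_(k | k != j) (mu i j * mu j k * mu k i) / (md i ^+ 2 * md j * md k)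
  <= p^-1 * (W ^+ 2 * U^-1 ^+ 4).
Proof.
have -> : \sum_j \sum_(k | k != j) (mu i j * mu j k * mu k i) / (md i ^+ 2 * md j * md k) =
    p^-1 * \sum_(j | j != i) w j * \sum_(k | k \notin [:: i; j]) w k * (r i ^+ 2 * (r j * r k)).
  rewrite mulr_sumr (bigD1 i)//= big1 ?add0r; last first.
    by move=> k _; rewrite muE /rmu eqxx !mul0r.
  apply: eq_bigr => j ji; have ij : i != j by rewrite eq_sym.
  rewrite (bigD1 i)//= [mu i i]muE /rmu eqxx mulr0 mul0r add0r.
  rewrite [RHS]mulrA [RHS]mulr_sumr; apply: eq_big => [k|k /andP[kj ki]].
    by rewrite !inE negb_or andbC.
  have jk : j != k by rewrite eq_sym.
  by rewrite !mean_degE !rmu_neq//; field; rewrite !gt_eqF.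
have Wi : U <= \sum_(j | j != i) w j <= W.
  rewrite /wsum [X in _ <= _ <= X](bigD1 i)//= [X in X - 1](bigD1 i)//=.
  by have := w1 i; have := w0 i; move: (\sum_(j | _) _) (w i) => s a; lra.
apply/andP; split; apply: ler_wpM2l => //.
  apply: (@le_trans _ _ (\sum_(j | j != i) w j * ((W - 2) * W^-1 ^+ 4))).
    rewrite -mulr_suml -mulrA; apply: ler_wpM2r; last by have /andP[] := Wi.
    by apply: mulr_ge0; [rewrite subr_ge0 (le_trans _ W12)// ler_nat|exact: exprn_ge0].
  apply: ler_sum => j ji; have ij : i != j by rewrite eq_sym.
  apply: ler_wpM2l; first exact: ltW.
  apply: (@le_trans _ _ (\sum_(k | k \notin [:: i; j]) w k * W^-1 ^+ 4)).
    rewrite -mulr_suml; apply: ler_wpM2r; first exact: exprn_ge0.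
    by have /andP[] := sum_out_w ij.
  apply: ler_sum => k _; apply: ler_wpM2l; first exact: ltW.
  by have /andP[] := prod4_bounds i j k.
apply: (@le_trans _ _ (\sum_(j | j != i) w j * (W * U^-1 ^+ 4))).
  apply: ler_sum => j ji; have ij : i != j by rewrite eq_sym.
  apply: ler_wpM2l; first exact: ltW.
  apply: (@le_trans _ _ (\sum_(k | k \notin [:: i; j]) w k * U^-1 ^+ 4)).
    apply: ler_sum => k _; apply: ler_wpM2l; first exact: ltW.
    by have /andP[] := prod4_bounds i j k.
  rewrite -mulr_suml; apply: ler_wpM2r; first exact: exprn_ge0.
  by have /andP[] := sum_out_w ij.
rewrite -mulr_suml expr2 -mulrA; apply: ler_wpM2r; last by have /andP[] := Wi.
by apply: mulr_ge0; [exact: ltW|exact: exprn_ge0].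
Qed.

(** Weakened on purpose, so that gamma gets literally the same endpoints as eta. *)
Lemma prod3r_bounds i j k :
  (W - 1) * W^-1 ^+ 4 <= r i * (r j * r k) <= W * U^-1 ^+ 4.
Proof.
have /andP[i1 i2] := rle i; have /andP[j1 j2] := rle j; have /andP[k1 k2] := rle k.
apply/andP; split.
  apply: (@le_trans _ _ (W^-1 * (W^-1 * W^-1))).
    rewrite [leRHS](_ : _ = W * W^-1 ^+ 4); last by field; rewrite gt_eqF.
    by apply: ler_wpM2r; [exact: exprn_ge0|rewrite gerBl].
  by apply: ler_pM => //; [exact: mulr_ge0|exact: ler_pM].
apply: (@le_trans _ _ (U^-1 * (U^-1 * U^-1))).
  by apply: ler_pM => //; [exact: mulr_ge0|exact: ler_pM].
rewrite [leLHS](_ : _ = U * U^-1 ^+ 4); last by field; rewrite gt_eqF.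
by apply: ler_wpM2r; [exact: exprn_ge0|rewrite gerBl].
Qed.

Lemma gamma_bounds i j : i != j ->
  p^-1 * ((W - 1) * (W - 2) * W^-1 ^+ 4) <=
  \sum_(k | (k != i) && (k != j)) (mu j k * mu k i) / (md i * md j * md k)
  <= p^-1 * (W ^+ 2 * U^-1 ^+ 4).
Proof.
move=> ij.
have -> : \sum_(k | (k != i) && (k != j)) (mu j k * mu k i) / (md i * md j * md k) =
    p^-1 * \sum_(k | k \notin [:: i; j]) w k * (r i * (r j * r k)).
  rewrite [RHS]mulr_sumr; apply: eq_big => [k|k /andP[ki kj]]; first by rewrite !inE negb_or.
  have jk : j != k by rewrite eq_sym.
  by rewrite !mean_degE !rmu_neq//; field; rewrite !gt_eqF.
have /andP[s1 s2] := sum_out_w ij.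
apply/andP; split; apply: ler_wpM2l => //.
  apply: (@le_trans _ _ (\sum_(k | k \notin [:: i; j]) w k * (U * W^-1 ^+ 4))).
    rewrite -mulr_suml [leLHS](_ : _ = (W - 2) * (U * W^-1 ^+ 4)); last by ring.
    apply: ler_wpM2r => //.
    by apply: mulr_ge0; [exact: ltW|exact: exprn_ge0].
  apply: ler_sum => k _; apply: ler_wpM2l; first exact: ltW.
  by have /andP[] := prod3r_bounds i j k.
apply: (@le_trans _ _ (\sum_(k | k \notin [:: i; j]) w k * (W * U^-1 ^+ 4))).
  apply: ler_sum => k _; apply: ler_wpM2l; first exact: ltW.
  by have /andP[] := prod3r_bounds i j k.
rewrite -mulr_suml expr2 -mulrA; apply: ler_wpM2r => //.
by apply: mulr_ge0; [exact: ltW|exact: exprn_ge0].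
Qed.

Lemma WU_le : W * U^-1 <= 1 + 2 / W.
Proof.
have := W12; move: W W0 U0 => x x0 u0 x12.
rewrite ler_pdivrMr// -subr_ge0.
have -> : (1 + 2 / x) * (x - 1) - x = (x - 2) / x by field; rewrite gt_eqF.
by rewrite divr_ge0 ?(ltW x0)//; lra.
Qed.

Let y1 : 2 / W <= 1.
Proof. by rewrite ler_pdivrMr// mul1r (le_trans _ W12)// ler_nat. Qed.

Let y0 : 0 <= 2 / W. Proof. by rewrite divr_ge0// ltW. Qed.

Let WU0 : 0 <= W * U^-1. Proof. by rewrite mulr_ge0// ltW. Qed.

Lemma bounds_gap :
  p^-1 * (W ^+ 2 * U^-1 ^+ 4) - p^-1 * ((W - 1) * (W - 2) * W^-1 ^+ 4) <= 33 * (p^-1 * W^-1 ^+ 3).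
Proof.
rewrite -mulrBr [leRHS]mulrCA; apply: ler_wpM2l => //.
have h := pow4_le WU0 WU_le y0 y1.
have e1 : W ^+ 2 * U^-1 ^+ 4 = W^-1 ^+ 2 * ((W * U^-1) ^+ 2) ^+ 2.
  by field; rewrite !gt_eqF.
have e2 : (W - 1) * (W - 2) * W^-1 ^+ 4 = W^-1 ^+ 2 * (1 - 3 / W + 2 / W ^+ 2).
  by field; rewrite gt_eqF.
have e3 : 33 * W^-1 ^+ 3 = W^-1 ^+ 2 * (33 / W) by field; rewrite gt_eqF.
rewrite e1 e2 e3 -mulrBr; apply: ler_wpM2l; first exact: sqr_ge0.
have : 0 <= 2 / W ^+ 2 by apply: divr_ge0 => //; apply: sqr_ge0.
have e4 : 15 * (2 / W) = 30 * W^-1 by field; rewrite gt_eqF.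
move: h; rewrite e4.
move: (_ ^+ 2 ^+ 2) (2 / W ^+ 2) (W^-1) => u v b h v0; lra.
Qed.

Notation etaw i :=
  (\sum_j \sum_(k | k != j) (mu i j * mu j k * mu k i) / (md i ^+ 2 * md j * md k)).
Notation gammaw i j :=
  (\sum_(k | (k != i) && (k != j)) (mu j k * mu k i) / (md i * md j * md k)).

(** Gamma and the mean of the two etas lie in one interval, so they differ by at most its width
    [33 / (p W^3)] from [bounds_gap]; 1089 is the square of 33. *)
Lemma v2_term i j : i != j ->
  0 <= (gammaw i j - (etaw i + etaw j) / 2) ^+ 2 * (mu i j * (1 - mu i j))
    <= 1089 * (p^-1 * W^-1 ^+ 6).
Proof.
move=> ij.
have gap := bounds_gap.
have := gamma_bounds ij; have := eta_bounds i; have := eta_bounds j; move: gap.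
have /andP[m1 m2] := one_sub_rmu hp hb hw i j.
have mp := rmu_le hp hb hw i j; have mp0 := rmu_ge0 hp hb hw i j; rewrite muE.
move: (etaw i) (etaw j) (gammaw i j) => x y g.
move: (p^-1 * _) (p^-1 * (_ * _ * _)) => hi lo gap /andP[y1' y2] /andP[x1 x2] /andP[g1 g2].
have g0 : 0 <= 33 * (p^-1 * W^-1 ^+ 3).
  by apply: mulr_ge0 => //; apply: mulr_ge0 => //; apply: exprn_ge0.
have mm : 0 <= rmu p w i j * (1 - rmu p w i j) <= p.
  have p1 : p <= 1 by case/andP: hp.
  move: m1 m2 mp mp0; move: (rmu p w i j) => u m1 m2 mp mp0.
  have m0 : 0 <= 1 - u by lra.
  apply/andP; split; first exact: mulr_ge0.
  by rewrite (le_trans _ mp)// ler_piMr.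
have sq : (g - (x + y) / 2) ^+ 2 <= (33 * (p^-1 * W^-1 ^+ 3)) ^+ 2.
  move: g0 gap; move: (33 * (p^-1 * _)) => G g0 gap.
  by rewrite -subr_ge0 subr_sqr mulr_ge0//; lra.
have /andP[mm0 mmp] := mm.
apply/andP; split; first by apply: mulr_ge0 => //; apply: sqr_ge0.
have -> : 1089 * (p^-1 * W^-1 ^+ 6) = (33 * (p^-1 * W^-1 ^+ 3)) ^+ 2 * p.
  by field; rewrite !gt_eqF.
by apply: ler_pM => //; apply: sqr_ge0.
Qed.

Notation v1w := (\sum_(i < n) \sum_(j < n | (i < j)%N) \sum_(k < n | (j < k)%N)
    (mu i j * (1 - mu i j) * (mu j k * (1 - mu j k)) * (mu k i * (1 - mu k i)))
    / (md i ^+ 2 * md j ^+ 2 * md k ^+ 2)).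
Notation v2w := (\sum_(i < n) \sum_(j < n | (i < j)%N)
  (gammaw i j - (etaw i + etaw j) / 2) ^+ 2 * (mu i j * (1 - mu i j))).

Lemma v2_bounds : 0 <= v2w <= n%:R ^+ 2 * (1089 * (p^-1 * W^-1 ^+ 6)).
Proof.
have ne i j : (i < j)%N -> i != j by move=> ij; rewrite -(inj_eq val_inj)/= ltn_eqF.
have B0 : 0 <= 1089 * (p^-1 * W^-1 ^+ 6).
  by apply: mulr_ge0 => //; apply: mulr_ge0 => //; apply: exprn_ge0.
apply/andP; split.
  apply: sumr_ge0 => i _; apply: sumr_ge0 => j ij.
  by have /andP[] := v2_term (ne _ _ ij).
have e : n%:R ^+ 2 * (1089 * (p^-1 * W^-1 ^+ 6)) =
    \sum_(i < n) \sum_(j < n) 1089 * (p^-1 * W^-1 ^+ 6).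
  by rewrite !sumr_const card_ord -mulrnA -[RHS]mulr_natl natrM expr2.
rewrite e; apply: ler_sum => i _; rewrite big_mkcond; apply: ler_sum => j _.
by case: ifP => // ij; have /andP[] := v2_term (ne _ _ ij).
Qed.

(** The first part is the number of triples times an almost constant term; 126 is [63 * 2] from
    [pow6_le] and [WU_le]. The second part is of relative size [p^2 / n], with 6534 equal to
    [6 * 1089]. *)
Lemma v_bounds :
  (1 - p) ^+ 3 * (1 - 3 / n%:R) <=
    (v1w + v2w) / (n%:R ^+ 3 / (6 * W ^+ 6 * p ^+ 3))
  <= 1 + 126 / (beta * n%:R) + 6534 * p ^+ 2 / n%:R.
Proof.
have n0 : 0 < n%:R :> R by exact: n_gt0 hb hn.
have /andP[v11 v12] := v1_bounds; have /andP[v21 v22] := v2_bounds.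
move: v11 v12 v21 v22; move: v1w v2w => v1 v2 v11 v12 v21 v22.
have W6 : (W * U^-1) ^+ 6 <= 1 + 126 / (beta * n%:R).
  apply: (le_trans (pow6_le WU0 WU_le y0 y1)); rewrite lerD2l.
  rewrite mulrA -natrM; apply: ler_wpM2l => //.
  by rewrite lef_pV2 ?posrE ?(W_ge hw)// mulr_gt0.
have tr : n%:R * (n%:R - 1) * (n%:R - 2) <= n%:R ^+ 3 :> R.
  have n1 : 2 <= n%:R :> R.
    have := W_le hw; have := W12; lra.
  by move: n1; move: (n%:R : R) => x x2; nra.
have tr' : n%:R ^+ 3 * (1 - 3 / n%:R) <= n%:R * (n%:R - 1) * (n%:R - 2) :> R.
  rewrite [leLHS](_ : _ = n%:R ^+ 3 - 3 * n%:R ^+ 2); last by field; rewrite gt_eqF.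
  by move: n0; move: (n%:R : R) => x x0; nra.
have c0 : 0 < n%:R ^+ 3 / (6 * W ^+ 6 * p ^+ 3).
  apply: divr_gt0; first exact: exprn_gt0.
  by apply: mulr_gt0; [apply: mulr_gt0 => //|]; apply: exprn_gt0.
rewrite ler_pdivlMr// ler_pdivrMr//; apply/andP; split.
  apply: (@le_trans _ _ v1); last by rewrite lerDl.
  apply: le_trans v11; rewrite -[leLHS]mulrA.
  apply: ler_wpM2l; first by rewrite exprn_ge0// subr_ge0; case/andP: hp.
  rewrite [leLHS](_ : _ = n%:R ^+ 3 * (1 - 3 / n%:R) * (6^-1 * (p^-1 ^+ 3 * W^-1 ^+ 6))); last first.
    by field; rewrite !gt_eqF.
  rewrite -[leRHS]mulrA; apply: ler_wpM2r; last exact: tr'.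
  apply: mulr_ge0; first by rewrite invr_ge0.
  by apply: mulr_ge0; exact: exprn_ge0.
rewrite mulrDl; apply: lerD.
  apply: (le_trans v12).
  rewrite [leLHS](_ : _ = @ntri R n * ((W * U^-1) ^+ 6 * (6 * W ^+ 6 * p ^+ 3)^-1)); last first.
    by field; rewrite !gt_eqF.
  rewrite [leRHS](_ : _ = n%:R ^+ 3 * ((1 + 126 / (beta * n%:R)) * (6 * W ^+ 6 * p ^+ 3)^-1)); last first.
    by field; rewrite !gt_eqF.
  have d0 : 0 <= (6 * W ^+ 6 * p ^+ 3)^-1.
    by rewrite invr_ge0; apply: mulr_ge0; [apply: mulr_ge0 => //|]; apply: exprn_ge0; exact: ltW.
  have n30 : 0 <= n%:R ^+ 3 :> R by rewrite exprn_ge0// ltW.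
  apply: (@le_trans _ _ (n%:R ^+ 3 * ((W * U^-1) ^+ 6 * (6 * W ^+ 6 * p ^+ 3)^-1))).
    apply: ler_wpM2r; last exact: tr.
    by apply: mulr_ge0 => //; exact: exprn_ge0.
  by apply: ler_wpM2l => //; apply: ler_wpM2r.
apply: (le_trans v22); rewrite le_eqVlt; apply/orP; left; apply/eqP.
by field; rewrite !gt_eqF.
Qed.

End variance.

(** * The Stein error of the standardized statistic *)

Lemma stein_combine {R : realFieldType} (E1 E2 C K D u d b b' k12 k8 g : R) :
  0 <= C -> 0 <= K -> 0 < d ->
  `|E1 - E2| <= K * (d / 2 + 12 * 3600 * k8 * g / (2 * d)) ->
  `|E2| <= C * (D + d / 2 + b / (2 * d)) + C * (d / 2 * u + b' / d) ->
  b <= 864 * k12 * g -> b' <= 144 * k12 * g ->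
  `|E1| <= C * D + (C + C * u + K) * (d / 2)
    + (C * (432 * k12) + C * (144 * k12) + K * (6 * 3600 * k8)) / d * g.
Proof.
move=> C0 K0 d0 h1 h2 hb hb'.
have i0 : 0 <= d^-1 by rewrite invr_ge0 ltW.
rewrite -[E1](subrK E2) (le_trans (ler_normD _ _))// (le_trans (lerD h1 h2))//.
have h3 : C * (b / (2 * d)) <= C * (864 * k12 * g / (2 * d)).
  by apply: ler_wpM2l => //; apply: ler_wpM2r => //; rewrite invr_ge0 mulr_ge0// ltW.
have h4 : C * (b' / d) <= C * (144 * k12 * g / d).
  by apply: ler_wpM2l => //; apply: ler_wpM2r.
rewrite [leRHS](_ : _ = K * (d / 2 + 12 * 3600 * k8 * g / (2 * d)) +
  (C * (D + d / 2) + C * (864 * k12 * g / (2 * d)) + (C * (d / 2 * u) + C * (144 * k12 * g / d)))).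
  by rewrite lerD2l ![C * (_ + _)]mulrDr; apply: lerD; rewrite lerD2l.
by field; rewrite gt_eqF.
Qed.

Section scaled_errors.
Context {R : realFieldType} (s L kp p : R).
Hypothesis L1 : 1 <= L.
Hypothesis sL : s ^+ 2 <= 12 * L ^+ 3.
Hypothesis kp1 : 1 <= kp.
Hypothesis p0 : 0 < p.
Let L0 : 0 < L. Proof. exact: lt_le_trans L1. Qed.
Let kp0 : 0 <= kp. Proof. exact: le_trans kp1. Qed.
Let g0 : 0 < L^-1. Proof. by rewrite invr_gt0. Qed.
Let g1 : L^-1 <= 1. Proof. by rewrite invf_le1. Qed.
Let g2 : L^-1 ^+ 2 <= L^-1. Proof. by rewrite expr2 ler_piMl// ltW. Qed.
Let g3 : L^-1 ^+ 3 <= L^-1.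
Proof. by rewrite exprS ler_piMr ?(ltW g0)// (le_trans g2). Qed.
Let s4 : s ^+ 4 <= 144 * L ^+ 6.
Proof.
rewrite (_ : s ^+ 4 = (s ^+ 2) ^+ 2) 1?(_ : 144 * L ^+ 6 = (12 * L ^+ 3) ^+ 2); [|by ring..].
rewrite ler_sqr ?nnegrE ?sqr_ge0//; apply: mulr_ge0 => //; exact: exprn_ge0 (ltW L0).
Qed.

Lemma scaled_variance_error :
  s ^+ 4 * ((kp / L) ^+ 12 * L ^+ 2 * (5 * L ^+ 2 + L) * p) <= 864 * kp ^+ 12 * p.
Proof.
have k12 : 0 <= kp ^+ 12 by exact: exprn_ge0.
apply: (@le_trans _ _ (144 * L ^+ 6 * ((kp / L) ^+ 12 * L ^+ 2 * (5 * L ^+ 2 + L) * p))).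
  apply: ler_wpM2r => //; apply: mulr_ge0; last exact: ltW.
  apply: mulr_ge0; first by apply: mulr_ge0; apply: exprn_ge0; [apply: divr_ge0 => //; exact: ltW|exact: ltW].
  by apply: addr_ge0; [apply: mulr_ge0 => //; exact: sqr_ge0|exact: ltW].
rewrite [leLHS](_ : _ = 144 * kp ^+ 12 * p * (5 * L^-1 ^+ 2 + L^-1 ^+ 3)); last by field; rewrite gt_eqF.
rewrite [leRHS](_ : _ = 144 * kp ^+ 12 * p * 6); last by ring.
apply: ler_wpM2l; first by apply: mulr_ge0 => //; [exact: mulr_ge0|exact: ltW].
by have := g2; have := g3; have := g1; lra.
Qed.

Lemma scaled_taylor_error :
  s ^+ 4 * ((kp / L) ^+ 12 * L ^+ 2 * (L ^+ 2 * p + L)) <= 144 * kp ^+ 12 * (p + L^-1).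
Proof.
have k12 : 0 <= kp ^+ 12 by exact: exprn_ge0.
apply: (@le_trans _ _ (144 * L ^+ 6 * ((kp / L) ^+ 12 * L ^+ 2 * (L ^+ 2 * p + L)))).
  apply: ler_wpM2r => //.
  apply: mulr_ge0; first by apply: mulr_ge0; apply: exprn_ge0; [apply: divr_ge0 => //; exact: ltW|exact: ltW].
  by apply: addr_ge0; [apply: mulr_ge0; [exact: sqr_ge0|exact: ltW]|exact: ltW].
rewrite [leLHS](_ : _ = 144 * kp ^+ 12 * (p * L^-1 ^+ 2 + L^-1 ^+ 3)); last by field; rewrite gt_eqF.
apply: ler_wpM2l; first exact: mulr_ge0.
apply: lerD => //; apply: ler_piMr; first exact: ltW.
exact: le_trans g2 g1.
Qed.

(** Here [s] is an inverse standard deviation, with [s ^+ 2] at most of order [L ^+ 3]; on this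
    scale the remainder variance is of order [p + 1/L]. *)
Lemma scaled_remainder_error :
  s ^+ 2 * (3600 * kp ^+ 4 * ((kp / L) ^+ 3 * (p + kp / L))) <= 12 * 3600 * kp ^+ 8 * (p + L^-1).
Proof.
have kL : 0 <= kp / L by apply: divr_ge0 => //; exact: ltW.
apply: (@le_trans _ _ (12 * L ^+ 3 * (3600 * kp ^+ 4 * ((kp / L) ^+ 3 * (p + kp / L))))).
  apply: ler_wpM2r => //; apply: mulr_ge0; first by apply: mulr_ge0 => //; exact: exprn_ge0.
  by apply: mulr_ge0; [exact: exprn_ge0|apply: addr_ge0 => //; exact: ltW].
rewrite [leLHS](_ : _ = 12 * 3600 * kp ^+ 7 * (p + kp * L^-1)); last by field; rewrite gt_eqF.
rewrite [leRHS](_ : _ = 12 * 3600 * kp ^+ 7 * (kp * (p + L^-1))); last by ring.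
apply: ler_wpM2l; first by apply: mulr_ge0; [exact: mulr_ge0|exact: exprn_ge0].
by rewrite mulrDr lerD2r ler_peMl// ltW.
Qed.

End scaled_errors.

Section edge_pairs.
Context {R : realFieldType} {n : nat} (p : R) (w : 'I_n -> R) (beta : R).
Hypothesis hp : 0 < p <= 1.
Hypothesis hb : 0 < beta.
Hypothesis hw : forall i, beta <= w i <= 1.
Hypothesis hn : 12 <= beta * n%:R.

Implicit Types (i j x y z : 'I_n).
Notation cfg := {ffun 'I_n * 'I_n -> bool}.
Notation m := (mdeg p w).
Notation M := (mtot p w).
Notation W := (wsum w).
Notation Ex := (Ex (rq p w)).
Notation L := (avgd (n := n) p).
Notation kap := (kap beta).
Let q01 := rq01 hp hb hw.
Let p0 : 0 < p. Proof. by case/andP: hp. Qed.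
Let p0' : 0 <= p. Proof. exact: ltW. Qed.

Hypothesis L1 : 1 <= L.
Variable s : R.
Hypothesis s0 : 0 <= s.
Hypothesis sL : s ^+ 2 <= 12 * L ^+ 3.

Notation T := (lintri p w).
Notation V0 := (vsum p w).
Let Rm (a : cfg) := wtri a - T a.
Let X (a : cfg) := s * (wtri a - Ex wtri).
Let kap1 : 1 <= kap. Proof. by have := kap_ge2 hb hw hn; apply: le_trans; rewrite ler1n. Qed.

Let XE a : X a = s * T a + s * (Rm a - Ex Rm).
Proof.
rewrite /X /Rm ExB Ex_lintri; ring.
Qed.

Let var_Rm : s ^+ 2 * Ex (fun a => (Rm a - Ex Rm) ^+ 2) <= 12 * 3600 * kap ^+ 8 * (p + L^-1).
Proof.
apply: le_trans (scaled_remainder_error L1 sL kap1 p0).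
by apply: ler_wpM2l; [exact: sqr_ge0|exact: (var_remainder hp hb hw hn)].
Qed.

Lemma second_moment_bound :
  Ex (fun a => X a ^+ 2) <= 2 * (s ^+ 2 * Ex V0) + 24 * 3600 * kap ^+ 8 * (p + L^-1).
Proof.
apply: (@le_trans _ _ (Ex (fun a => 2 * (s ^+ 2 * T a ^+ 2) + 2 * (s ^+ 2 * (Rm a - Ex Rm) ^+ 2)))).
  apply: (le_Ex q01) => a; rewrite XE; move: (T a) (Rm a - Ex Rm) => x y.
  rewrite -subr_ge0 [leRHS](_ : _ = (s * x - s * y) ^+ 2); last by ring.
  exact: sqr_ge0.
have -> : Ex (fun a => 2 * (s ^+ 2 * T a ^+ 2) + 2 * (s ^+ 2 * (Rm a - Ex Rm) ^+ 2)) =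
    2 * (s ^+ 2 * Ex (fun a => T a ^+ 2)) + 2 * (s ^+ 2 * Ex (fun a => (Rm a - Ex Rm) ^+ 2)).
  by rewrite ExD !ExZ.
rewrite Ex_lintri2; apply: lerD => //.
apply: (@le_trans _ _ (2 * (12 * 3600 * kap ^+ 8 * (p + L^-1)))); first by apply: ler_wpM2l.
by rewrite le_eqVlt; apply/orP; left; apply/eqP; ring.
Qed.

Variables (h dh : R -> R) (C K : R).
Hypothesis C0 : 0 <= C.
Hypothesis K0 : 0 <= K.
Hypothesis dhC : forall x : R, `|dh x| <= C.
Hypothesis taylor : forall x y : R, `|h y - h x - (y - x) * dh x| <= C * (y - x) ^+ 2.
Hypothesis lipK : forall x y : R, `|(dh x - x * h x) - (dh y - y * h y)| <= K * `|x - y|.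

(** [stein_bound] for [s * T], plus the cost of passing to [X]: the Stein integrand is
    [K]-Lipschitz, and [X - s * T] is the centred scaled remainder. *)
Lemma stein_error_bound (d : R) : 0 < d ->
  `|Ex (fun a => dh (X a) - X a * h (X a))| <=
  C * `|1 - s ^+ 2 * Ex V0| + (C + C * (s ^+ 2 * Ex V0) + K) * (d / 2)
  + (C * (432 * kap ^+ 12) + C * (144 * kap ^+ 12) + K * (6 * 3600 * kap ^+ 8)) / d * (p + L^-1).
Proof.
move=> d0; pose psi (x : R) := dh x - x * h x.
have L0 : 0 < L by exact: L_gt0 hp hb hn.
have diff : `|Ex (fun a => psi (X a)) - Ex (fun a => psi (s * T a))| <=
    K * (d / 2 + 12 * 3600 * kap ^+ 8 * (p + L^-1) / (2 * d)).
  rewrite -ExB (le_trans (norm_Ex_le hp hb hw _))//.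
  apply: (@le_trans _ _ (Ex (fun a => K * (d / 2 + s ^+ 2 * (Rm a - Ex Rm) ^+ 2 / (2 * d))))).
    apply: (le_Ex q01) => a; apply: (le_trans (lipK _ _)); apply: ler_wpM2l => //.
    rewrite XE addrAC subrr add0r (le_trans (norm_le_amgm _ d0))// lerD2l.
    by rewrite exprMn.
  rewrite ExZ ExD Ex_cst ExZr ExZ; apply: ler_wpM2l => //; rewrite lerD2l.
  apply: ler_wpM2r => //; rewrite invr_ge0 mulr_ge0//; exact: ltW.
have main := stein_bound hp hb hw hn s0 C0 C0 dhC taylor d0.
have e1 := scaled_variance_error L1 sL kap1 p0.
have e2 := scaled_taylor_error L1 sL kap1 p0.
have p_le : p <= p + L^-1 by rewrite lerDl invr_ge0 ltW.
have e3 : 864 * kap ^+ 12 * p <= 864 * kap ^+ 12 * (p + L^-1).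
  by apply: ler_wpM2l => //; apply: mulr_ge0 => //; apply: exprn_ge0; exact: le_trans kap1.
exact: stein_combine C0 K0 d0 diff main (le_trans e1 e3) e2.
Qed.

End edge_pairs.

Section edge_pairs.
Context {R : realFieldType} {n : nat} (p : R) (w : 'I_n -> R) (beta : R).
Hypothesis hp : 0 < p <= 1.
Hypothesis hb : 0 < beta.
Hypothesis hw : forall i, beta <= w i <= 1.
Hypothesis hn : 12 <= beta * n%:R.

Implicit Types (i j x y z : 'I_n).
Notation cfg := {ffun 'I_n * 'I_n -> bool}.
Notation m := (mdeg p w).
Notation M := (mtot p w).
Notation W := (wsum w).
Notation Ex := (Ex (rq p w)).
Notation L := (avgd (n := n) p).
Notation kap := (kap beta).
Let q01 := rq01 hp hb hw.
Let p0 : 0 < p. Proof. by case/andP: hp. Qed.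
Let p0' : 0 <= p. Proof. exact: ltW. Qed.

Notation c := (n%:R ^+ 3 / (6 * W ^+ 6 * p ^+ 3)).
Notation V0 := (vsum p w).

Let n0 : 0 < n%:R :> R. Proof. exact: n_gt0 hb hn. Qed.
Let W0 : 0 < W. Proof. exact: W_gt0 hw hn. Qed.

Lemma scale_gt0 : 0 < c.
Proof.
apply: divr_gt0; first exact: exprn_gt0.
by apply: mulr_gt0; [apply: mulr_gt0 => //|]; apply: exprn_gt0.
Qed.

Lemma Ex_vsum_ratio : (1 - p) ^+ 3 * (1 - 3 / n%:R) <= Ex V0 / c <= 1.
Proof.
have n1 : 2 <= n%:R :> R.
  by have := W_le hw; have := le_trans hn (W_ge hw); lra.
have tr : @ntri R n <= n%:R ^+ 3.
  by rewrite /ntri; move: n1; move: (n%:R : R) => x x2; nra.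
have tr' : n%:R ^+ 3 * (1 - 3 / n%:R) <= @ntri R n.
  rewrite [leLHS](_ : _ = n%:R ^+ 3 - 3 * n%:R ^+ 2); last by field; rewrite gt_eqF.
  by rewrite /ntri; move: n0; move: (n%:R : R) => x x0; nra.
have c0 := scale_gt0.
have /andP[h1 h2] := Ex_vsum_bounds hp hb hw hn.
have d0 : 0 <= (6 * p ^+ 3 * W ^+ 6)^-1.
  by rewrite invr_ge0; apply: mulr_ge0; [apply: mulr_ge0 => //|]; apply: exprn_ge0; exact: ltW.
have cE : c = n%:R ^+ 3 * (6 * p ^+ 3 * W ^+ 6)^-1 by field; rewrite !gt_eqF.
rewrite ler_pdivlMr// ler_pdivrMr// mul1r cE; apply/andP; split.
  apply: le_trans h1; rewrite -[leLHS]mulrA; apply: ler_wpM2l.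
    by rewrite exprn_ge0// subr_ge0; case/andP: hp.
  rewrite [leLHS](_ : _ = n%:R ^+ 3 * (1 - 3 / n%:R) * (6 * p ^+ 3 * W ^+ 6)^-1).
    exact: ler_wpM2r.
  by field; rewrite !gt_eqF.
by apply: (le_trans h2); apply: ler_wpM2r.
Qed.

(** As [W <= n%:R], the scale [c] is at least [1 / (6 L^3)]; the other factor 2 comes from
    [v >= c / 2]. *)
Lemma inv_scale_le (v : R) : 2^-1 <= v / c -> 0 < v /\ v^-1 <= 12 * L ^+ 3.
Proof.
have c0 := scale_gt0; rewrite ler_pdivlMr// => cv.
have v0 : 0 < v by apply: lt_le_trans cv; apply: mulr_gt0; rewrite ?invr_gt0.
split=> //; apply: (@le_trans _ _ (2^-1 * c)^-1).
  by rewrite lef_pV2// posrE; apply: mulr_gt0; rewrite ?invr_gt0.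
have -> : (2^-1 * c)^-1 = 12 * (W ^+ 6 * (p ^+ 3 / n%:R ^+ 3)) by field; rewrite !gt_eqF.
have -> : 12 * L ^+ 3 = 12 * (n%:R ^+ 6 * (p ^+ 3 / n%:R ^+ 3)).
  by rewrite /avgd; field; rewrite gt_eqF.
apply: ler_wpM2l => //; apply: ler_wpM2r.
  by apply: divr_ge0; apply: exprn_ge0; exact: ltW.
by rewrite lerXn2r ?nnegrE ?(W_le hw)//; exact: ltW.
Qed.

End edge_pairs.

From mathcomp Require Import all_classical all_reals all_analysis.
From mathcomp Require Import measurable_realfun.

Import numFieldNormedType.Exports.

Local Open Scope classical_set_scope.
Local Open Scope ring_scope.

(** * Stein's equation on the real line *)

Definition lip {R : realType} (K : R) (f : R -> R) : Prop :=
  forall x y, `|f x - f y| <= K * `|x - y|.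

Lemma lip_continuous {R : realType} (K : R) (f : R -> R) :
  lip K f -> continuous f.
Proof.
move=> fK x; apply/cvgrPdist_le => /= e e0.
near=> y; apply: le_trans (fK x y) _.
have K0 : 0 < `|K| + 1 by rewrite ltr_wpDl.
apply: (@le_trans _ _ ((`|K| + 1) * `|x - y|)).
  by apply: ler_wpM2r => //; rewrite (le_trans (ler_norm _))// lerDl.
rewrite mulrC -ler_pdivlMr//.
near: y; apply: (@cvgr_dist_le _ _ _ _ _ id x) => //; rewrite divr_gt0//.
Unshelve. all: by end_near. Qed.

Lemma lip_of_derive {R : realType} (K : R) (f df : R -> R) :
  (forall x : R, is_derive x 1 f (df x)) -> (forall x, `|df x| <= K) -> lip K f.
Proof.
move=> fdf dfK; suff H x y : x <= y -> `|f x - f y| <= K * `|x - y|.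
  move=> x y; have [/H//|/ltW/H] := leP x y.
  by rewrite distrC [`|y - x|]distrC.
move=> xy; have cf : {within `[x, y], continuous f}.
  apply: derivable_within_continuous => z _.
  by have [] := fdf z.
have [c _ fE] := MVT_segment xy (fun z _ => fdf z) cf.
by rewrite distrC fE normrM [`|x - y|]distrC ler_wpM2r.
Qed.

Lemma is_derive_cast (R : realType) (f : R -> R) (x a b : R) :
  is_derive x 1 f a -> a = b -> is_derive x 1 f b.
Proof. by move=> fa <-. Qed.

Section stein_solution.
Context {R : realType}.
Notation mu := (@lebesgue_measure R).
Notation phi := (@normal_pdf R 0 1).

Lemma normal_pdf01E x : phi x = normal_peak 1 * expR (- (x ^+ 2 / 2)).
Proof.
rewrite normal_pdfE ?oner_eq0// /normal_fun subr0 expr1n; congr (_ * expR _).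
by rewrite -[1 *+ 2]/(2:R) mulNr.
Qed.

Lemma integrable_mul_pdf (g : R -> R) (C : R) (D : set R) : measurable D ->
  continuous g -> (forall x, `|g x| <= C) ->
  mu.-integrable D (EFin \o (fun x => g x * phi x)).
Proof.
move=> mD cg gC.
apply: (@integrableS _ _ _ mu setT) => //.
have := @integrableMr _ _ _ mu setT measurableT g (EFin \o phi).
apply => //.
- exact: continuous_measurable_fun.
- exists C; split; first exact: num_real.
  by move=> x Cx y _; apply: le_trans (gC y) (ltW Cx).
- exact: integrable_normal_pdf.
Qed.

Variables (psi : R -> R) (B K : R).
Hypothesis psiK : lip K psi.
Hypothesis psiB : forall x, B <= `|x| -> psi x = 0.
Hypothesis B0 : 0 < B.
Hypothesis K0 : 0 <= K.
Hypothesis psi0 : (\int[mu]_x (psi x * phi x))%R = 0.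

Lemma psi_bound x : `|psi x| <= K * (2 * B).
Proof.
have [Bx|xB] := leP B `|x|.
  by rewrite psiB// normr0 mulr_ge0// mulr_ge0// ltW.
have := psiK x B; rewrite (psiB (_ : B <= `|B|)) ?ler_norm// subr0.
move=> /le_trans; apply; rewrite ler_wpM2l// (le_trans (ler_normB _ _))//.
by rewrite (gtr0_norm B0); lra.
Qed.

Let g x := psi x * phi x.
Let F x := (\int[mu]_(t in `]-oo, x]) g t)%R.
Let f x := F x * (expR (x ^+ 2 / 2) / normal_peak 1).

Let g_int D : measurable D -> mu.-integrable D (EFin \o g).
Proof.
move=> mD; apply: (integrable_mul_pdf mD) psi_bound.
exact: lip_continuous psiK.
Qed.

Let F_derive (x : R) : is_derive x 1 F (g x).
Proof.
have [] := @continuous_FTC1 R g -oo%O x (x + 1) _ _ _ _ => //.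
- by rewrite ltrDl.
- exact: g_int.
- by rewrite ltNyr.
- apply: (@cvgM R R (nbhs x) _ psi phi (psi x) (phi x)).
  + by apply: (lip_continuous psiK).
  + by apply: continuous_normal_pdf; exact: oner_neq0.
- by move=> dF FE; split => //; rewrite -derive1E FE.
Qed.

Let F_left x : x <= - B -> F x = 0.
Proof.
move=> xB; rewrite /F (@eq_Rintegral _ _ _ mu _ (fun=> 0)); last first.
  move=> t; rewrite inE/= in_itv/= => tx; rewrite /g psiB ?mul0r//.
  by rewrite (le_trans (_ : B <= - t)) -1?normrN ?ler_norm// lerNr (le_trans tx).
by rewrite /Rintegral integral0.
Qed.

(** To the right of the support [F x] is the whole Gaussian integral of [psi], which is 0. *)
Let F_right x : B <= x -> F x = 0.
Proof.
move=> xB; have := psi0; rewrite -/g.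
have -> : [set: R] = `]-oo, x] `|` `]x, +oo[.
  by rewrite -itv_bndbnd_setU// set_itv_infty_infty.
rewrite Rintegral_setU//=; last 2 first.
- by apply: g_int; exact: measurableU.
- apply/disj_setPRL => t/=; rewrite !in_itv/= andbT => xt; apply/negP.
  by rewrite -ltNge.
rewrite -/(F x) [X in _ + X](_ : _ = 0) ?addr0//.
rewrite (@eq_Rintegral _ _ _ mu _ (fun=> 0)); last first.
  move=> t; rewrite inE/= in_itv/= andbT => tx; rewrite psiB ?mul0r//.
  by rewrite (le_trans xB)// (le_trans (ltW tx))// ler_norm.
by rewrite /Rintegral integral0.
Qed.

Let f_derive (x : R) : is_derive x 1 f (psi x + x * f x).
Proof.
have Q0 : normal_peak 1 != 0 :> R by rewrite gt_eqF// normal_peak_gt0// oner_eq0.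
have dE : is_derive x 1 (fun y : R => expR (y ^+ 2 / 2)) (expR (x ^+ 2 / 2) * x).
  apply: (@is_derive1_comp R expR (fun y => y ^+ 2 / 2)).
  have H := @is_deriveX R R id 2 x 1 1 (is_derive_id _ _).
  have H2 := @is_deriveM R R (id ^+ 2) (cst 2^-1) x 1 _ 0 H (is_derive_cst _ _ _).
  refine (is_derive_cast H2 _).
  by rewrite scaler0 add0r /= !scaler1 /GRing.scale /= expr1; field.
have dG : is_derive x 1 (fun y : R => expR (y ^+ 2 / 2) / normal_peak 1) (x * (expR (x ^+ 2 / 2) / normal_peak 1)).
  have H2 := @is_deriveM R R _ (cst (normal_peak 1)^-1) x 1 _ 0 dE (is_derive_cst _ _ _).
  refine (is_derive_cast H2 _).
  by rewrite scaler0 add0r /GRing.scale /=; ring.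
have H2 := is_deriveM (F_derive x) dG.
refine (is_derive_cast H2 _).
rewrite /GRing.scale /= /f /g normal_pdf01E expRN.
field; rewrite Q0/=; exact: lt0r_neq0 (expR_gt0 _).
Qed.

Let f_out x : B <= `|x| -> f x = 0.
Proof.
rewrite /f ler_normr => /orP[/F_right->|xB]; first by rewrite mul0r.
by rewrite F_left ?mul0r// lerNr.
Qed.

(** The extreme value theorem on [[-B, B]], outside of which [f] vanishes. *)
Let f_bounded : exists C, 0 <= C /\ forall x, `|f x| <= C.
Proof.
have cf : {within `[-B, B], continuous f}.
  by apply: derivable_within_continuous => z _; have [] := f_derive z.
have BB : - B <= B by rewrite -subr_ge0 opprK addr_ge0 ?ltW.
have [c1 _ H1] := EVT_max BB cf; have [c2 _ H2] := EVT_min BB cf.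
exists (`|f c1| + `|f c2|); split; first by rewrite addr_ge0.
move=> x; have [/f_out->|xB] := leP B `|x|; first by rewrite normr0 addr_ge0.
have xI : x \in `[-B, B] by rewrite in_itv/= -ler_norml ltW.
have := H1 x xI; have := H2 x xI; rewrite ler_norml.
have := ler_norm (f c1); have := ler_norm (- f c2); rewrite normrN.
have := normr_ge0 (f c1); have := normr_ge0 (f c2).
by move=> *; apply/andP; split; lra.
Qed.

(* Where psi phi has integral 0 and compact support, the Stein equation
   f' - x f = psi is solved by the compactly supported
   f = phi^-1 \int_(-oo)^x psi phi, so that no tail estimate is needed. *)
Lemma stein_solution : exists (h dh : R -> R) (C : R),
  [/\ 0 <= C, forall x : R, is_derive x 1 h (dh x), forall x, `|dh x| <= C,
      lip C dh & forall x, dh x - x * h x = psi x].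
Proof.
have [C [C0 fC]] := f_bounded.
pose C1 := K * (2 * B) + B * C.
have C10 : 0 <= C1 by rewrite addr_ge0// mulr_ge0 ?mulr_ge0// ltW.
have df x : `|psi x + x * f x| <= C1.
  have [Bx|xB] := leP B `|x|; first by rewrite psiB// f_out// mulr0 addr0 normr0.
  rewrite (le_trans (ler_normD _ _))// lerD ?psi_bound// normrM ler_pM//.
  exact: ltW.
clearbody C1; have fL := lip_of_derive f_derive df; have Bge := ltW B0.
have xf x y : `|x * f x - y * f y| <= (C + B * C1) * `|x - y|.
  have aux u v : `|u| <= B -> `|u * f u - v * f v| <= (C + B * C1) * `|u - v|.
    move=> uB; rewrite (_ : _ - _ = (u - v) * f v + u * (f u - f v)); last by ring.
    rewrite (le_trans (ler_normD _ _))// [leRHS]mulrDl lerD//.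
      by rewrite normrM mulrC ler_wpM2r.
    by rewrite normrM -mulrA ler_pM.
  have [/aux//|/ltW Bx] := leP `|x| B.
  have [yB|/ltW By] := leP `|y| B; first by rewrite distrC [`|x - y|]distrC aux.
  by rewrite !f_out// !mulr0 subrr normr0 mulr_ge0// addr_ge0// mulr_ge0.
exists f, (fun x => psi x + x * f x), (C1 + K + (C + B * C1)); split.
- by rewrite !addr_ge0// mulr_ge0.
- exact: f_derive.
- by move=> x; rewrite (le_trans (df x))// -addrA lerDl !addr_ge0// mulr_ge0.
- move=> x y; rewrite (_ : _ - _ = (psi x - psi y) + (x * f x - y * f y)); last by ring.
  rewrite (le_trans (ler_normD _ _))// [leRHS]mulrDl lerD//.
  by rewrite (le_trans (psiK x y))// ler_wpM2r// lerDr.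
- by move=> x; rewrite addrK.
Qed.

End stein_solution.

(** * Lipschitz cutoff functions and their Gaussian integrals *)

Lemma lip_min {R : realType} (K : R) (f g : R -> R) :
  lip K f -> lip K g -> lip K (fun x => Num.min (f x) (g x)).
Proof.
move=> fK gK x y; have := fK x y; have := gK x y; rewrite !ler_norml.
move: (K * _) => k /andP[? ?] /andP[? ?].
by case: (leP (f x) (g x)); case: (leP (f y) (g y)) => *; apply/andP; split; lra.
Qed.

Lemma lip_cst {R : realType} (K c : R) : 0 <= K -> lip K (fun=> c).
Proof. by move=> K0 x y; rewrite subrr normr0 mulr_ge0. Qed.

Lemma lip_max {R : realType} (K : R) (f g : R -> R) :
  lip K f -> lip K g -> lip K (fun x => Num.max (f x) (g x)).
Proof.
move=> fK gK x y; have := fK x y; have := gK x y; rewrite !ler_norml.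
move: (K * _) => k /andP[? ?] /andP[? ?].
by case: (leP (f x) (g x)); case: (leP (f y) (g y)) => *; apply/andP; split; lra.
Qed.

(** Equal to 1 on [[a, b]], to 0 outside [[a - d, b + d]], and affine in between. *)
Definition trapezoid {R : realType} (a b d x : R) : R :=
  Num.max 0 (Num.min 1 (Num.min ((x - a) / d + 1) ((b - x) / d + 1))).

Section trapezoid.
Context {R : realType} (a b d : R).
Hypothesis d0 : 0 < d.

Lemma lip_trapezoid : lip d^-1 (trapezoid a b d).
Proof.
have k0 : 0 <= d^-1 by rewrite invr_ge0 ltW.
apply: lip_max; first exact: lip_cst.
apply: lip_min; first exact: lip_cst.
apply: lip_min => x y.
  rewrite (_ : _ - _ = d^-1 * (x - y)); last by field; rewrite gt_eqF.
  by rewrite normrM (ger0_norm k0).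
rewrite (_ : _ - _ = d^-1 * (y - x)); last by field; rewrite gt_eqF.
by rewrite normrM (ger0_norm k0) distrC.
Qed.

Lemma trapezoid_ge0 x : 0 <= trapezoid a b d x.
Proof. by rewrite /trapezoid le_max lexx. Qed.

Lemma trapezoid_le1 x : trapezoid a b d x <= 1.
Proof. by rewrite /trapezoid ge_max ler01/= ge_min lexx. Qed.

Lemma trapezoid1 x : a <= x <= b -> trapezoid a b d x = 1.
Proof.
move=> /andP[ax xb]; rewrite /trapezoid; apply/eqP.
rewrite eq_le ge_max ler01 ge_min lexx/= le_max !le_min lexx/=.
by rewrite !lerDr !divr_ge0 ?orbT ?subr_ge0// ltW.
Qed.

Lemma trapezoid_gt x : b + d <= x -> trapezoid a b d x = 0.
Proof.
move=> bx; rewrite /trapezoid; apply/eqP; rewrite eq_le ge_max lexx le_max lexx/=.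
have e u : (u + 1 <= 0) = (u <= - 1) by rewrite -lerBrDr sub0r.
rewrite !ge_min !e !ler_pdivrMr// mulN1r andbT.
by apply/orP; right; apply/orP; right; rewrite lerBlDr -lerBlDl opprK.
Qed.

Lemma trapezoid_lt x : x <= a - d -> trapezoid a b d x = 0.
Proof.
move=> bx; rewrite /trapezoid; apply/eqP; rewrite eq_le ge_max lexx le_max lexx/=.
have e u : (u + 1 <= 0) = (u <= - 1) by rewrite -lerBrDr sub0r.
rewrite !ge_min !e !ler_pdivrMr// mulN1r andbT.
by apply/orP; right; apply/orP; left; rewrite lerBlDr [- d + a]addrC.
Qed.

End trapezoid.

Section cdf_fun.
Context {R : realType} (P : probability (measurableTypeR R) R).

(** A law on the line is the law of the identity, so the limits of [cdf] at the infinities apply to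
    it. *)
Let idTR : measurableTypeR R -> R := idfun.

#[local] HB.instance Definition _ :=
  @isMeasurableFun.Build _ _ _ _ idTR (@measurable_id _ _ setT).

Lemma cdf_fun_cvg1 : fine (P `]-oo, t]%classic) @[t --> +oo] --> (1 : R).
Proof. exact/fine_cvg/(@cvg_cdfy1 _ _ R P idTR). Qed.

Lemma cdf_fun_cvg0 : fine (P `]-oo, t]%classic) @[t --> -oo] --> (0 : R).
Proof. exact/fine_cvg/(@cvg_cdfNy0 _ _ R P idTR). Qed.

End cdf_fun.

Section normal_integral.
Context {R : realType}.
Notation mu := (@lebesgue_measure R).
Notation phi := (@normal_pdf R 0 1).
Notation G t := (\int[mu]_(x in `]-oo, t]) phi x)%R.

Lemma normal_cdf_cvg1 : G t @[t --> +oo] --> (1 : R).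
Proof. exact: (cdf_fun_cvg1 (normal_prob 0 1)). Qed.

Lemma normal_cdf_cvg0 : G t @[t --> -oo] --> (0 : R).
Proof. exact: (cdf_fun_cvg0 (normal_prob 0 1)). Qed.

Lemma integrable_pdf D : measurable D -> mu.-integrable D (EFin \o phi).
Proof.
move=> mD; apply: (@integrableS _ _ _ mu setT) => //.
exact: integrable_normal_pdf.
Qed.

Variables (psi : R -> R) (K : R).
Hypothesis psiK : lip K psi.
Hypothesis psi0 : forall x, 0 <= psi x.
Hypothesis psi1 : forall x, psi x <= 1.

Lemma integrable_psi D : measurable D ->
  mu.-integrable D (EFin \o (fun x => psi x * phi x)).
Proof.
move=> mD; apply: (integrable_mul_pdf mD (lip_continuous psiK) (C := 1)).
by move=> x; rewrite ger0_norm.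
Qed.

Lemma normal_integral_le t : (forall x, t < x -> psi x = 0) ->
  (\int[mu]_x (psi x * phi x))%R <= G t.
Proof.
move=> psit.
have -> : (\int[mu]_x (psi x * phi x))%R =
    (\int[mu]_(x in `]-oo, t]) (psi x * phi x))%R.
  rewrite [RHS]Rintegral_mkcond; apply: eq_Rintegral => x _.
  rewrite patchE; case: ifPn => //; rewrite notin_setE/= in_itv/= => /negP.
  by rewrite -ltNge => /psit ->; rewrite mul0r.
apply: le_Rintegral => //.
- exact: integrable_psi.
- exact: integrable_pdf.
- by move=> x _; rewrite ler_piMl// normal_pdf_ge0.
Qed.

Lemma normal_integral_ge a t : a < t -> (forall x, a < x <= t -> psi x = 1) ->
  G t - G a <= (\int[mu]_x (psi x * phi x))%R.
Proof.
move=> at' psit.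
rewrite (@Rintegral_itvB _ phi -oo%O (BRight t) a) ?bnd_simp//; last first.
  exact: ltW.
  exact: integrable_pdf.
pose h (x : R) : R := (\1_(`]a, t]%classic : set R) x * phi x).
have -> : (\int[mu]_(x in `]a, t]) phi x)%R = (\int[mu]_x h x)%R.
  rewrite Rintegral_mkcond; apply: eq_Rintegral => x _.
  by rewrite patchE /h indicE; case: ifPn => _; rewrite ?mul1r ?mul0r.
apply: le_Rintegral => //.
- have := @integrableMr _ _ _ mu setT measurableT (\1_(`]a, t]%classic : set R)) (EFin \o phi).
  apply => //; last exact: integrable_pdf.
  exists 1; split; first exact: num_real.
  move=> y y1 z _; apply: le_trans (ltW y1).
  by rewrite indicE ger0_norm ?ler0n// lern1 leq_b1.
- exact: integrable_psi.
- move=> x _; rewrite /h ler_wpM2r ?normal_pdf_ge0// indicE.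
  have [|] := boolP (x \in _); last by rewrite psi0.
  by rewrite inE/= in_itv/= => /psit ->.
Qed.

End normal_integral.

(** * From Stein's equation to convergence of distribution functions *)

Lemma div_sqr_le {R : realFieldType} (c e M : R) :
  0 < e -> Num.max 1 (c / e) <= M -> c / M ^+ 2 <= e.
Proof.
move=> e0; rewrite ge_max => /andP[M1 cM].
have M0 : 0 < M by apply: lt_le_trans M1.
rewrite ler_pdivrMr ?exprn_gt0// mulrC -ler_pdivrMr// (le_trans cM)//.
by rewrite expr2 ler_peMl// ltW.
Qed.

Lemma close_to_one {R : realFieldType} (z u v e : R) :
  1 - e <= z -> z <= 1 -> 1 - v <= u -> u <= 1 -> v <= e -> `|z - u| <= e.
Proof. by rewrite ler_norml => *; apply/andP; split; lra. Qed.

Lemma dist_via {R : realFieldType} (z w x e : R) :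
  `|0 - (x - w)| <= e / 2 -> `|z - w| <= e / 4 -> 0 <= e -> `|z - x| <= e.
Proof.
by rewrite !ler_norml => /andP[? ?] /andP[? ?] ?; apply/andP; split; lra.
Qed.

Section stein_method.
Context {R : realType}.
Notation mu := (@lebesgue_measure R).
Notation phi := (@normal_pdf R 0 1).
Notation G t := (\int[mu]_(x in `]-oo, t]) phi x)%R.
Notation N psi := (\int[mu]_x (psi x * phi x))%R.

(** The law of the n-th variable, as a positive normalised linear functional. The inputs are a
    second moment bound, in place of tightness, and the vanishing of the Stein expectations. *)
Variable Ex : nat -> (R -> R) -> R.
Hypothesis ExD : forall n f g, Ex n (fun x => f x + g x) = Ex n f + Ex n g.
Hypothesis ExZ : forall n c f, Ex n (fun x => c * f x) = c * Ex n f.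
Hypothesis le_Ex : forall n f g, (forall x, f x <= g x) -> Ex n f <= Ex n g.
Hypothesis Ex1 : forall n, Ex n (fun=> 1) = 1.
Variable C2 : R.
Hypothesis Ex2 : \forall n \near \oo, Ex n (fun x => x ^+ 2) <= C2.
Hypothesis Ex_stein : forall (h dh : R -> R) (C K : R),
  0 <= C -> (forall x : R, is_derive x 1 h (dh x)) -> (forall x, `|dh x| <= C) ->
  lip C dh -> lip K (fun x => dh x - x * h x) ->
  Ex n (fun x => dh x - x * h x) @[n --> \oo] --> (0 : R).

Let psiM (M : R) := trapezoid (- M) M 1.

Let lip_psiM M : lip 1 (psiM M).
Proof. by have := @lip_trapezoid R (- M) M 1 ltr01; rewrite invr1. Qed.

Let integrable_psiM M : mu.-integrable setT (EFin \o (fun x => psiM M x * phi x)).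
Proof.
apply: (integrable_psi (@lip_psiM M)) => // x.
  exact: trapezoid_ge0.
exact: trapezoid_le1.
Qed.

Let psiM_out M x : M + 1 <= `|x| -> psiM M x = 0.
Proof.
rewrite ler_normr => /orP[h|h]; first by rewrite /psiM trapezoid_gt.
by rewrite /psiM trapezoid_lt//; lra.
Qed.

(** Chebyshev: [1 - x^2 / M^2] lies below the plateau function. *)
Let psiM_Ex (M : R) : 0 < M ->
  \forall n \near \oo, 1 - C2 / M ^+ 2 <= Ex n (psiM M) <= 1.
Proof.
move=> M0; near=> n; apply/andP; split; last first.
  by rewrite -[leRHS](Ex1 n); apply: le_Ex => x; exact: trapezoid_le1.
have : Ex n (fun x => 1 + (- M ^- 2) * x ^+ 2) <= Ex n (psiM M).
  apply: le_Ex => x; have [xM|Mx] := leP `|x| M.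
    rewrite /psiM trapezoid1//; last by rewrite -ler_norml.
    by rewrite gerDl mulNr oppr_le0 mulr_ge0 ?sqr_ge0// invr_ge0 sqr_ge0.
  rewrite /psiM (@le_trans _ _ 0) ?trapezoid_ge0// mulNr subr_le0.
  rewrite ler_pdivlMl ?exprn_gt0// mulr1 -[x ^+ 2]real_normK ?num_real//;
  rewrite ?ler_sqr ?nnegrE ?normr_ge0 ?(ltW Mx) ?(ltW M0)//.
move=> h; apply: le_trans h; rewrite ExD ExZ Ex1 lerD2l mulNr lerN2 [C2 / _]mulrC.
rewrite ler_pM2l; last by rewrite invr_gt0 exprn_gt0.
by near: n.
Unshelve. all: by end_near. Qed.

Let psiM_N (e : R) : 0 < e -> \forall M \near +oo, 1 - e <= N (psiM M) <= 1.
Proof.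
move=> e0; near=> M.
have M0 : 0 < M by near: M; exact: (nbhs_pinfty_gt (num_real _)).
have psi01 x := trapezoid_ge0 (- M) M 1 x.
have psi11 x := trapezoid_le1 (- M) M 1 x.
apply/andP; split; last first.
  have := @integral_normal_pdf R 0 1 => HI.
  rewrite [leRHS](_ : 1 = (\int[mu]_x phi x)%R); last first.
    by rewrite /Rintegral HI.
  apply: le_Rintegral => //.
  - exact: integrable_pdf.
  - by move=> x _; rewrite ler_piMl ?normal_pdf_ge0//; exact: psi11.
have H := normal_integral_ge (@lip_psiM M) psi01 psi11 (a := - M) (t := M).
apply: le_trans (H _ _); last 2 first.
- by rewrite gtrN.
- by move=> x /andP[/ltW Mx xM]; rewrite /psiM trapezoid1// Mx.
have h1 : `|1 - G M| <= e / 2.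
  near: M; apply: cvgr_dist_le; first exact: normal_cdf_cvg1.
  by rewrite divr_gt0.
have h2 : `|0 - G (- M)| <= e / 2.
  near: M.
  have := @normal_cdf_cvg0 R; rewrite cvgNy_compNP => /cvgr_dist_le; apply.
  by rewrite divr_gt0.
move: h1 h2; rewrite !ler_norml => /andP[_ h1] /andP[h2 _]; lra.
Unshelve. all: by end_near. Qed.

(** Subtract the multiple of a wide plateau that makes the Gaussian integral vanish and apply
    Stein's equation to the difference. Both the Gaussian and the n-th expectation of the plateau
    are close to 1, so the correction is nearly the same constant on both sides. *)
Lemma stein_compact (psi : R -> R) (K B : R) : lip K psi -> 0 <= K -> 0 < B ->
  (forall x, B <= `|x| -> psi x = 0) ->
  Ex n psi @[n --> \oo] --> N psi.
Proof.
move=> psiK K0 B0 psiB; apply/cvgrPdist_le => /= e e0.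
pose D := 2 * `|N psi| + 1.
have D0 : 0 < D by rewrite ltr_wpDl// mulr_ge0.
pose eta := Num.min (1 / 2) (e / 4 / D).
have eta0 : 0 < eta by rewrite lt_min; apply/andP; split; rewrite !divr_gt0.
near (pinfty_nbhs R) => M.
have M0 : 0 < M by near: M; exact: (nbhs_pinfty_gt (num_real _)).
have MB : B <= M + 1.
  have h : B <= M by near: M; exact: (nbhs_pinfty_ge (num_real _)).
  by rewrite (le_trans h)// lerDl.
have CM : C2 / M ^+ 2 <= eta.
  have h : Num.max 1 (C2 / eta) <= M by near: M; exact: (nbhs_pinfty_ge (num_real _)).
  exact: div_sqr_le.
have /andP[NM1 NM2] : 1 - eta <= N (psiM M) <= 1 by near: M; exact: psiM_N.
have NM0 : 1 / 2 <= N (psiM M).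
  have : eta <= 1 / 2 by rewrite /eta ge_min lexx.
  by move: NM1; move: (N _) => z ? ?; lra.
have etaD : eta * D <= e / 4 by rewrite -ler_pdivlMr// /eta ge_min lexx orbT.
pose kap := N psi / N (psiM M).
have kapE : kap * N (psiM M) = N psi.
  by rewrite /kap mulfVK// gt_eqF// (lt_le_trans _ NM0).
have kapD : `|kap| <= D.
  have NM00 : 0 < N (psiM M) by apply: lt_le_trans NM0.
  rewrite /kap normrM normfV (gtr0_norm NM00).
  rewrite ler_pdivrMr//.
  rewrite (@le_trans _ _ (D * (1 / 2)))//; last by rewrite ler_wpM2l// ltW.
  by rewrite mul1r ler_pdivlMr// /D mulrC lerDl.
have psiC : integrable mu setT (EFin \o (fun x => psi x * phi x)).
  apply: (integrable_mul_pdf measurableT (lip_continuous psiK)).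
  exact: (psi_bound psiK psiB B0 K0).
pose g x := psi x + (- kap) * psiM M x.
have gK : lip (K + `|kap|) g.
  move=> x y; rewrite (_ : _ - _ = (psi x - psi y) + (- kap) * (psiM M x - psiM M y)); last by rewrite /g; ring.
  rewrite (le_trans (ler_normD _ _))// mulrDl lerD// normrM normrN ler_wpM2l//.
  by have := @lip_psiM M x y; rewrite mul1r.
have gB x : M + 1 <= `|x| -> g x = 0.
  by move=> Mx; rewrite /g psiB ?(le_trans MB)// psiM_out// mulr0 addr0.
have g0 : N g = 0.
  rewrite (_ : (fun x => _) = fun x => psi x * phi x - kap * (psiM M x * phi x)); last first.
    by apply/funext => x; rewrite /g; ring.
  rewrite RintegralB//; last first.
    exact: (integrableZl measurableT kap (integrable_psiM M)).
  rewrite RintegralZl ?kapE ?subrr//; exact: integrable_psiM.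
have M1 : 0 < M + 1 by lra.
have K1 : 0 <= K + `|kap| by rewrite addr_ge0.
have [h [dh [C [C0 hdh dhC dhL hE]]]] := stein_solution gK gB M1 K1 g0.
have gL : lip (K + `|kap|) (fun x => dh x - x * h x) by move=> x y; rewrite !hE; exact: gK.
have := Ex_stein C0 hdh dhC dhL gL.
rewrite (_ : (fun x => _) = g); last by apply/funext => x; rewrite hE.
move=> /cvgrPdist_le Exg.
near=> n.
have : `|0 - Ex n g| <= e / 2 by near: n; apply: Exg; rewrite divr_gt0.
rewrite /g ExD ExZ.
have /andP[E1 E2] : 1 - C2 / M ^+ 2 <= Ex n (psiM M) <= 1 by near: n; exact: psiM_Ex.
have kE : `|kap * (N (psiM M) - Ex n (psiM M))| <= e / 4.
  rewrite normrM (le_trans _ etaD)// mulrC ler_pM//.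
  exact: close_to_one NM1 NM2 E1 E2 CM.
move: kE; rewrite mulrBr kapE mulNr => k1 k2.
exact: dist_via k2 k1 (ltW e0).
Unshelve. all: by end_near. Qed.

(** Sandwich the indicator of the half-line between trapezoids of compact support. The part below
    [- M], which no such function dominates, is covered by adding [x^2 / M^2] above and subtracting
    [G (- M)] below. *)
Theorem stein_cdf (t : R) : {for t, continuous (fun s : R => G s)} ->
  Ex n (fun x => (x <= t)%R%:R) @[n --> \oo] --> G t.
Proof.
move=> Gt; apply/cvgrPdist_le => /= e e0.
have e4 : 0 < e / 4 by rewrite divr_gt0.
have /cvgrPdist_le/(_ _ e4)/nbhs_ballP[d /= d0 Gd] : (fun s : R => G s) @ t --> G t.
  exact: Gt.
have d20 : 0 < d / 2 by rewrite divr_gt0.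
have Gd1 : `|G t - G (t + d / 2)| <= e / 4.
  apply: Gd; rewrite /ball/= opprD addNKr normrN gtr0_norm//; lra.
have Gd2 : `|G t - G (t - d / 2)| <= e / 4.
  apply: Gd; rewrite /ball/= opprB addrC subrK gtr0_norm//; lra.
near (pinfty_nbhs R) => M.
have M0 : 0 < M by near: M; exact: (nbhs_pinfty_gt (num_real _)).
have Mt : - M < t - d / 2.
  by rewrite ltrNl; near: M; exact: (nbhs_pinfty_gt (num_real _)).
have CM : C2 / M ^+ 2 <= e / 4.
  have h : Num.max 1 (C2 / (e / 4)) <= M by near: M; exact: (nbhs_pinfty_ge (num_real _)).
  exact: div_sqr_le.
have GM : `|0 - G (- M)| <= e / 4.
  near: M; have := @normal_cdf_cvg0 R; rewrite cvgNy_compNP => /cvgr_dist_le; apply.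
  by rewrite divr_gt0.
pose up := trapezoid (- M) t (d / 2).
pose lo := trapezoid (- M) (t - d / 2) (d / 2).
have dV : 0 <= (d / 2)^-1 by rewrite invr_ge0 ltW.
have lipup : lip (d / 2)^-1 up by exact: lip_trapezoid.
have liplo : lip (d / 2)^-1 lo by exact: lip_trapezoid.
pose B := M + `|t| + d.
have B0 : 0 < B by rewrite /B ltr_wpDl// addr_ge0// ltW.
have tN := ler_norm t; have tN' := ler_norm (- t); rewrite normrN in tN'.
have upB x : B <= `|x| -> up x = 0.
  rewrite ler_normr /B => /orP[h|h]; first by apply: trapezoid_gt => //; lra.
  by apply: trapezoid_lt => //; lra.
have loB x : B <= `|x| -> lo x = 0.
  rewrite ler_normr /B => /orP[h|h]; first by apply: trapezoid_gt => //; lra.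
  by apply: trapezoid_lt => //; lra.
have Exup := stein_compact lipup dV B0 upB.
have Exlo := stein_compact liplo dV B0 loB.
have Nup : N up <= G (t + d / 2).
  apply: (normal_integral_le lipup).
  - by move=> x; exact: trapezoid_ge0.
  - by move=> x; exact: trapezoid_le1.
  - by move=> x tx; apply: trapezoid_gt => //; exact: ltW.
have Nlo : G (t - d / 2) - G (- M) <= N lo.
  apply: (normal_integral_ge liplo) => //.
  - by move=> x; exact: trapezoid_ge0.
  - by move=> x; exact: trapezoid_le1.
  - by move=> x /andP[/ltW Mx xt]; apply: trapezoid1 => //; apply/andP.
near=> n.
have H1 : `|N up - Ex n up| <= e / 4 by near: n; move/cvgrPdist_le : Exup; exact.
have H2 : `|N lo - Ex n lo| <= e / 4 by near: n; move/cvgrPdist_le : Exlo; exact.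
have Ele : Ex n (fun x => (x <= t)%R%:R) <= Ex n (fun x => up x + M ^- 2 * x ^+ 2).
  apply: le_Ex => x; have [xt|tx] := leP x t; last first.
    by rewrite addr_ge0 ?trapezoid_ge0// mulr_ge0 ?sqr_ge0// invr_ge0 sqr_ge0.
  have [xM|Mx] := leP (- M) x.
    rewrite /up trapezoid1 ?xM ?xt// lerDl mulr_ge0 ?sqr_ge0// invr_ge0 sqr_ge0//.
  rewrite (@le_trans _ _ (M ^- 2 * x ^+ 2))//; last first.
    by rewrite lerDr trapezoid_ge0.
  rewrite ler_pdivlMl ?exprn_gt0// mulr1 -(sqrrN x) ler_sqr ?nnegrE ?(ltW M0)//.
    by rewrite lerNr ltW.
  by rewrite oppr_ge0 (le_trans (ltW Mx))// oppr_le0 ltW.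
have Ege : Ex n lo <= Ex n (fun x => (x <= t)%R%:R).
  apply: le_Ex => x; have [xt|tx] := leP x t; first exact: trapezoid_le1.
  by rewrite /lo trapezoid_gt// subrK ltW.
move: Ele; rewrite ExD ExZ => Ele.
have E2 : M ^- 2 * Ex n (fun x => x ^+ 2) <= C2 / M ^+ 2.
  by rewrite mulrC ler_pM2r ?invr_gt0 ?exprn_gt0//; near: n.
move: H1 H2 Gd1 Gd2 GM Ele Ege Nup Nlo; rewrite !ler_norml.
move: (M ^- 2 * _) (C2 / _) E2 CM => z1 z2 E2 CM.
move: (G t) (G (t + _)) (G (t - _)) (G (- M)) (Ex n _) (Ex n _) (Ex n _) (N _) (N _).
move=> ? ? ? ? ? ? ? ? ? /andP[? ?] /andP[? ?] /andP[? ?] /andP[? ?] /andP[? ?] *.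
by apply/andP; split; lra.
Unshelve. all: by end_near. Qed.

End stein_method.

(** * The law of a random graph on an arbitrary probability space *)

Lemma in_bigsetI (T : Type) (I : finType) (Q : pred I) (F : I -> set T) (x : T) :
  (\big[setI/setT]_(i | Q i) F i) x <-> forall i, Q i -> F i x.
Proof.
have H (s : seq I) : (\big[setI/setT]_(i <- s | Q i) F i) x <->
    forall i, i \in s -> Q i -> F i x.
  elim: s => [|j s IH]; first by rewrite big_nil.
  rewrite big_cons; case: ifPn => [Qj|Qj].
    split=> [[Fj /IH Fs] i|Fs].
      by rewrite inE => /predU1P[->//|]; exact: Fs.
    by split; [apply: Fs => //; rewrite mem_head|apply/IH => i si; apply: Fs; rewrite inE si orbT].
  split=> [/IH Fs i|Fs].
    by rewrite inE => /predU1P[->|]; [rewrite (negbTE Qj)|exact: Fs].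
  by apply/IH => i si; apply: Fs; rewrite inE si orbT.
by rewrite H; split=> Fs i => [|_]; apply: Fs; rewrite mem_index_enum.
Qed.

Section law_of_random_graph.
Context {R : realType} {d : measure_display} {T : measurableType d} (P : probability T R).
Context {n : nat} (A : 'I_n -> 'I_n -> {RV P >-> bool}) (mu : 'M[R]_n).
Hypothesis hA : random_graph P A mu.

Notation cfg := {ffun 'I_n * 'I_n -> bool}.

Definition graph_config (x : T) : cfg := [ffun e => A e.1 e.2 x].

(** The entries below the diagonal copy those above, so the full configuration does not have a
    product law; masking them leaves independent coordinates. *)
Let up (x : T) : cfg := [ffun e => upper e && A e.1 e.2 x].

Let measurable_A i j (c : bool) : measurable (A i j @^-1` [set c]).
Proof. exact: measurable_funPTI. Qed.

Let J : {set 'I_n * 'I_n} := [set e | upper e].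
Let q (e : 'I_n * 'I_n) : R := mu e.1 e.2.

Let upE (b : cfg) : (forall e, ~~ upper e -> b e = false) ->
  up @^-1` [set b] = \big[setI/setT]_(e in J) (A e.1 e.2 @^-1` [set b e]).
Proof.
move=> ub; apply/seteqP; split=> x /=.
  by move=> <-; apply/in_bigsetI => e; rewrite inE /= ffunE => ->.
move=> /in_bigsetI H; suff : up x = b by []; apply/ffunP => e; rewrite ffunE.
have [ue|ue] := boolP (upper e); last by rewrite ub.
by apply: H; rewrite inE.
Qed.

Let up0 (b : cfg) e : ~~ upper e -> b e -> up @^-1` [set b] = set0.
Proof.
move=> ue be; rewrite -subset0 => x /= ub; have := congr1 (fun f : cfg => f e) ub.
by rewrite ffunE (negbTE ue) be.
Qed.

Let upP (b : cfg) : (exists2 e, ~~ upper e & b e) \/ (forall e, ~~ upper e -> b e = false).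
Proof.
have [H|H] := boolP [forall e, ~~ upper e ==> ~~ b e].
  by right=> e ue; move/forallP: H => /(_ e); rewrite ue => /negbTE.
by move: H; rewrite negb_forall => /existsP[e]; rewrite negb_imply negbK => /andP[]; left; exists e.
Qed.

Let measurable_up b : measurable (up @^-1` [set b]).
Proof.
have [[e ue be]|ub] := upP b; first by rewrite (up0 ue be).
by rewrite upE//; apply: bigsetI_measurable => e _; exact: measurable_A.
Qed.

Let P_up b : P (up @^-1` [set b]) =
  (\prod_e (if upper e then if b e then q e else 1 - q e else (~~ b e)%:R))%:E.
Proof.
have [[e ue be]|ub] := upP b.
  by rewrite (up0 ue be) measure0 (bigD1 e)//= (negbTE ue) be mul0r.
rewrite upE// (adj_indep hA) => [|e|e _]; [|by rewrite inE|by []].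
congr (_%:E); rewrite [LHS]big_mkcond/=; apply: eq_bigr => e _; rewrite inE/=.
case: ifPn => ue; last by rewrite ub.
have PA : P (A e.1 e.2 @^-1` [set true]) = (q e)%:E by rewrite -(adj_prob hA ue).
case: (b e); first by rewrite PA.
have -> : A e.1 e.2 @^-1` [set false] = ~` (A e.1 e.2 @^-1` [set true]).
  by apply/seteqP; split=> x /=; case: (A _ _ x).
by rewrite probability_setC// PA.
Qed.

(** A function of the upper entries is a finite combination of indicators of the values of [up],
    whose probabilities are the weights in [Ex_dep]. *)
Lemma expectation_graph (F : cfg -> R) : dep upper F ->
  ('E_P[fun x => F (graph_config x)] = (Ex q F)%:E)%E.
Proof.
move=> dF; rewrite (Ex_dep _ dF) unlock.
have E x : (F (graph_config x))%:E = (\sum_b (F b)%:E * (\1_(up @^-1` [set b]) x)%:E)%E.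
  have -> : F (graph_config x) = F (up x) by apply: dF => e ue; rewrite !ffunE ue.
  rewrite (bigD1 (up x))//= indicE mem_set// mule1 big1 ?adde0// => b bx.
  by rewrite indicE memNset ?mule0//= => xb; rewrite xb eqxx in bx.
under eq_integral do rewrite E.
rewrite integral_sum//; last by move=> b; apply: integrableZl => //; exact: integrable_indic.
rewrite -sumEFin; apply: eq_bigr => b _.
rewrite integralZl//; last exact: integrable_indic.
by rewrite integral_indic// setIT EFinM; congr (_ * _)%E; exact: P_up.
Qed.

Lemma probability_graph (F : cfg -> R) (B : set R) : dep upper F ->
  measurable [set x | B (F (graph_config x))] ->
  P [set x | B (F (graph_config x))] = (Ex q (fun a => (F a \in B)%:R))%:E.
Proof.
move=> dF mB; rewrite -expectation_graph; last by move=> a b ab; rewrite (dF a b).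
rewrite -[in LHS](expectation_indic P mB); congr (expectation _ _).
Qed.

Lemma weighted_trianglesE x : weighted_triangles P A x = wtri (graph_config x).
Proof.
have adjE i j : adj (graph_config x) i j = A i j x.
  rewrite /adj /edge; case: (ltngtP i j) => [ij|ij|/val_inj ->]; rewrite ?ffunE /=.
  - by rewrite -(inj_eq val_inj)/= ltn_eqF.
  - by rewrite -(inj_eq val_inj)/= gtn_eqF//= (adj_sym hA).
  - by rewrite eqxx (adj_irr hA).
have dgE i : dg i [::] (graph_config x) = deg A i x.
  by apply: eq_bigr => j _; rewrite adjE.
rewrite /wtri triple_sum_ord.
- rewrite mulrA mulVf ?pnatr_eq0// mul1r; apply: eq_bigr => i _; apply: eq_bigr => j _.
  apply: eq_bigr => k _; rewrite /tri !adjE !dgE -!natrM; congr (_%:R / _).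
  by case: (A i j x); case: (A j k x); case: (A k i x).
- exact: tri_swap12.
- exact: tri_swap23.
- exact: tri_diag.
Qed.

Lemma cdf_standardized_triangles v t :
  @cdf _ _ _ P (standardized_triangles P A v) t =
  (Ex q (fun a => ((wtri a - Ex q wtri) / v <= t)%R%:R))%:E.
Proof.
have dw := dep_upper_wtri (R := R) (n := n).
pose F (a : cfg) := (wtri a - Ex q wtri) / v.
have XE x : standardized_triangles P A v x = F (graph_config x).
  rewrite /standardized_triangles /F weighted_trianglesE; congr ((_ - _) / _).
  rewrite (_ : weighted_triangles P A = fun x => wtri (graph_config x)).
    by rewrite expectation_graph.
  by apply/funext => y; rewrite weighted_trianglesE.
rewrite /cdf /distribution /pushforward.
rewrite (_ : _ @^-1` _ = [set x | `]-oo, t]%classic (F (graph_config x))]); last first.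
  by apply/seteqP; split=> x /=; rewrite XE.
rewrite probability_graph.
- by congr (_%:E); apply: eq_Ex => a; rewrite /F mem_setE in_itv.
- by move=> a b ab; rewrite /F (dw a b).
- rewrite (_ : [set x | _] = standardized_triangles P A v @^-1` `]-oo, t]); last first.
    by apply/seteqP; split=> x /=; rewrite XE.
  exact: measurable_funPTI.
Qed.

End law_of_random_graph.

(** * Passage to the limit along a sequence of rank-1 graphs *)

Lemma inv_natr_cvg0 {R : realType} : (n%:R : R)^-1 @[n --> \oo] --> (0 : R).
Proof.
apply/gtr0_cvgV0; last exact: cvgr_idn.
by near=> n; rewrite ltr0n; near: n; exact: nbhs_infty_gt.
Unshelve. all: by end_near. Qed.

Lemma equiv_of_ratio {R : realType} (f g : nat -> R) :
  (\forall n \near \oo, 0 < g n) -> f n / g n @[n --> \oo] --> (1 : R) -> f ~_\oo g.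
Proof.
move=> g0 fg; apply/eqaddoP => e e0; near=> n.
have gn : 0 < g n by near: n.
have : `|1 - f n / g n| <= e by near: n; move/cvgrPdist_le : fg; exact.
rewrite distrC => h; rewrite (_ : (f - g) n = (f n / g n - 1) * g n).
  by rewrite normrM; apply: ler_wpM2r.
by rewrite mulrBl mul1r divfK ?gt_eqF.
Unshelve. all: by end_near. Qed.

Lemma taylor_of_lip {R : realType} (h dh : R -> R) (C : R) : 0 <= C ->
  (forall x : R, is_derive x 1 h (dh x)) -> lip C dh ->
  forall x y, `|h y - h x - (y - x) * dh x| <= C * (y - x) ^+ 2.
Proof.
move=> C0 hdh dhC.
have ch (a b : R) : {within `[a, b], continuous h}.
  by apply: derivable_within_continuous => z _; have [] := hdh z.
have main (x y z : R) : `|z - x| <= `|y - x| -> h y - h x = dh z * (y - x) ->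
    `|h y - h x - (y - x) * dh x| <= C * (y - x) ^+ 2.
  move=> zx ->; rewrite [X in _ - X]mulrC -mulrBl normrM -[(y - x) ^+ 2]real_normK ?num_real//.
  rewrite expr2 mulrA; apply: ler_wpM2r => //; apply: (le_trans (dhC _ _)).
  exact: ler_wpM2l.
move=> x y; have [xy|yx|->] := ltgtP x y.
- have [z zI zE] := MVT xy (fun t _ => hdh t) (ch x y).
  move: zI; rewrite in_itv/= => /andP[xz zy]; apply: (main x y z) => //.
  by rewrite !ger0_norm ?subr_ge0 ?lerD2r// ltW.
- have [z zI zE] := MVT yx (fun t _ => hdh t) (ch y x).
  move: zI; rewrite in_itv/= => /andP[yz zx]; apply: (main x y z) => //.
    by rewrite !ler0_norm ?subr_le0 ?lerN2 ?lerD2r// ltW.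
  by rewrite -[LHS]opprB zE -mulrN opprB.
- by rewrite !subrr mul0r subr0 normr0 expr0n mulr0.
Qed.

Section rank1_sequence.
Context {R : realType} (p : nat -> R) (w : forall n, 'I_n -> R) (beta : R) (mu : forall n, 'M[R]_n).
Hypothesis hp : forall n, (0 < n)%N -> 0 < p n <= 1.
Hypothesis hb : 0 < beta.
Hypothesis hw : forall n i, beta <= @w n i <= 1.
Hypothesis p_cvg : p n @[n --> \oo] --> (0 : R).
Hypothesis L_cvg : (n%:R * p n)^-1 @[n --> \oo] --> (0 : R).
Hypothesis muE : forall n i j, mu n i j = rmu (p n) (@w n) i j.

Notation c n := (n%:R ^+ 3 / (6 * (\sum_i @w n i) ^+ 6 * p n ^+ 3)).
Notation Ex n := (Ex (rq (p n) (@w n))).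
Notation EV n := (Ex n (vsum (p n) (@w n))).

Let n_gt : \forall n \near \oo, (0 < n)%N.
Proof. exact: nbhs_infty_gt. Qed.

Let hn : \forall n \near \oo, 12 <= beta * n%:R.
Proof.
near=> n; rewrite -ler_pdivrMl//; near: n; exact: nbhs_infty_ger.
Unshelve. all: by end_near. Qed.

Let lower_cvg : (1 - p n) ^+ 3 * (1 - 3 / n%:R) @[n --> \oo] --> (1 : R).
Proof.
rewrite -[X in _ --> X](_ : (1 - 0) ^+ 3 * (1 - 3 * 0) = 1); last by ring.
apply: cvgM; last by apply: cvgB; [exact: cvg_cst|apply: cvgM; [exact: cvg_cst|exact: inv_natr_cvg0]].
have h : (1 - p n) @[n --> \oo] --> (1 - 0 : R) by apply: cvgB => //; exact: cvg_cst.
by do 2!apply: cvgM => //.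
Qed.

Lemma v_ratio_cvg : v_sq (mu n) / c n @[n --> \oo] --> (1 : R).
Proof.
apply: (squeeze_cvgr (f := fun n => (1 - p n) ^+ 3 * (1 - 3 / n%:R))
   (h := fun n => 1 + 126 / (beta * n%:R) + 6534 * p n ^+ 2 / n%:R)); first last.
- rewrite -[X in _ --> X](_ : 1 + 126 * beta^-1 * 0 + 6534 * (0 * 0) * 0 = 1); last by ring.
  apply: cvgD; first apply: cvgD; first exact: cvg_cst.
    under eq_fun do rewrite invfM mulrA.
    by apply: cvgM; [exact: cvg_cst|exact: inv_natr_cvg0].
  apply: cvgM; last exact: inv_natr_cvg0.
  by apply: cvgM; [exact: cvg_cst|exact: cvgM].
- exact: lower_cvg.
near=> n; have h0 : 0 < p n <= 1 by apply: hp; near: n.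
have h12 : 12 <= beta * n%:R by near: n; exact: hn.
exact: (v_bounds h0 hb (hw (n := n)) h12 (mu := mu n) (muE (n := n))).
Unshelve. all: by end_near. Qed.

Lemma Ex_vsum_ratio_cvg : EV n / c n @[n --> \oo] --> (1 : R).
Proof.
apply: (squeeze_cvgr (f := fun n => (1 - p n) ^+ 3 * (1 - 3 / n%:R)) (h := fun n => 1)).
- near=> n; have h0 : 0 < p n <= 1 by apply: hp; near: n.
  have h12 : 12 <= beta * n%:R by near: n; exact: hn.
  exact: (Ex_vsum_ratio h0 hb (hw (n := n)) h12).
- exact: lower_cvg.
- exact: cvg_cst.
Unshelve. all: by end_near. Qed.

Let scale_pos : \forall n \near \oo, 0 < c n.
Proof.
near=> n; have h0 : 0 < p n <= 1 by apply: hp; near: n.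
have h12 : 12 <= beta * n%:R by near: n; exact: hn.
exact: (scale_gt0 h0 hb (hw (n := n)) h12).
Unshelve. all: by end_near. Qed.

Lemma v_sq_equiv : (fun n => v_sq (mu n)) ~_\oo (fun n => c n).
Proof. exact: equiv_of_ratio scale_pos v_ratio_cvg. Qed.

Let s n := (Num.sqrt (v_sq (mu n)))^-1.
Notation Xn n a := (s n * (wtri a - Ex n wtri)).
Notation g n := (p n + (@avgd R n (p n))^-1).
Notation u n := (s n ^+ 2 * EV n).
Notation kap := (kap beta).

Let q01 n e : 0 <= rq (p n) (@w n) e <= 1.
Proof.
(* For [n = 0], where [hp] says nothing about [p], there are no pairs of vertices. *)
case: n e => [[[]//]|n] e; apply: (rq01 _ hb (hw (n := _))) => //; exact: hp.
Qed.

Let scale_n : \forall n \near \oo, 0 < v_sq (mu n) /\ s n ^+ 2 <= 12 * avgd (n := n) (p n) ^+ 3.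
Proof.
near=> n; have h0 : 0 < p n <= 1 by apply: hp; near: n.
have h12 : 12 <= beta * n%:R by near: n; exact: hn.
have h2 : 2^-1 <= v_sq (mu n) / c n.
  near: n; apply: (cvgr_ge _ v_ratio_cvg); rewrite invf_lt1//; exact: ltr1n.
have [v0 vL] := inv_scale_le h0 hb (hw (n := n)) h12 h2.
by split=> //; rewrite exprVn sqr_sqrtr// ltW.
Unshelve. all: by end_near. Qed.

Let L_ge1 : \forall n \near \oo, 1 <= avgd (n := n) (p n).
Proof.
near=> n; have /andP[h0 _] : 0 < p n <= 1 by apply: hp; near: n.
have L0 : 0 < avgd (n := n) (p n) by rewrite mulr_gt0// ltr0n; near: n.
rewrite -(invf_le1 L0); near: n; exact: (cvgr_le _ L_cvg).
Unshelve. all: by end_near. Qed.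

Let u_cvg : u n @[n --> \oo] --> (1 : R).
Proof.
have H : (EV n / c n) / (v_sq (mu n) / c n) @[n --> \oo] --> (1 / 1 : R).
  apply: cvgM; first exact: Ex_vsum_ratio_cvg.
  by apply: cvgV; [exact: oner_neq0|exact: v_ratio_cvg].
rewrite divr1 in H; apply: cvg_trans H; apply: near_eq_cvg; near=> n.
have c0 : 0 < c n by near: n.
have [v0 _] : 0 < v_sq (mu n) /\ s n ^+ 2 <= 12 * avgd (n := n) (p n) ^+ 3 by near: n.
rewrite exprVn sqr_sqrtr; last exact: ltW.
by move: (c n) c0 (v_sq _) v0 (EV n) => x x0 y y0 z; field; rewrite !gt_eqF.
Unshelve. all: by end_near. Qed.

Let g_cvg : g n @[n --> \oo] --> (0 : R).
Proof. by rewrite -[X in _ --> X]addr0; exact: cvgD. Qed.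

Let second_moment : \forall n \near \oo, Ex n (fun a => Xn n a ^+ 2) <= 3.
Proof.
have H : 2 * u n + 24 * 3600 * kap ^+ 8 * g n @[n --> \oo] --> (2 * 1 + 24 * 3600 * kap ^+ 8 * 0 : R).
  by apply: cvgD; apply: cvgM => //; exact: cvg_cst.
near=> n; have h0 : 0 < p n <= 1 by apply: hp; near: n.
have h12 : 12 <= beta * n%:R by near: n; exact: hn.
have [v0 sL] : 0 < v_sq (mu n) /\ s n ^+ 2 <= 12 * avgd (n := n) (p n) ^+ 3 by near: n.
have L1 : 1 <= avgd (n := n) (p n) by near: n.
have s0 : 0 <= s n by rewrite invr_ge0 sqrtr_ge0.
apply: (le_trans (second_moment_bound h0 hb (hw (n := n)) h12 L1 sL)).
near: n; apply: (cvgr_le _ H); rewrite mulr0 addr0 mulr1; exact: ltr_nat.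
Unshelve. all: by end_near. Qed.

Let stein_limit (h dh : R -> R) (C K : R) :
  0 <= C -> (forall x : R, is_derive x 1 h (dh x)) -> (forall x, `|dh x| <= C) ->
  lip C dh -> lip K (fun x => dh x - x * h x) ->
  Ex n (fun a => dh (Xn n a) - Xn n a * h (Xn n a)) @[n --> \oo] --> (0 : R).
Proof.
move=> C0 hdh dhC dhL hK.
have hK' x y : `|(dh x - x * h x) - (dh y - y * h y)| <= `|K| * `|x - y|.
  by apply: (le_trans (hK x y)); apply: ler_wpM2r => //; exact: ler_norm.
apply/cvgrPdist_le => e e0.
pose D := C * (432 * kap ^+ 12) + C * (144 * kap ^+ 12) + `|K| * (6 * 3600 * kap ^+ 8).
(* With [d] fixed, all terms of the bound vanish in the limit except [(C + C + |K|) * (d / 2)]; this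
   choice keeps that one below [e / 2]. *)
pose d := e / (C + C + `|K| + 1).
have S0 : 0 < C + C + `|K| + 1 by rewrite ltr_wpDl// !addr_ge0.
have d0 : 0 < d by rewrite divr_gt0.
have H : C * `|1 - u n| + (C + C * u n + `|K|) * (d / 2) + D / d * g n @[n --> \oo] -->
    (C * `|1 - 1| + (C + C * 1 + `|K|) * (d / 2) + D / d * 0 : R).
  apply: cvgD; last by apply: cvgM => //; exact: cvg_cst.
  apply: cvgD.
    apply: cvgM; first exact: cvg_cst.
    by apply: cvg_norm; apply: cvgB => //; exact: cvg_cst.
  apply: cvgM; last exact: cvg_cst.
  apply: cvgD; last exact: cvg_cst.
  by apply: cvgD; [exact: cvg_cst|apply: cvgM => //; exact: cvg_cst].
near=> n; have h0 : 0 < p n <= 1 by apply: hp; near: n.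
have h12 : 12 <= beta * n%:R by near: n; exact: hn.
have [v0 sL] : 0 < v_sq (mu n) /\ s n ^+ 2 <= 12 * avgd (n := n) (p n) ^+ 3 by near: n.
have L1 : 1 <= avgd (n := n) (p n) by near: n.
have s0 : 0 <= s n by rewrite invr_ge0 sqrtr_ge0.
rewrite sub0r normrN.
apply: (le_trans (stein_error_bound h0 hb (hw (n := n)) h12 L1 s0 sL C0 (normr_ge0 K)
  dhC (taylor_of_lip C0 hdh dhL) hK' d0)).
near: n; apply: (cvgr_le _ H).
rewrite subrr normr0 !mulr0 addr0 add0r mulr1.
have -> : (C + C + `|K|) * (d / 2) = (C + C + `|K|) / (C + C + `|K| + 1) * (e / 2).
  by rewrite /d; field; rewrite gt_eqF.
apply: (@le_lt_trans _ _ (1 * (e / 2))); last by rewrite mul1r ltr_pdivrMr// ltr_pMr// ltr1n.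
by apply: ler_wpM2r; [rewrite divr_ge0// ltW|rewrite ler_pdivrMr// mul1r lerDl].
Unshelve. all: by end_near. Qed.

Lemma rank1_clt (t : R) :
  {for t, continuous (fun s : R => (\int[lebesgue_measure]_(x in `]-oo, s]) normal_pdf 0 1 x)%R)} ->
  Ex n (fun a => ((wtri a - Ex n wtri) / Num.sqrt (v_sq (mu n)) <= t)%R%:R) @[n --> \oo] -->
  (\int[lebesgue_measure]_(x in `]-oo, t]) normal_pdf 0 1 x)%R.
Proof.
move=> tc.
have := @stein_cdf R (fun n f => Ex n (fun a => f (Xn n a))) _ _ _ _ 3 second_moment stein_limit t tc.
have E n : Ex n (fun a => (Xn n a <= t)%R%:R) =
   Ex n (fun a => ((wtri a - Ex n wtri) / Num.sqrt (v_sq (mu n)) <= t)%R%:R).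
  by apply: eq_Ex => a; rewrite mulrC.
under eq_fun do rewrite E.
apply.
- by move=> n f g; rewrite ExD.
- by move=> n k f; rewrite ExZ.
- by move=> n f g fg; exact: (@le_Ex R _ _ (q01 (n := n)) _ _ (fun a => fg _)).
- by move=> n; rewrite Ex_cst.
Qed.

End rank1_sequence.

(** * The sequence [p_n = n^-alpha] and the theorem *)

Lemma powRN_natr_cvg0 {R : realType} (a : R) : 0 < a -> n%:R `^ (- a) @[n --> \oo] --> (0 : R).
Proof.
move=> a0; apply/cvgrPdist_le => e e0; near=> n.
have n0 : 0 < n%:R :> R by rewrite ltr0n; near: n; exact: nbhs_infty_gt.
rewrite sub0r normrN ger0_norm ?powR_ge0// powRN -[e]invrK lef_pV2 ?posrE ?powR_gt0 ?invr_gt0//.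
have -> : e^-1 = (e `^ (- a^-1)) `^ a.
  by rewrite -powRrM mulNr mulVf ?gt_eqF// powRN powRr1// ltW.
apply: ge0_ler_powR; rewrite ?nnegrE ?powR_ge0 ?ltW//.
by near: n; exact: nbhs_infty_gtr.
Unshelve. all: by end_near. Qed.

Lemma natr_mul_powRN {R : realType} (a : R) (n : nat) : (0 < n)%N ->
  n%:R * n%:R `^ (- a) = n%:R `^ (1 - a) :> R.
Proof.
move=> n0; rewrite powRD ?powRr1// pnatr_eq0 -lt0n n0.
by rewrite implybT.
Qed.

Section standard_sequences.
Context {R : realType} (alpha : R).
Hypothesis halpha : 0 < alpha < 1.
Let a0 : 0 < alpha. Proof. by case/andP: halpha. Qed.

Lemma p_bounds n : (0 < n)%N -> 0 < p_ alpha n <= 1.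
Proof.
move=> n0; have n1 : 0 < n%:R :> R by rewrite ltr0n.
rewrite /p_ powR_gt0//= powRN invf_le1 ?powR_gt0//.
rewrite [leLHS](_ : _ = 1 `^ alpha); last by rewrite powR1.
by apply: ge0_ler_powR; rewrite ?nnegrE ?ler1n ?ltW.
Qed.

Lemma p_cvg0 : p_ alpha n @[n --> \oo] --> (0 : R).
Proof. exact: powRN_natr_cvg0. Qed.

Lemma np_cvg : (n%:R * p_ alpha n)^-1 @[n --> \oo] --> (0 : R).
Proof.
have h : 0 < 1 - alpha by rewrite subr_gt0; case/andP: halpha.
apply: cvg_trans (powRN_natr_cvg0 h); apply: near_eq_cvg; near=> n.
by rewrite natr_mul_powRN ?powRN//; near: n; exact: nbhs_infty_gt.
Unshelve. all: by end_near. Qed.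

End standard_sequences.

Lemma rank1_main {R : realType} (alpha beta : R) (w : forall n : nat, 'I_n -> R) :
  0 < alpha < 1 -> 0 < beta -> (forall n i, beta <= @w n i <= 1) ->
  let mu n := edge_prob alpha (rank1_weights (@w n)) in
  (forall (d : nat -> measure_display)
      (T : forall n, measurableType (d n))
      (P : forall n, probability (T n) R)
      (A : forall n, 'I_n -> 'I_n -> {RV (P n) >-> bool}),
    (forall n, random_graph (P n) (@A n) (mu n)) ->
    cvg_in_distribution P
      (fun n => standardized_triangles (P n) (@A n) (Num.sqrt (v_sq (mu n))))
      (normal_prob 0 1)) /\
  (fun n => v_sq (mu n)) ~_\oo
    (fun n => n%:R ^+ 3 / (6 * (\sum_i @w n i) ^+ 6 * p_ alpha n ^+ 3)).
Proof.
move=> ha hb hw mu.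
have muE n i j : mu n i j = rmu (p_ alpha n) (@w n) i j.
  by rewrite /mu /edge_prob /rank1_weights !mxE /rmu; case: eqP => // _; rewrite mulr0.
have hp := p_bounds ha; have pc := p_cvg0 ha; have npc := np_cvg ha.
split; last exact: (v_sq_equiv hp hb hw pc muE).
move=> d T P A hA t tc.
pose G s := (\int[lebesgue_measure]_(x in `]-oo, s]) normal_pdf 0 1 x)%R : R.
have GE s : normal_prob 0 1 `]-oo, s]%classic = (G s)%:E.
  by rewrite /G /Rintegral fineK//; exact: (fin_num_measure (normal_prob 0 1)).
have Gc : {for t, continuous G}.
  have tc' : normal_prob 0 1 `]-oo, s]%classic @[s --> t] --> (G t)%:E by rewrite -GE; exact: tc.
  exact: (fine_cvg tc').
suff : @cdf _ _ _ (P n) (standardized_triangles (P n) (@A n) (Num.sqrt (v_sq (mu n)))) t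
    @[n --> \oo] --> (G t)%:E by rewrite -GE.
have E n : @cdf _ _ _ (P n) (standardized_triangles (P n) (@A n) (Num.sqrt (v_sq (mu n)))) t =
   (Ex (rq (p_ alpha n) (@w n)) (fun a => ((wtri a - Ex (rq (p_ alpha n) (@w n)) wtri)
      / Num.sqrt (v_sq (mu n)) <= t)%R%:R))%:E.
  rewrite (cdf_standardized_triangles (hA n)); have -> // : (fun e : 'I_n * 'I_n => mu n e.1 e.2) = rq (p_ alpha n) (@w n).
  by apply/funext => e; rewrite muE.
under eq_fun do rewrite E.
apply: cvg_EFin; first by near=> n.
exact: (rank1_clt hp hb hw pc npc muE).
Unshelve. all: by end_near. Qed.

Theorem corollary2p5 (R : realType) (alpha beta : R)
    (halpha : 0 < alpha < 1) (hbeta : 0 < beta < 1) :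
  (forall w : forall n : nat, 'I_n -> R,
    (forall n i, beta <= w n i <= 1) ->
    let mu n := edge_prob alpha (rank1_weights (w n)) in
    (forall (d : nat -> measure_display)
        (T : forall n, measurableType (d n))
        (P : forall n, probability (T n) R)
        (A : forall n, 'I_n -> 'I_n -> {RV (P n) >-> bool}),
      (forall n, random_graph (P n) (A n) (mu n)) ->
      cvg_in_distribution P
        (fun n => standardized_triangles (P n) (A n) (Num.sqrt (v_sq (mu n))))
        (normal_prob 0 1)) /\
    (fun n => v_sq (mu n)) ~_\oo
      (fun n => n%:R ^+ 3 / (6 * (\sum_i w n i) ^+ 6 * p_ alpha n ^+ 3))) /\
  (forall c : R, 0 < c <= 1 ->
    let mu n := edge_prob alpha (er_weights n c) in
    (forall (d : nat -> measure_display)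
        (T : forall n, measurableType (d n))
        (P : forall n, probability (T n) R)
        (A : forall n, 'I_n -> 'I_n -> {RV (P n) >-> bool}),
      (forall n, random_graph (P n) (A n) (mu n)) ->
      cvg_in_distribution P
        (fun n => standardized_triangles (P n) (A n) (Num.sqrt (v_sq (mu n))))
        (normal_prob 0 1)) /\
    (fun n => v_sq (mu n)) ~_\oo
      (fun n => 1 / (6 * c ^+ 3 * n%:R `^ (3 * (1 - alpha))))).
Proof.
have [b0 _] := andP hbeta; split=> [w hw|c /andP[c0 c1]]; first exact: rank1_main halpha b0 hw.
(* The homogeneous graph is rank-1 with all weights [sqrt c], so [rank1_main] is applied with
   [sqrt c] itself as the lower bound on the weights. *)
have erE n : er_weights n c = rank1_weights (fun _ : 'I_n => Num.sqrt c).
  by apply/matrixP => i j; rewrite !mxE; case: eqP => // _; rewrite -expr2 sqr_sqrtr// ltW.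
have s0 : 0 < Num.sqrt c by rewrite sqrtr_gt0.
have hw (n : nat) (i : 'I_n) : Num.sqrt c <= Num.sqrt c <= 1.
  by rewrite lexx -[leRHS]sqrtr1 ler_sqrt.
move=> mu; have {}erE : mu = fun n => edge_prob alpha (rank1_weights (fun _ : 'I_n => Num.sqrt c)).
  by apply: functional_extensionality_dep => n; rewrite /mu erE.
rewrite {mu}erE.
have [clt equiv] := rank1_main halpha s0 hw; split=> [d T P A hA|]; first exact: clt.
rewrite [X in _ ~_\oo X](_ : _ = fun n : nat =>
  n%:R ^+ 3 / (6 * (\sum_(i < n) Num.sqrt c) ^+ 6 * p_ alpha n ^+ 3)) //.
apply/funext => n; rewrite sumr_const card_ord -(mulr_natr (Num.sqrt c)) exprMn.
have -> : Num.sqrt c ^+ 6 = c ^+ 3.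
  by rewrite (exprM _ 2 3) sqr_sqrtr// ltW.
(* At [n = 0] both sides are 0, the left one because the inverse of 0 is 0. *)
case: n => [|n].
  rewrite powR0 ?mulr0 ?invr0 ?mulr0 ?expr0n ?mul0r//.
  by rewrite mulf_neq0// gt_eqF// subr_gt0; case/andP: halpha.
have -> : n.+1%:R `^ (3 * (1 - alpha)) = (n.+1%:R * p_ alpha n.+1) ^+ 3.
  by rewrite natr_mul_powRN// mulrC powRrM powR_mulrn// powR_ge0.
have n0 : 0 < n.+1%:R :> R by rewrite ltr0n.
have := p_bounds halpha (ltn0Sn n) => /andP[p0 _].
move: (p_ alpha n.+1) p0 (n.+1%:R) n0 => p p0 x x0.
by field; rewrite !gt_eqF.
Qed.
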